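(* Let $n\in\mathbb Z^d\setminus\{0\}$ and suppose that $$-2\varrho_0\frac{g_1}{g_0}\widehat W_n>1 .$$ Then for each $K\in\mathbb N$ (i.e. $K\ge1$) there exists a unique critical value $\bar\alpha=\bar\alpha(K,n)>0$ such that the dispersion relation $$-\varrho_0g_0g_1\widehat W_n|q_n|^2I_n(\alpha;\lambda)=1$$ with $\alpha=\bar\alpha$ has the root $\lambda=0$. If $0<\alpha<\bar\alpha$, then all roots $\lambda\in\mathbb C$ of the dispersion relation have negative real parts (the Fourier mode $n$ is linearly asymptotically stable). If $\alpha>\bar\alpha$, then there exists a root with positive real part (the Fourier mode $n$ is linearly unstable).
   Context: $d,K\ge1$ are integers; $\Omega=(0,1)^d$ is the torus. $\varrho_0>0$ is fixed, $G:\mathbb R^+\to\mathbb R^+$ is bounded, positive, decreasing, $g_0:=G(\varrho_0)>0$, $g_1:=G'(\varrho_0)<0$. $W$ is nonnegative, bounded, radially symmetric, nonincreasing in $|x|$, compactly supported, periodically extended to $\Omega$, with $\int_\Omega W=1$. $q_n:=2\pi n$, $\widehat W_n:=\int_\Omega W(x)e^{-iq_n\cdot x}dx\in\mathbb R$. (The displayed hypothesis is exactly the condition for linear instability of the mode $n$ in the memoryless model $\partial_t\varrho=\frac12\Delta(G(W\ast\varrho)^2\varrho)$.) Linear stability or instability of mode $n$ in the model with memory is understood in terms of the real parts of the roots of the dispersion relation. For $\alpha>0$, $$I_n(\alpha;\lambda):=\int_0^\infty e^{-\lambda t}\,C_K(t)^2\exp\Big(-\frac{|q_n|^2}{2}V_\alpha(t)\Big)dt,\qquad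 C_K(t):=\frac1{(K-1)!}\int_0^te^{-\alpha s}s^{K-1}\,ds,$$ which converges for $\operatorname{Re}\lambda>-\frac{|q_n|^2g_0^2}{2}\alpha^{-2K}$ (roots are understood in this half-plane), and $V_\alpha(t):=\operatorname{Var}\big(\int_0^tY_s^1\,ds\big)$, where $(Y_s)_{s\ge0}$ is the stationary $\mathbb R^K$-valued Ornstein--Uhlenbeck process $dY_s=AY_s\,ds+g_0e_K\,dB_s$, $B$ a one-dimensional Brownian motion, $e_K=(0,\dots,0,1)^T$, $A_{kk}=-\alpha$, $A_{k,k+1}=1$, all other entries of $A\in\mathbb R^{K\times K}$ zero, and $Y_0$ independent of $B$ with the invariant law $\mathcal N(0,\Sigma)$, $\Sigma=g_0^2\int_0^\infty e^{tA}e_Ke_K^Te^{tA^T}dt$. *)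

(* Defs.v *)
From HB Require Import structures.
From mathcomp Require Import all_boot all_order all_algebra.
From mathcomp Require Import all_classical all_reals all_analysis.
From mathcomp Require Import complex.

Set Implicit Arguments.
Unset Strict Implicit.
Unset Printing Implicit Defensive.

Import Order.TTheory GRing.Theory Num.Theory.
Import numFieldNormedType.Exports.

Local Open Scope classical_set_scope.
Local Open Scope ring_scope.
Local Open Scope complex_scope.

(** * Complex exponential and complex-valued integrals *)

Definition cexp (R : realType) (z : R[i]) : R[i] :=
  let: a +i* b := z in (expR a * cos b) +i* (expR a * sin b).

Definition Cintegral (R : realType) (D : set R) (f : R -> R[i]) : R[i] :=
  Rintegral lebesgue_measure D (fun t => complex.Re (f t))
  +i* Rintegral lebesgue_measure D (fun t => complex.Im (f t)).

(** * Interaction kernel on the torus *)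

(* Squared Euclidean norm; the norm [`|x|] of the library is the sup norm. *)
Definition sqnorm2 (R : realType) (d : nat) (x : 'rV[R]_d) : R :=
  \sum_(i < d) x 0 i ^+ 2.

Definition dotv (R : realType) (d : nat) (x y : 'rV[R]_d) : R :=
  \sum_(i < d) x 0 i * y 0 i.

(* The integral over (0,1)^d, as an iterated integral; for the bounded Borel
   functions considered here this is the Lebesgue integral by Fubini. *)
Fixpoint cell_integral (R : realType) (d : nat) : ('rV[R]_d -> R) -> R :=
  match d with
  | 0 => fun f => f 0
  | d'.+1 => fun f =>
      Rintegral lebesgue_measure `]0, 1[
        (fun x => cell_integral (fun y : 'rV[R]_d' =>
           f (row_mx (x%:M : 'rV[R]_1) y)))
  end.

(* The Z^d-periodic extension. For compactly supported [W] the sum is finite at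
   each point, and if [W] is supported in (-1/2,1/2)^d it is the function that
   repeats [W] on each translate of that cube. *)
Definition periodize (R : realType) (d : nat) (W : 'rV[R]_d -> R)
    (x : 'rV[R]_d) : R :=
  \sum_(k \in [set: 'rV[int]_d]) W (x + map_mx intr k).

Record interaction_kernel (R : realType) (d : nat) (W : 'rV[R]_d -> R) : Prop :=
  InteractionKernel {
    kernel_ge0 : forall x, 0 <= W x;
    kernel_bounded : exists M : R, forall x, W x <= M;
    kernel_radial : forall x y, sqnorm2 x = sqnorm2 y -> W x = W y;
    kernel_nonincreasing : forall x y, sqnorm2 x <= sqnorm2 y -> W y <= W x;
    kernel_compact_support : compact (closure [set x | W x != 0]);
    kernel_normalized : cell_integral (periodize W) = 1 }.

Definition wavevector (R : realType) (d : nat) (n : 'rV[int]_d) : 'rV[R]_d :=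
  (2 * pi) *: map_mx intr n.
Arguments wavevector R {d} n.

(* \int_Omega W(x) exp(-i q_n . x) dx, split into real and imaginary part.
   It is real by the symmetry of W; since the order of R[i] only compares numbers
   with the same imaginary part, an inequality 1 < c%:C * fourier_coef W n is the
   inequality between real numbers. *)
Definition fourier_coef (R : realType) (d : nat) (W : 'rV[R]_d -> R)
    (n : 'rV[int]_d) : R[i] :=
  let e (x : 'rV[R]_d) := cexp (0 -i* dotv (wavevector R n) x) in
  cell_integral (fun x => periodize W x * complex.Re (e x))
  +i* cell_integral (fun x => periodize W x * complex.Im (e x)).

(** * Brownian motion and the Ornstein-Uhlenbeck process *)

Definition sigma_generated (R : realType) (disp : measure_display)
    (T : measurableType disp) (I : Type) (J : set I) (X : I -> T -> R) :
    set (set T) :=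
  <<s [set A | exists2 i, J i & exists2 E : set R, measurable E &
         A = X i @^-1` E] >>.

Definition independent_systems (R : realType) (disp : measure_display)
    (T : measurableType disp) (P : probability T R) (F G : set (set T)) : Prop :=
  forall A B, F A -> G B -> P (A `&` B) = (P A * P B)%E.

(* X has law N(m, v), where v is the variance. The degenerate case is separate
   because [normal_prob] takes the standard deviation as argument and is not a
   Dirac mass when it is 0. *)
Definition has_normal_law (R : realType) (disp : measure_display)
    (T : measurableType disp) (P : probability T R) (m v : R) (X : T -> R) :
    Prop :=
  forall E : set R, measurable E ->
    P (X @^-1` E) = if v == 0 then dirac m E else normal_prob m (Num.sqrt v) E.

(* X has law N(0, S): each linear combination u.X has law N(0, u^T S u). *)
Definition has_centered_gaussian_law (R : realType) (disp : measure_display)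
    (T : measurableType disp) (P : probability T R) (K : nat) (S : 'M[R]_K)
    (X : 'I_K -> T -> R) : Prop :=
  forall u : 'cV[R]_K,
    has_normal_law P 0 ((u^T *m S *m u) 0 0)
      (fun w => \sum_(k < K) u k 0 * X k w).

(* Time runs in [0, +oo[; the values at negative times are irrelevant. *)
Record brownian_motion (R : realType) (disp : measure_display)
    (T : measurableType disp) (P : probability T R) (B : R -> {RV P >-> R}) :
    Prop := BrownianMotion {
  bm_start : {ae P, forall w, B 0 w = 0};
  bm_continuous : forall w, {within `[0, +oo[, continuous (fun t => B t w)};
  bm_increment : forall s t, 0 <= s -> s < t ->
    has_normal_law P 0 (t - s) (fun w => B t w - B s w);
  bm_independent : forall s t, 0 <= s -> s < t ->
    independent_systems P
      (sigma_generated `[0, s] B)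
      (sigma_generated [set: unit] (fun _ w => B t w - B s w)) }.

Definition ou_drift (R : realType) (K : nat) (alpha : R) : 'M[R]_K :=
  \matrix_(k < K, l < K)
    (if l == k then - alpha else if l == k.+1 :> nat then 1 else 0).

(* (0, ..., 0, 1)^T *)
Definition ou_noise (R : realType) (K : nat) : 'cV[R]_K :=
  \col_(k < K) (k.+1 == K)%:R.

Definition expmx (R : realType) (K : nat) (M : 'M[R]_K) : 'M[R]_K :=
  \matrix_(k < K, l < K)
    limn (fun N : nat => (\sum_(j < N) (j`!%:R)^-1 *: (M ^+ j)) k l).

Definition ou_covariance (R : realType) (K : nat) (alpha g0 : R) : 'M[R]_K :=
  let A := ou_drift K alpha in
  let e := ou_noise R K in
  \matrix_(k < K, l < K)
    (g0 ^+ 2 * Rintegral lebesgue_measure `[0, +oo[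
       (fun t => (expmx (t *: A) *m e *m e^T *m expmx (t *: A^T)) k l)).

(* The noise being additive, the stochastic differential equation is the
   pathwise integral equation
   Y_t = Y_0 + \int_0^t A Y_s ds + g0 B_t e_K. *)
Record stationary_ou (R : realType) (K : nat) (alpha g0 : R)
    (disp : measure_display) (T : measurableType disp) (P : probability T R)
    (B : R -> {RV P >-> R}) (Y : R -> 'I_K -> {RV P >-> R}) : Prop :=
  StationaryOU {
    ou_brownian : brownian_motion B;
    ou_initial_law : has_centered_gaussian_law P (ou_covariance K alpha g0) (Y 0);
    ou_initial_independent :
      independent_systems P
        (sigma_generated [set: 'I_K] (Y 0))
        (sigma_generated `[0, +oo[ B);
    ou_continuous : forall w k,
      {within `[0, +oo[, continuous (fun t => Y t k w)};
    ou_equation : {ae P, forall w, forall (t : R) (k : 'I_K), 0 <= t ->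
      Y t k w =
        Y 0 k w
        + Rintegral lebesgue_measure `[0, t]
            (fun s => (ou_drift K alpha *m \col_(l < K) Y s l w) k 0)
        + g0 * ou_noise R K k 0 * B t w} }.

Definition integral_variance (R : realType) (disp : measure_display)
    (T : measurableType disp) (P : probability T R) (X : R -> {RV P >-> R})
    (t : R) : R :=
  fine 'V_P [fun w => Rintegral lebesgue_measure `[0, t] (fun s => X s w)].

(** * The dispersion relation *)

Definition memory_coef (R : realType) (K : nat) (alpha t : R) : R :=
  ((K.-1)`!%:R)^-1 * Rintegral lebesgue_measure `[0, t]
    (fun s => expR (- alpha * s) * s ^+ K.-1).

(* I_n(alpha; lambda), with [q2] for |q_n|^2 and [V] for V_alpha. *)
Definition memory_integral (R : realType) (K : nat) (q2 alpha : R) (V : R -> R)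
    (lambda : R[i]) : R[i] :=
  Cintegral `[0, +oo[ (fun t =>
    cexp (- lambda * t%:C)
    * (memory_coef K alpha t ^+ 2 * expR (- (q2 / 2) * V t))%:C).

(* [lambda] lies in the half-plane of convergence and solves the relation. *)
Definition dispersion_root (R : realType) (K : nat) (rho0 g0 g1 : R) (What : R[i])
    (q2 alpha : R) (V : R -> R) (lambda : R[i]) : Prop :=
  - (q2 * g0 ^+ 2 / 2) * alpha ^- (2 * K) < complex.Re lambda /\
  - (rho0 * g0 * g1)%:C * What * q2%:C * memory_integral K q2 alpha V lambda = 1.

(* Main.v *)
Require Import Defs.
From HB Require Import structures.
From mathcomp Require Import all_boot all_order all_algebra.
From mathcomp Require Import all_classical all_reals all_analysis.
From mathcomp Require Import measurable_realfun complex ring lra zify.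

Set Implicit Arguments.
Unset Strict Implicit.
Unset Printing Implicit Defensive.

Import Order.TTheory GRing.Theory Num.Theory.
Import numFieldNormedType.Exports.

Local Open Scope classical_set_scope.
Local Open Scope ring_scope.

(* Put m = K - 1, C = C_K, and let p_k(s) = exp(-alpha s) s^k / k! and c_k be the
   primitive of p_k vanishing at 0, so that C = c_m.  Since c_k(t - s) solves the
   adjoint equation, int_0^t Y^1 = sum_k c_k(t) Y_0^k + g0 int_0^t C(t - s) dB_s, and
   independence gives V_alpha = g0^2 M with
     M(t) = int_0^t C^2 + sum_{k,l} S_{kl} c_k(t) c_l(t),
     S_{kl} = int_0^oo p_{m-k} p_{m-l}.
   Rescaling time by alpha turns the relation at lambda = 0 into kappa J(b) = 1, where
   kappa = -2 rho0 (g1/g0) What > 1, b = |q_n|^2 g0^2 / (2 alpha^(2m+3)) and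
   J(b) = int_0^oo b C^2 exp(-b M) for alpha = 1.  J decreases strictly from 1 at 0+
   to 0 at +oo: the difference of b M' exp(-b M) for two values of b has integral zero
   and one change of sign, and C^2/M' increases because p_k/C and c_k/C decrease.
   For alpha below the critical value and Re lambda >= 0, the modulus of the left-hand
   side is at most its value at lambda = 0, which is < 1; above it, that value is > 1
   and the left-hand side tends to 0 along the positive real axis. *)

(** For fixed [u > 0] the integrand [b C^2 exp(-b M)] is not monotone in [b], so [J] cannot be
    compared pointwise. But [b M' exp(-b M)] is a probability density, and [J(b)] is the mean of
    [C^2 / M'] under it; as [b] grows this law moves towards 0, where the quotient is smaller. The
    limits of [J] come from [M = F + D], with [F = int_0^t C^2] due to the noise and [D] due to
    [Y_0]: [b C^2 exp(-b F)] has integral 1, [D] is bounded, which gives the limit 1 at 0, and [D]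
    is nondecreasing and dominates a multiple of [C^2], which gives the limit 0 at infinity. On the
    probabilistic side [Y] is known only through its pathwise integral equation. Integration by
    parts replaces [int_0^t C(t - s) dB_s] by [int_0^t p_m(t - s) B_s ds], the boundary terms
    vanishing with [C(0)] and [B_0]. For each path this is a limit of sums [sum_i w_i B(s_i)], whose
    covariances follow from [min(s, r)]; the first two moments pass to the limit by Fatou's
    lemma. *)

Section Calculus.
Context {R : realType}.
Implicit Types (f F : R -> R) (a b t x : R).

Lemma is_derive_continuous F f x : is_derive x 1 F (f x) -> {for x, continuous F}.
Proof. by move=> dF; apply/differentiable_continuous/derivable1_diffP; exact: ex_derive. Qed.

Lemma within_continuous (A : set R) f : continuous f -> {within A, continuous f}.
Proof. exact: continuous_subspaceT. Qed.

Lemma continuous_integrable f a b : continuous f ->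
  lebesgue_measure.-integrable `[a, b] (EFin \o f).
Proof.
move=> cf; apply: continuous_compact_integrable; first exact: segment_compact.
exact: continuous_subspaceT.
Qed.

Lemma Rintegral_FTC f F a b : a <= b -> continuous f ->
  (forall x, a <= x <= b -> is_derive x 1 F (f x)) ->
  \int[lebesgue_measure]_(x in `[a, b]) f x = F b - F a.
Proof.
rewrite le_eqVlt => /orP[/eqP <- cf dF|ab cf dF].
  by rewrite set_itv1 Rintegral_set1 subrr.
rewrite /Rintegral (@continuous_FTC2 _ f F a b ab) //.
- exact: continuous_subspaceT.
- split.
  + by move=> x; rewrite in_itv/= => /andP[ax xb]; have [] := dF x; rewrite ?(ltW ax) ?(ltW xb).
  + apply: cvg_at_right_filter. apply: (@is_derive_continuous F f); apply: dF. by rewrite lexx ltW.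
  + apply: cvg_at_left_filter. apply: (@is_derive_continuous F f); apply: dF. by rewrite lexx ltW.
- move=> x; rewrite in_itv/= => /andP[ax xb].
  rewrite derive1E; apply: derive_val. apply: dF. by rewrite (ltW ax) (ltW xb).
Qed.

(** The base point -1 gives a two-sided derivative at 0, so the primitive can be used in
    [Rintegral_FTC] on every [[0, t]]. *)
Lemma primitive_exists f : continuous f ->
  exists F, forall x, -1 < x -> is_derive x 1 F (f x).
Proof.
move=> cf; exists (fun x => \int[lebesgue_measure]_(t in `[-1, x]) f t) => x x1.
have := @continuous_FTC1_closed _ f (-1) x (x + 1) _ (continuous_integrable _ _ cf) x1 (cf x).
rewrite ltrDl ltr01 => /(_ isT)[d1 d2].
by apply: DeriveDef; [exact: d1|rewrite -derive1E; exact: d2].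
Qed.

Lemma is_derive_within_continuous F f a b :
  (forall x, a <= x <= b -> is_derive x 1 F (f x)) -> {within `[a, b], continuous F}.
Proof.
move=> dF; apply: derivable_within_continuous => x.
by rewrite in_itv/= => xab; have [] := dF _ xab.
Qed.

Lemma ger0_is_derive_le F f a b : a <= b ->
  (forall x, a <= x <= b -> is_derive x 1 F (f x)) ->
  (forall x, a < x < b -> 0 <= f x) -> F a <= F b.
Proof.
rewrite le_eqVlt => /orP[/eqP -> //|ab] dF f0.
have dF' x : x \in `]a, b[ -> is_derive x 1 F (f x).
  by rewrite in_itv/= => /andP[ax xb]; apply: dF; rewrite !ltW.
have [c cab e] := MVT ab dF' (is_derive_within_continuous dF).
rewrite -subr_ge0 e mulr_ge0 ?subr_ge0 ?(ltW ab)//; apply: f0.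
by move: cab; rewrite in_itv.
Qed.

Lemma gtr0_is_derive_lt F f a b : a < b ->
  (forall x, a <= x <= b -> is_derive x 1 F (f x)) ->
  (forall x, a < x < b -> 0 < f x) -> F a < F b.
Proof.
move=> ab dF f0.
have dF' x : x \in `]a, b[ -> is_derive x 1 F (f x).
  by rewrite in_itv/= => /andP[ax xb]; apply: dF; rewrite !ltW.
have [c cab e] := MVT ab dF' (is_derive_within_continuous dF).
rewrite -subr_gt0 e mulr_gt0 ?subr_gt0 ?ab//; apply: f0.
by move: cab; rewrite in_itv.
Qed.
End Calculus.

(* The pointwise forms of the differentiation rules: the library states them for
   sums and products in the ring of functions. *)
Section IsDeriveFun.
Context {R : realType}.
Implicit Types (f g : R -> R) (c x df dg : R).

Lemma is_derive_fcst c x : is_derive x 1 (fun=> c) 0.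
Proof. exact: is_derive_cst. Qed.

Lemma is_derive_fid x : is_derive x 1 (fun y : R => y) 1.
Proof. exact: is_derive_id. Qed.

Lemma is_derive_fD f g x df dg : is_derive x 1 f df -> is_derive x 1 g dg ->
  is_derive x 1 (fun y => f y + g y) (df + dg).
Proof. exact: is_deriveD. Qed.

Lemma is_derive_fB f g x df dg : is_derive x 1 f df -> is_derive x 1 g dg ->
  is_derive x 1 (fun y => f y - g y) (df - dg).
Proof. exact: is_deriveB. Qed.

Lemma is_derive_fN f x df : is_derive x 1 f df ->
  is_derive x 1 (fun y => - f y) (- df).
Proof. exact: is_deriveN. Qed.

Lemma is_derive_fM f g x df dg : is_derive x 1 f df -> is_derive x 1 g dg ->
  is_derive x 1 (fun y => f y * g y) (df * g x + f x * dg).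
Proof.
move=> hf hg; apply: (is_derive_eq (is_deriveM hf hg)).
by rewrite addrC [df * _]mulrC.
Qed.

Lemma is_derive_fZ c f x df : is_derive x 1 f df ->
  is_derive x 1 (fun y => c * f y) (c * df).
Proof. exact: is_deriveZ. Qed.

Lemma is_derive_fcomp f g x df dg : is_derive x 1 g dg ->
  is_derive (g x) 1 f df -> is_derive x 1 (fun y => f (g y)) (df * dg).
Proof. by move=> hg hf; exact: is_derive1_comp hf hg. Qed.

Lemma is_derive_fsum (I : Type) (r : seq I) (F : I -> R -> R) (dF : I -> R) x :
  (forall i, is_derive x 1 (F i) (dF i)) ->
  is_derive x 1 (fun y => \sum_(i <- r) F i y) (\sum_(i <- r) dF i).
Proof.
move=> dFi; elim: r => [|i r ih].
  by under eq_fun do rewrite big_nil; rewrite big_nil; exact: is_derive_fcst.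
under eq_fun do rewrite big_cons.
by rewrite big_cons; exact: is_derive_fD.
Qed.
End IsDeriveFun.

(** * Erlang densities and their primitives *)

(** Times [a ^+ k.+1], this is the density of the Erlang law of shape [k + 1] and rate [a]. It is
    also the entry of [exp(s A)] on the k-th superdiagonal, for [A] the drift matrix of the
    process. *)
Definition erlang {R : realType} (a : R) (k : nat) (s : R) : R :=
  expR (- a * s) * s ^+ k / k`!%:R.

(* The primitive of [erlang a k] vanishing at 0, for [a != 0]; the recursion is an
   integration by parts. *)
Fixpoint erlang_int {R : realType} (a : R) (k : nat) (s : R) : R :=
  match k with
  | 0 => (1 - erlang a 0 s) / a
  | k'.+1 => (erlang_int a k' s - erlang a k s) / a
  end.

Section Erlang.
Context {R : realType}.
Implicit Types (a b s t : R) (k l m : nat).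

Lemma erlang0 a s : erlang a 0 s = expR (- a * s).
Proof. by rewrite /erlang fact0 divr1 expr0 mulr1. Qed.

Lemma erlangS a k s : erlang a k.+1 s = k.+1%:R^-1 * (s * erlang a k s).
Proof.
rewrite /erlang factS natrM exprS.
have h1 : (k`!)%:R != 0 :> R by rewrite pnatr_eq0 -lt0n fact_gt0.
have h2 : (k.+1)%:R != 0 :> R by rewrite pnatr_eq0.
by field; rewrite h1 nat1r h2.
Qed.

Lemma is_derive_erlang a k s : is_derive s 1 (erlang a k)
  ((if k is k'.+1 then erlang a k' s else 0) - a * erlang a k s).
Proof.
elim: k => [|k ih].
  rewrite (_ : erlang a 0 = (fun s => expR (- a * s))); last first.
    by apply/funext => x; rewrite erlang0.
  apply: (is_derive_eq (is_derive_fcomp (is_derive_fZ (- a) (is_derive_fid s)) (is_derive_expR _))).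
  by rewrite mulr1 sub0r mulrC mulNr.
rewrite (_ : erlang a k.+1 = (fun s => k.+1%:R^-1 * (s * erlang a k s))); last first.
  by apply/funext => x; rewrite erlangS.
apply: (is_derive_eq (is_derive_fZ _ (is_derive_fM (is_derive_fid s) ih))).
have h2 : (k.+1)%:R != 0 :> R by rewrite pnatr_eq0.
case: k ih h2 => [|k] ih h2; first by field.
have h1 : (k.+1)%:R != 0 :> R by rewrite pnatr_eq0.
rewrite erlangS; move: (erlang a k s) => e.
by field; rewrite !nat1r h1 /= -[2]/(1 + 1) -addrA !nat1r h2.
Qed.

Lemma continuous_erlang a k : continuous (erlang a k).
Proof.
move=> s; apply/differentiable_continuous/derivable1_diffP.
by have [] := is_derive_erlang a k s.
Qed.

Lemma is_derive_erlang_int a k s : a != 0 ->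
  is_derive s 1 (erlang_int a k) (erlang a k s).
Proof.
move=> a0; elim: k => [|k ih].
  have h := is_derive_fZ a^-1 (is_derive_fB (is_derive_fcst 1 s) (is_derive_erlang a 0 s)).
  rewrite (_ : erlang_int a 0 = (fun y => a^-1 * (1 - erlang a 0 y))); last first.
    by apply/funext => x; rewrite /= mulrC.
  by apply: (is_derive_eq h); field.
have h := is_derive_fZ a^-1 (is_derive_fB ih (is_derive_erlang a k.+1 s)).
rewrite (_ : erlang_int a k.+1 = (fun y => a^-1 * (erlang_int a k y - erlang a k.+1 y))); last first.
  by apply/funext => x; rewrite /= mulrC.
by apply: (is_derive_eq h); field.
Qed.

Lemma continuous_erlang_int a k : a != 0 -> continuous (erlang_int a k).
Proof.
move=> a0 s; apply/differentiable_continuous/derivable1_diffP.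
by have [] := is_derive_erlang_int k s a0.
Qed.

Lemma erlang_at0 a k : erlang a k 0 = (k == 0)%:R.
Proof.
rewrite /erlang mulr0 expR0 mul1r expr0n; case: k => [|k]; last by rewrite mul0r.
by rewrite fact0 divr1.
Qed.

Lemma erlang_int_at0 a k : erlang_int a k 0 = 0.
Proof.
elim: k => [|k ih] /=; first by rewrite erlang_at0 subrr mul0r.
by rewrite ih erlang_at0 subrr mul0r.
Qed.

Lemma erlang_ge0 a k s : 0 <= s -> 0 <= erlang a k s.
Proof. by move=> s0; rewrite !mulr_ge0 ?expR_ge0 ?exprn_ge0 ?invr_ge0. Qed.

Lemma erlang_gt0 a k s : 0 < s -> 0 < erlang a k s.
Proof.
by move=> s0; rewrite !mulr_gt0 ?expR_gt0 ?exprn_gt0 ?invr_gt0 ?ltr0n ?fact_gt0.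
Qed.

Lemma Rintegral_erlang a k t : a != 0 -> 0 <= t ->
  \int[lebesgue_measure]_(s in `[0, t]) erlang a k s = erlang_int a k t.
Proof.
move=> a0 t0; rewrite (Rintegral_FTC t0 (@continuous_erlang a k) (fun x _ => is_derive_erlang_int k x a0)).
by rewrite erlang_int_at0 subr0.
Qed.

Lemma erlang_int_ltr a k s t : a != 0 -> 0 <= s -> s < t ->
  erlang_int a k s < erlang_int a k t.
Proof.
move=> a0 s0 st; apply: (gtr0_is_derive_lt (f := erlang a k) st).
- by move=> x _; exact: is_derive_erlang_int.
- by move=> x /andP[sx _]; apply: erlang_gt0; exact: le_lt_trans sx.
Qed.

Lemma erlang_int_gt0 a k t : a != 0 -> 0 < t -> 0 < erlang_int a k t.
Proof. by move=> a0 t0; rewrite -(erlang_int_at0 a k) erlang_int_ltr. Qed.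

Lemma erlang_int_ge0 a k t : a != 0 -> 0 <= t -> 0 <= erlang_int a k t.
Proof.
move=> a0; rewrite le_eqVlt => /orP[/eqP <-|]; first by rewrite erlang_int_at0.
by move=> t0; rewrite ltW// erlang_int_gt0.
Qed.

Lemma erlang_int_le a k t : 0 < a -> 0 <= t -> erlang_int a k t <= a ^- k.+1.
Proof.
move=> a0 t0; elim: k => [|k ih] /=.
  by rewrite expr1 ler_piMl ?invr_ge0 ?(ltW a0)// lerBlDr lerDl erlang_ge0.
rewrite exprSr invfM mulrC [leRHS]mulrC ler_wpM2l ?invr_ge0 ?(ltW a0)//.
by rewrite (le_trans _ ih)// lerBlDr lerDl erlang_ge0.
Qed.

(** The primitive of index [k.+1] is [(erlang_int a k t - erlang a k.+1 t) / a]; its nonnegativity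
    bounds the density by the primitive one index below. *)
Lemma erlang_le a k t : 0 < a -> 0 <= t -> erlang a k t <= a ^- k.
Proof.
move=> a0 t0; case: k => [|k].
  by rewrite erlang0 expr0 invr1 -[leRHS]expR0 ler_expR mulNr oppr_le0 mulr_ge0// ltW.
have h := erlang_int_ge0 k.+1 (lt0r_neq0 a0) t0.
rewrite (le_trans _ (erlang_int_le k a0 t0))//.
by move: h; rewrite /= pmulr_lge0 ?invr_gt0// subr_ge0.
Qed.

(** [erlang a k s] is [(k + 1) / s] times [erlang a k.+1 s], which is bounded. *)
Lemma erlang_cvg0 a k : 0 < a -> erlang a k s @[s --> +oo] --> 0.
Proof.
move=> a0.
pose C := k.+1%:R * a ^- k.+1.
have Cs : C * s^-1 @[s --> +oo] --> 0.
  rewrite -[X in _ --> X](mulr0 C); apply: cvgM; first exact: cvg_cst.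
  apply/(@gtr0_cvgV0 _ _ _ _ id); last exact: cvg_id.
  by near=> s.
apply: squeeze_cvgr (cvg_cst 0) Cs.
near=> s.
have s0 : 0 < s by [].
rewrite erlang_ge0 ?(ltW s0)//=.
have -> : erlang a k s = k.+1%:R * erlang a k.+1 s * s^-1.
    rewrite erlangS; have h2 : (k.+1)%:R != 0 :> R by rewrite pnatr_eq0.
    by field; rewrite nat1r h2 lt0r_neq0.
by rewrite ler_wpM2r ?invr_ge0 ?(ltW s0)// ler_wpM2l// erlang_le// ltW.
Unshelve. all: by end_near. Qed.

Lemma erlang_int_cvg a k : 0 < a -> erlang_int a k s @[s --> +oo] --> a ^- k.+1.
Proof.
move=> a0; elim: k => [|k ih] /=.
  rewrite [X in _ --> X](_ : _ = (1 - 0) / a); last by rewrite subr0 mul1r expr1.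
  apply: cvgM; last exact: cvg_cst.
  by apply: cvgB; [exact: cvg_cst|exact: erlang_cvg0].
rewrite [X in _ --> X](_ : _ = (a ^- k.+1 - 0) / a); last first.
  by rewrite subr0 exprS invfM mulrC.
apply: cvgM; last exact: cvg_cst.
by apply: cvgB => //; exact: erlang_cvg0.
Qed.

Lemma integral_erlangy a k : 0 < a ->
  (\int[lebesgue_measure]_(s in `[0%R, +oo[) (erlang a k s)%:E = (a ^- k.+1)%:E)%E.
Proof.
move=> a0; have aN := lt0r_neq0 a0.
transitivity ((a ^- k.+1)%:E - (erlang_int a k 0)%:E)%E; last first.
  by rewrite erlang_int_at0 sube0.
apply: ge0_continuous_FTC2y.
- by move=> x x0; exact: erlang_ge0.
- by apply: continuous_subspaceT; exact: continuous_erlang.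
- exact: erlang_int_cvg.
- by move=> x _; have [] := is_derive_erlang_int k x aN.
- by apply: cvg_at_right_filter; exact: continuous_erlang_int.
- move=> x _; rewrite derive1E; apply: derive_val; exact: is_derive_erlang_int.
Qed.

Lemma Rintegral_erlangy a k : 0 < a ->
  \int[lebesgue_measure]_(s in `[0, +oo[) erlang a k s = a ^- k.+1.
Proof. by move=> a0; rewrite /Rintegral integral_erlangy. Qed.

(** Makes the entries of the stationary covariance explicit; the binomial coefficient comes from the
    normalisations by factorials. *)
Lemma erlangM a k l s :
  erlang a k s * erlang a l s = 'C(k + l, k)%:R * erlang (2 * a) (k + l) s.
Proof.
have fN j : j`!%:R != 0 :> R by rewrite pnatr_eq0 -lt0n fact_gt0.
have -> : erlang (2 * a) (k + l) s =
    expR (- a * s) * expR (- a * s) * (s ^+ k * s ^+ l) / (k + l)`!%:R.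
  by rewrite /erlang exprD -expRD; congr (expR _ * _ * _); ring.
have e : (k + l)`!%:R = 'C(k + l, k)%:R * k`!%:R * l`!%:R :> R.
  by rewrite -!natrM -(bin_fact (leq_addr l k)) addKn mulnA.
have bN : 'C(k + l, k)%:R != 0 :> R.
  by rewrite pnatr_eq0 -lt0n bin_gt0 leq_addr.
rewrite e /erlang. by field; rewrite !fN bN.
Qed.

End Erlang.

(** * The renewal equation *)

Section HalfLineIntegral.
Context {R : realType}.
Implicit Types (f g : R -> R) (a b u v x : R).
Notation mu := (@lebesgue_measure R).

Lemma ge0_integrable_of_Rintegrable (D : set R) f (l : R) : measurable D ->
  measurable_fun D f -> (forall x, D x -> 0 <= f x) ->
  (\int[mu]_(x in D) (f x)%:E = l%:E)%E -> mu.-integrable D (EFin \o f).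
Proof.
move=> mD mf f0 fl; apply/integrableP; split; first exact/measurable_EFinP.
rewrite [ltLHS](_ : _ = \int[mu]_(x in D) (f x)%:E)%E; first by rewrite fl ltry.
by apply: eq_integral => x; rewrite inE => Dx; rewrite /= ger0_norm// f0.
Qed.

Lemma le_integrable_real (D : set R) f g : measurable D -> measurable_fun D f ->
  (forall x, D x -> `|f x| <= g x) ->
  mu.-integrable D (EFin \o g) -> mu.-integrable D (EFin \o f).
Proof.
move=> mD mf fg; apply: le_integrable => //; first exact/measurable_EFinP.
by move=> x Dx /=; rewrite lee_fin (le_trans (fg x Dx))// ler_norm.
Qed.

Lemma continuous_measurable (D : set R) f : continuous f -> measurable_fun D f.
Proof. by move=> cf; apply: measurable_funTS; exact: continuous_measurable_fun. Qed.

(** The minimum of [f] over [[v + 1, v + 2]], an interval of length 1, is a positive lower bound of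
    the integral. *)
Lemma Rintegral_gt0 f v : continuous f -> 0 <= v ->
  (forall x, 0 <= x -> 0 <= f x) -> (forall x, v < x -> 0 < f x) ->
  mu.-integrable `[0, +oo[ (EFin \o f) ->
  0 < \int[mu]_(x in `[0, +oo[) f x.
Proof.
move=> cf v0 f0 fp intf.
have [c + cm] : exists2 c, c \in `[v + 1, v + 2] & forall x, x \in `[v + 1, v + 2] -> f c <= f x.
  by apply: EVT_min; [lra|exact: continuous_subspaceT].
rewrite in_itv/= => /andP[c1 c2].
have sub : `[v + 1, v + 2] `<=` `[0, +oo[%classic.
  by move=> x /=; rewrite !in_itv/= => /andP[x1 x2]; rewrite andbT; lra.
apply: (@lt_le_trans _ _ (f c)); first by apply: fp; lra.
have -> : f c = \int[mu]_(x in `[v + 1, v + 2]) f c.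
  rewrite Rintegral_cst//= lebesgue_measure_itv/= lte_fin ifT; last lra.
  by rewrite -EFinD/= (_ : v + 2 - (v + 1) = 1) ?mulr1//; lra.
apply: (@le_trans _ _ (\int[mu]_(x in `[v + 1, v + 2]) f x)).
  apply: le_Rintegral => //.
  - by apply: continuous_integrable; exact: cst_continuous.
  - exact: continuous_integrable.
rewrite /Rintegral fine_le//.
- by apply: integrable_fin_num => //; exact: continuous_integrable.
- exact: integrable_fin_num.
- apply: ge0_subset_integral => //.
    by apply/measurable_EFinP; exact: continuous_measurable.
  by move=> x /=; rewrite in_itv/= andbT => x0; rewrite lee_fin f0.
Qed.

End HalfLineIntegral.

Section RenewalIntegral.
Context {R : realType}.
Notation mu := (@lebesgue_measure R).
Variables q M dM : R -> R.
Hypothesis cq : continuous q.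
Hypothesis q_ge0 : forall u, 0 <= u -> 0 <= q u.
Hypothesis cM : continuous M.
Hypothesis cdM : continuous dM.
Hypothesis dMP : forall u : R, 0 < u -> is_derive u 1 M (dM u).
Hypothesis M0 : M 0 = 0.
Hypothesis q0 : q 0 = 0.
Hypothesis q_le : forall u, 0 <= u -> q u <= dM u.
Hypothesis My : M u @[u --> +oo] --> +oo.

Implicit Types (u v b : R).
(** For [f = dM], the density of the time at which [M] reaches the level of an exponential variable
    of rate [b]. *)
Let dens (f : R -> R) (b u : R) : R := b * f u * expR (- b * M u).

Let c_expM b : continuous (fun u => expR (- b * M u)).
Proof.
move=> u; apply: (@continuous_comp _ _ _ (fun u => - b * M u) expR).
  by apply: cvgM; [exact: cvg_cst|exact: cM].
exact: continuous_expR.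
Qed.

Let c_dens f b : continuous f -> continuous (dens f b).
Proof.
move=> cf u; apply: cvgM; last exact: c_expM.
by apply: cvgM; [exact: cvg_cst|exact: cf].
Qed.

Let dM_ge0 u : 0 <= u -> 0 <= dM u.
Proof. by move=> u0; rewrite (le_trans (q_ge0 u0)) ?q_le. Qed.

(** The primitive [- exp(-b M)] rises from -1, where [M] is 0, to 0 as [M] tends to infinity. *)
Lemma integral_renewal_density b : 0 < b ->
  (\int[mu]_(u in `[0%R, +oo[) (dens dM b u)%:E = 1)%E.
Proof.
move=> b0.
have dE u : 0 < u -> is_derive u 1 (fun u => - expR (- b * M u)) (dens dM b u).
  move=> u0; apply: (is_derive_eq (is_derive_fN (is_derive_fcomp (is_derive_fZ (- b) (dMP u0)) (is_derive_expR _)))).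
  by rewrite /dens; ring.
rewrite (@ge0_continuous_FTC2y _ _ (fun u => - expR (- b * M u)) 0 0).
- by rewrite M0 mulr0 expR0 -EFinB sub0r opprK.
- by move=> x x0; rewrite /dens !mulr_ge0 ?expR_ge0 ?dM_ge0 ?(ltW b0).
- exact/continuous_subspaceT/c_dens.
- rewrite -oppr0; apply: cvgN.
  rewrite [X in X @ _ --> _](_ : _ = (fun x => expR (- x)) \o (fun u => b * M u)); last first.
    by apply/funext => u /=; rewrite mulNr.
  apply: cvg_comp; last exact: cvgr_expR.
  exact: gt0_cvgMry b0 My.
- by move=> x x0; have [] := dE x x0.
- apply: cvg_at_right_filter; apply: (@cvgN _ R^o); exact: c_expM.
- move=> x; rewrite in_itv/= andbT => x0.
  by rewrite derive1E; have [_ ->] := dE x x0.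
Qed.

Lemma integrable_renewal_density b : 0 < b ->
  mu.-integrable `[0, +oo[ (EFin \o dens dM b).
Proof.
move=> b0; apply: (ge0_integrable_of_Rintegrable (l := 1)) => //.
- by apply: continuous_measurable; exact: c_dens.
- move=> x /=; rewrite in_itv/= andbT => x0.
  by rewrite /dens !mulr_ge0 ?expR_ge0 ?dM_ge0 ?(ltW b0).
- exact: integral_renewal_density.
Qed.

Lemma integrable_renewal b : 0 < b -> mu.-integrable `[0, +oo[ (EFin \o dens q b).
Proof.
move=> b0; apply: le_integrable_real (integrable_renewal_density b0) => //.
  by apply: continuous_measurable; exact: c_dens.
move=> x /=; rewrite in_itv/= andbT => x0.
rewrite ger0_norm /dens; last by rewrite !mulr_ge0 ?expR_ge0 ?q_ge0 ?(ltW b0).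
by rewrite ler_wpM2r ?expR_ge0// ler_wpM2l ?(ltW b0)// q_le.
Qed.

(** The mean of [q / dM] under the density [dens dM b], written without the quotient because [dM 0]
    may vanish. *)
Definition renewal b := \int[mu]_(u in `[0, +oo[) dens q b u.

Let M_ge0 u : 0 <= u -> 0 <= M u.
Proof.
rewrite le_eqVlt => /orP[/eqP <-|u0]; first by rewrite M0.
have du x : x \in `]0, u[ -> is_derive x 1 M (dM x).
  by rewrite in_itv/= => /andP[x0 _]; exact: dMP.
have [c] := MVT u0 du (within_continuous cM).
rewrite in_itv/= M0 !subr0 => /andP[c0 _] ->.
by rewrite mulr_ge0 ?dM_ge0 ?(ltW u0) ?(ltW c0).
Qed.

(** Dominated convergence: for [b] in the enlarged interval []a1, a2[] the integrand is at most
    [a2 q exp(-a1 M)], a multiple of the integrand at [a1]. *)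
Lemma renewal_continuous b1 b2 : 0 < b1 -> {within `[b1, b2], continuous renewal}.
Proof.
move=> b1_gt0; pose a1 := b1 / 2; pose a2 := b2 + 1.
have a1_gt0 : 0 < a1 by rewrite divr_gt0.
have ca : {in `]a1, a2[%classic, continuous renewal}.
  rewrite /renewal; apply: (@continuity_under_integral R _ _ mu (dens q) _ _ a1 a2 _ _
    (fun u : R => a2 / a1 * dens q a1 u)).
  - exact: measurable_itv.
  - move=> b /=; rewrite in_itv/= => /andP[b0 _]; apply: integrable_renewal.
    exact: lt_trans b0.
  - apply: aeW => u _ b _; rewrite /dens; apply: cvgM.
      by apply: cvgM; [exact: cvg_id|exact: cvg_cst].
    apply: (@continuous_comp _ _ _ (fun b => - b * M u) expR); last exact: continuous_expR.
    by apply: cvgM; [apply: (@cvgN _ R^o); exact: cvg_id|exact: cvg_cst].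
  - by apply: (integrableZl _ (a2 / a1) (integrable_renewal a1_gt0)).
  - move=> b /=; rewrite in_itv/= => /andP[ab ba]; apply: aeW => u /=.
    rewrite in_itv/= andbT => u0; have b_gt0 := lt_trans a1_gt0 ab.
    rewrite ger0_norm /dens; last by rewrite !mulr_ge0 ?expR_ge0 ?q_ge0 ?(ltW b_gt0).
    rewrite [leRHS](_ : _ = a2 * q u * expR (- a1 * M u)); last first.
      by field; rewrite gt_eqF.
    apply: ler_pM.
    + by rewrite mulr_ge0 ?q_ge0 ?(ltW b_gt0).
    + exact: expR_ge0.
    + by rewrite ler_wpM2r ?q_ge0// ltW.
    + by rewrite ler_expR ler_wpM2r ?M_ge0// lerN2 ltW.
apply: continuous_in_subspaceT => b; rewrite inE/= in_itv/= => /andP[b1b bb2].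
apply: ca; rewrite inE/= in_itv/= /a1 /a2; apply/andP; split; lra.
Qed.

Section Monotone.
Hypothesis dM_gt0 : forall u, 0 < u -> 0 < dM u.
Hypothesis ratio : forall u v, 0 < u -> u < v -> q u * dM v < q v * dM u.

Let M_lt u v : 0 <= u -> u < v -> M u < M v.
Proof.
move=> u0 uv.
have du x : x \in `]u, v[ -> is_derive x 1 M (dM x).
  by rewrite in_itv/= => /andP[ux _]; apply: dMP; exact: le_lt_trans ux.
have [c] := MVT uv du (within_continuous cM).
rewrite in_itv/= => /andP[uc _] e.
by rewrite -subr_gt0 e mulr_gt0 ?subr_gt0// dM_gt0//; exact: le_lt_trans uc.
Qed.

(* The difference of the two exponential densities of [M] has one sign change, at
   [v], and integral zero; [q / dM] is increasing. *)
Lemma renewal_decreasing b1 b2 : 0 < b1 -> b1 < b2 -> renewal b2 < renewal b1.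
Proof.
move=> b1_gt0 b12; have b2_gt0 := lt_trans b1_gt0 b12.
have b12N : b2 - b1 != 0 by rewrite subr_eq0 gt_eqF.
(* The level of [M] at which the two densities agree: [b1 exp(-b1 y) = b2 exp(-b2 y)]. *)
pose y := ln (b2 / b1) / (b2 - b1).
have y0 : 0 < y by rewrite divr_gt0 ?subr_gt0// ln_gt0// ltr_pdivlMr// mul1r.
have [v v0 Mv] : exists2 v, 0 < v & M v = y.
  have [T [T0 MT]] : exists T, 0 < T /\ y < M T.
    have : \forall T \near +oo, 0 < T /\ y < M T.
      near=> T; split; first by near: T; exact: nbhs_pinfty_gt.
      by near: T; move/cvgryPgt : My; exact.
    by move=> /filter_ex.
  have [|v + Mv] := @IVT _ M 0 T y (ltW T0) (within_continuous cM).
    by rewrite M0 (min_idPl _) ?(max_idPr _) ?(ltW y0) ?(ltW MT)// ltW// (lt_trans y0).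
  rewrite in_itv/= le_eqVlt => /andP[/orP[/eqP v0|v0] _]; last by exists v.
  by move: y0; rewrite -Mv -v0 M0 ltxx.
pose w u := b1 * expR (- b1 * M u) - b2 * expR (- b2 * M u).
have wE u : w u = b1 * expR (- b1 * M u) * (1 - expR ((b2 - b1) * (y - M u))).
  rewrite /w mulrBr mulr1 -mulrA -expRD; congr (_ - _).
  rewrite (_ : - b1 * M u + (b2 - b1) * (y - M u) = ln (b2 / b1) + - b2 * M u); last first.
    by rewrite /y; field.
  rewrite expRD lnK ?posrE ?divr_gt0//; field. by rewrite gt_eqF.
(* Subtracting [phi * dM] leaves the integral of [f] equal to [renewal b1 - renewal b2], since both
   densities have mass 1. It makes the first factor of [f] change sign at [v], where [w] does, so
   that [f >= 0]. *)
pose phi := q v / dM v.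
pose f u := (q u - phi * dM u) * w u.
have phiE u : q u - phi * dM u = (q u * dM v - q v * dM u) / dM v.
  by rewrite /phi; field; rewrite gt_eqF// dM_gt0.
have cf : continuous f.
  move=> u; apply: cvgM.
    by apply: cvgB; [exact: cq|apply: cvgM; [exact: cvg_cst|exact: cdM]].
  by apply: cvgB; (apply: cvgM; [exact: cvg_cst|exact: c_expM]).
have f_gt0 u : v < u -> 0 < f u.
  move=> vu; rewrite /f phiE wE; apply: mulr_gt0.
    by rewrite divr_gt0 ?dM_gt0// subr_gt0 ratio.
  rewrite mulr_gt0 ?mulr_gt0 ?expR_gt0// subr_gt0 -[ltRHS]expR0 ltr_expR.
  by rewrite pmulr_rlt0 ?subr_gt0// subr_lt0 -Mv M_lt// ltW.
have f_ge0 u : 0 <= u -> 0 <= f u.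
  rewrite le_eqVlt => /orP[/eqP <-|u0].
    (* [ratio] speaks of positive times only; at 0 the sign comes from [q 0 = 0], [M 0 = 0] and
       [b1 < b2]. *)
    rewrite /f /w q0 M0 !mulr0 expR0 !mulr1 sub0r mulNr -mulrN opprB.
    have phi0 : 0 <= phi by rewrite divr_ge0 ?q_ge0 ?dM_ge0 ?(ltW v0).
    apply: mulr_ge0; last by rewrite subr_ge0 ltW.
    by apply: mulr_ge0 => //; exact: dM_ge0.
  have [uv|vu|->] := ltgtP u v; last 2 first.
  - by rewrite ltW// f_gt0.
  - by rewrite /f phiE subrr mul0r mul0r.
  rewrite /f phiE wE -mulrNN mulr_ge0//.
    by rewrite -mulNr divr_ge0 ?(ltW (dM_gt0 v0))// opprB subr_ge0; exact/ltW/ratio.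
  rewrite -mulrN mulr_ge0 ?mulr_ge0 ?expR_ge0 ?(ltW b1_gt0)// opprB subr_ge0.
  rewrite -[leLHS]expR0 ler_expR mulr_ge0 ?subr_ge0 ?(ltW b12)// -Mv.
  by apply/ltW/M_lt => //; exact: ltW.
have fE : f = fun u => (dens q b1 u - dens q b2 u) - phi * (dens dM b1 u - dens dM b2 u).
  by apply/funext => u; rewrite /f /w /dens; ring.
have iq := integrable_renewal; have id := integrable_renewal_density.
have iqB : mu.-integrable `[0, +oo[ (EFin \o (fun u => dens q b1 u - dens q b2 u)).
  by apply: (integrableB _ (iq _ b1_gt0) (iq _ b2_gt0)).
have idB : mu.-integrable `[0, +oo[ (EFin \o (fun u => dens dM b1 u - dens dM b2 u)).
  by apply: (integrableB _ (id _ b1_gt0) (id _ b2_gt0)).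
have ipB : mu.-integrable `[0, +oo[ (EFin \o (fun u => phi * (dens dM b1 u - dens dM b2 u))).
  by apply: (integrableZl _ phi idB).
have intf : mu.-integrable `[0, +oo[ (EFin \o f).
  by rewrite fE; apply: (integrableB _ iqB ipB).
have := Rintegral_gt0 cf (ltW v0) f_ge0 f_gt0 intf.
rewrite fE RintegralB// RintegralZl// !RintegralB//; [|exact: id|exact: id|exact: iq|exact: iq].
have I1 b : 0 < b -> \int[mu]_(u in `[0, +oo[) dens dM b u = 1.
  by move=> b0; rewrite /Rintegral integral_renewal_density.
by rewrite !I1// subrr mulr0 subr0 subr_gt0.
Unshelve. all: by end_near. Qed.

End Monotone.
End RenewalIntegral.

Section RenewalEquation.
Context {R : realType}.
Notation mu := (@lebesgue_measure R).
Variables (q F D dM : R -> R) (Dm s : R).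
Hypothesis cq : continuous q.
Hypothesis q_ge0 : forall u, 0 <= u -> 0 <= q u.
Hypothesis q0 : q 0 = 0.
Hypothesis cF : continuous F.
Hypothesis dF : forall u : R, 0 < u -> is_derive u 1 F (q u).
Hypothesis F0 : F 0 = 0.
Hypothesis Fy : F u @[u --> +oo] --> +oo.
Hypothesis cD : continuous D.
Hypothesis D0 : D 0 = 0.
Hypothesis D_gt0 : forall u, 0 < u -> 0 < D u.
Hypothesis D_homo : forall u v, 0 <= u -> u <= v -> D u <= D v.
Hypothesis D_le : forall u, 0 <= u -> D u <= Dm.
Hypothesis s_gt0 : 0 < s.
Hypothesis q_le_D : forall u, 0 <= u -> s * q u <= D u.
Hypothesis cdM : continuous dM.
Hypothesis dMP : forall u : R, 0 < u -> is_derive u 1 (F \+ D) (dM u).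
Hypothesis q_le_dM : forall u, 0 <= u -> q u <= dM u.
Hypothesis dM_gt0 : forall u, 0 < u -> 0 < dM u.
Hypothesis ratio : forall u v, 0 < u -> u < v -> q u * dM v < q v * dM u.

Let M := F \+ D.

Let cM : continuous M.
Proof. by move=> u; apply: cvgD; [exact: cF|exact: cD]. Qed.

Let M0 : M 0 = 0.
Proof. by rewrite /M/= F0 D0 addr0. Qed.

Let D_ge0 u : 0 <= u -> 0 <= D u.
Proof. by rewrite le_eqVlt => /orP[/eqP<-|/D_gt0/ltW//]; rewrite D0. Qed.

Let My : M u @[u --> +oo] --> +oo.
Proof.
apply: ger_cvgy Fy; near=> u; by rewrite /M/= lerDl D_ge0.
Unshelve. all: by end_near. Qed.

Let F_ge0 u : 0 <= u -> 0 <= F u.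
Proof.
rewrite le_eqVlt => /orP[/eqP <-|u0]; first by rewrite F0.
have du x : x \in `]0, u[ -> is_derive x 1 F (q x).
  by rewrite in_itv/= => /andP[x0 _]; exact: dF.
have [c] := MVT u0 du (within_continuous cF).
rewrite in_itv/= F0 !subr0 => /andP[c0 _] ->.
by rewrite mulr_ge0 ?q_ge0 ?(ltW u0) ?(ltW c0).
Qed.

Let iM b (b0 : 0 < b) := integrable_renewal cq q_ge0 cM cdM dMP M0 q_le_dM My b0.

(** With [F] for [M] and [q] for [dM] the integrand is itself a probability density; both bounds
    below compare [M = F + D] with [F]. *)
Let IF b (b0 : 0 < b) :=
  integral_renewal_density q_ge0 cF cq dF F0 (fun u _ => lexx (q u)) Fy b0.

Let iF b (b0 : 0 < b) :=
  integrable_renewal_density q_ge0 cF cq dF F0 (fun u _ => lexx (q u)) Fy b0.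

(** [M <= F + Dm], and [b q exp(-b F)] has integral 1. *)
Lemma renewal_ge b : 0 < b -> expR (- b * Dm) <= renewal q M b.
Proof.
move=> b0; have <- : \int[mu]_(u in `[0, +oo[)
    (expR (- b * Dm) * (b * q u * expR (- b * F u))) = expR (- b * Dm).
  rewrite RintegralZl//; last exact: iF.
  by rewrite /Rintegral (IF b0)/= mulr1.
apply: le_Rintegral => //.
- exact: (integrableZl _ _ (iF b0)).
- exact: iM.
- move=> u /=; rewrite in_itv/= andbT => u0.
  rewrite mulrCA ler_wpM2l ?mulr_ge0 ?q_ge0 ?(ltW b0)// -expRD ler_expR /M/= mulrDr.
  by rewrite addrC lerD2l !mulNr lerN2 ler_wpM2l ?D_le ?(ltW b0).
Qed.

(** Cut at [e]. Before [e], the inequalities [M >= D >= s q] and [x exp(-x) <= 1] bound the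
    integrand by [1 / s]; after [e], [D >= D e] and the density of [F] has mass 1. *)
Lemma renewal_le b e : 0 < b -> 0 < e ->
  renewal q M b <= e / s + expR (- b * D e).
Proof.
move=> b0 e0.
pose f u := b * q u * expR (- b * M u).
have f_int : mu.-integrable `[0, +oo[ (EFin \o f) := iM b0.
rewrite /renewal -/f -(subrK (\int[mu]_(u in `[0, e]) f u) (\int[mu]_(u in `[0, +oo[) f u)).
rewrite Rintegral_itvB// ?bnd_simp ?(ltW e0)// addrC lerD//.
- have -> : e / s = \int[mu]_(u in `[0, e]) s^-1.
    by rewrite Rintegral_cst//= lebesgue_measure_itv/= lte_fin e0 -EFinD/= subr0 mulrC.
  apply: le_Rintegral => //.
  + by apply: integrableS f_int => //; apply: subset_itvl; rewrite bnd_simp.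
  + by apply: continuous_integrable; exact: cst_continuous.
  + move=> u /=; rewrite in_itv/= => /andP[u0 _].
    have x_expR x : x * expR (- x) <= 1 :> R.
      rewrite expRN ler_pdivrMr ?expR_gt0// mul1r (le_trans _ (expR_ge1Dx x))//.
      by rewrite lerDr.
    have qu := q_ge0 u0.
    apply: (@le_trans _ _ (s^-1 * ((b * s * q u) * expR (- (b * s * q u))))).
      rewrite [leRHS](_ : _ = b * q u * expR (- (b * s * q u))); last first.
        by field; rewrite gt_eqF.
      rewrite ler_wpM2l ?mulr_ge0 ?(ltW b0)// ler_expR mulNr lerN2 -mulrA.
      rewrite ler_wpM2l ?(ltW b0)// (le_trans (q_le_D u0))// lerDr.
      exact: F_ge0.
    by rewrite ler_piMr ?invr_ge0 ?(ltW s_gt0).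
- pose h u := expR (- b * D e) * (b * q u * expR (- b * F u)).
  have ch_int : mu.-integrable `[0, +oo[ (EFin \o h) .
    by apply: (integrableZl _ _ (iF b0)).
  have <- : \int[mu]_(u in `[0, +oo[) h u = expR (- b * D e).
    rewrite RintegralZl//; last exact: iF.
    by rewrite /Rintegral (IF b0)/= mulr1.
  have h_ge0 u : 0 <= u -> 0 <= h u.
    by move=> u0; rewrite !mulr_ge0 ?expR_ge0 ?q_ge0 ?(ltW b0).
  have sub : `]e, +oo[ `<=` `[0, +oo[%classic.
    by apply: subset_itvr; rewrite bnd_simp ltW.
  have ih : mu.-integrable `]e, +oo[ (EFin \o h) by exact: integrableS ch_int.
  apply: (@le_trans _ _ (\int[mu]_(u in `]e, +oo[) h u)).
    apply: le_Rintegral => //; first exact: integrableS f_int.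
    move=> u /=; rewrite in_itv/= andbT => eu.
    have u0 : 0 <= u by rewrite ltW// (lt_trans e0).
    rewrite /h mulrCA ler_wpM2l ?mulr_ge0 ?q_ge0 ?(ltW b0)// -expRD ler_expR /M/= mulrDr.
    rewrite addrC lerD2r !mulNr lerN2 ler_wpM2l ?(ltW b0)//.
    by apply: D_homo; exact: ltW.
  rewrite /Rintegral fine_le//.
  + exact: integrable_fin_num.
  + exact: integrable_fin_num.
  + apply: ge0_subset_integral => //.
      by case/integrableP : ch_int.
    by move=> x /=; rewrite in_itv/= andbT => x0; rewrite lee_fin h_ge0.
Qed.

Lemma renewal_solution kappa : 1 < kappa ->
  exists2 b, 0 < b & kappa * renewal q M b = 1.
Proof.
move=> k1; have k0 : 0 < kappa by rewrite (lt_trans _ k1).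
have Dm0 : 0 < Dm by rewrite (lt_le_trans (D_gt0 ltr01))// D_le.
(* At [b1] the lower bound gives [kappa exp(-b1 Dm) = sqrt kappa >= 1]. At [b2] the upper bound
   gives at most [1/2 + 1/4]: [e] makes [kappa e / s = 1/2], and the logarithm in [b2] makes
   [kappa exp(-b2 D(e)) <= 1/4]. *)
pose b1 := ln kappa / (2 * Dm); pose e := s / (2 * kappa).
have e0 : 0 < e by rewrite divr_gt0// mulr_gt0.
have lk : 0 < ln kappa by rewrite ln_gt0.
have b1_gt0 : 0 < b1 by rewrite divr_gt0// mulr_gt0.
pose b2 := b1 + ln (4 * kappa) / D e.
have De := D_gt0 e0.
have b2_gt : b1 <= b2 by rewrite lerDl divr_ge0 ?(ltW De)// ln_ge0//; lra.
have b2_gt0 := lt_le_trans b1_gt0 b2_gt.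
have J1 : 1 <= kappa * renewal q M b1.
  rewrite (le_trans _ (ler_wpM2l (ltW k0) (renewal_ge b1_gt0)))//.
  rewrite -{1}(lnK k0) -expRD -[leLHS]expR0 ler_expR.
  rewrite (_ : ln kappa + - b1 * Dm = ln kappa / 2) ?divr_ge0 ?(ltW lk)//.
  by rewrite /b1; field; rewrite gt_eqF.
have J2 : kappa * renewal q M b2 <= 1.
  rewrite (le_trans (ler_wpM2l (ltW k0) (renewal_le b2_gt0 e0)))//.
  have : expR (- b2 * D e) <= (4 * kappa)^-1.
    have k4 : 0 < 4 * kappa by rewrite mulr_gt0.
    rewrite -[leRHS]lnK ?posrE ?invr_gt0// ler_expR lnV ?posrE// mulNr lerN2.
    rewrite (_ : b2 * D e = b1 * D e + ln (4 * kappa)); last first.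
      by rewrite /b2; field; rewrite gt_eqF.
    by rewrite lerDr mulr_ge0 ?(ltW b1_gt0) ?(ltW De).
  move/(ler_wpM2l (ltW k0)) => h.
  rewrite mulrDr; apply: (le_trans (lerD (lexx _) h)).
  rewrite (_ : kappa * (e / s) = 1 / 2); last by rewrite /e; field; rewrite !gt_eqF.
  rewrite (_ : kappa / (4 * kappa) = 1 / 4); last by field; rewrite gt_eqF.
  lra.
have cJ : {within `[b1, b2], continuous (fun b => kappa * renewal q M b)}.
  move=> b; apply: cvgM; first exact: cvg_cst.
  exact: (renewal_continuous cq q_ge0 cM cdM dMP M0 q_le_dM My b1_gt0).
have [|b + Jb] := @IVT _ (fun b => kappa * renewal q M b) b1 b2 1 b2_gt cJ.
  by rewrite ge_min le_max J1 J2 orbT.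
rewrite in_itv/= => /andP[b1b _]; exists b => //.
exact: lt_le_trans b1b.
Qed.

Lemma renewal_lt b1 b2 : 0 < b1 -> b1 < b2 -> renewal q M b2 < renewal q M b1.
Proof.
exact: (renewal_decreasing cq q_ge0 cM cdM dMP M0 q0 q_le_dM My dM_gt0 ratio).
Qed.

End RenewalEquation.

(** * Monotone ratios of Erlang densities and their primitives *)

Section ErlangRatios.
Context {R : realType}.
Implicit Types (a u v : R) (k l m : nat).

(** Monotonicity of [X i / Y i] from consecutive indices, without division: two inequalities are
    multiplied and the common factor [X m * Y m] is cancelled. *)
Lemma ratio_chain (X Y : nat -> R) l m : (forall i, 0 < X i) -> (forall i, 0 < Y i) ->
  (forall i, Y i * X i.+1 <= X i * Y i.+1) -> (l <= m)%N -> Y l * X m <= X l * Y m.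
Proof.
move=> X0 Y0 XY; elim: m => [|m ih]; first by rewrite leqn0 => /eqP ->; rewrite mulrC.
rewrite leq_eqVlt => /orP[/eqP ->|]; first by rewrite mulrC.
rewrite ltnS => /ih lm.
have h : (Y l * X m) * (Y m * X m.+1) <= (X l * Y m) * (X m * Y m.+1).
  by apply: ler_pM => //; rewrite mulr_ge0// ltW.
by rewrite -(ler_pM2r (mulr_gt0 (X0 m) (Y0 m))); lra.
Qed.

(** Since [(l + 1) erlang a l.+1 s = s erlang a l s], the left-hand side is the integral of
    [s erlang a l s] over [[0, u]], where [s <= u]. *)
Lemma erlang_int_le_erlang_int a l u : 0 < a -> 0 <= u ->
  l.+1%:R * erlang_int a l.+1 u <= u * erlang_int a l u.
Proof.
move=> a0 u0; have aN := lt0r_neq0 a0; rewrite -subr_ge0.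
pose g (x : R) := x * erlang_int a l x - l.+1%:R * erlang_int a l.+1 x.
have dg (x : R) : is_derive x 1 g (erlang_int a l x).
  apply: (is_derive_eq (is_derive_fB
    (is_derive_fM (is_derive_fid x) (is_derive_erlang_int l x aN))
    (is_derive_fZ _ (is_derive_erlang_int l.+1 x aN)))).
  rewrite erlangS; have h2 : (l.+1)%:R != 0 :> R by rewrite pnatr_eq0.
  by field; rewrite nat1r.
have <- : g 0 = 0 by rewrite /g !erlang_int_at0 !mulr0 subrr.
apply: (@ger0_is_derive_le _ g (erlang_int a l)) => // x /andP[x0 _].
by rewrite erlang_int_ge0// ltW.
Qed.

(** Write [c_k] for [erlang_int a k]. For consecutive indices the difference of the two sides, as a
    function of [v], vanishes at [u] and has derivative [erlang a k x / (k + 1)] times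
    [x c_k(u) - (k + 1) c_{k+1}(u)], which is nonnegative for [x >= u] by the preceding lemma. *)
Lemma erlang_int_ratio a l m u v : 0 < a -> (l <= m)%N -> 0 < u -> u < v ->
  erlang_int a l v * erlang_int a m u <= erlang_int a l u * erlang_int a m v.
Proof.
move=> a0 lm u0 uv; have aN := lt0r_neq0 a0; have v0 := lt_trans u0 uv.
apply: (@ratio_chain (fun k => erlang_int a k u) (fun k => erlang_int a k v)) => // k.
- exact: erlang_int_gt0.
- exact: erlang_int_gt0.
pose f (x : R) := erlang_int a k u * erlang_int a k.+1 x - erlang_int a k.+1 u * erlang_int a k x.
have df (x : R) : is_derive x 1 f
    (erlang_int a k u * erlang a k.+1 x - erlang_int a k.+1 u * erlang a k x).
  exact: (is_derive_fB (is_derive_fZ _ (is_derive_erlang_int k.+1 x aN))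
    (is_derive_fZ _ (is_derive_erlang_int k x aN))).
have fu : f u = 0 by rewrite /f mulrC subrr.
rewrite -subr_ge0 [leRHS](_ : _ = f v); last by rewrite /f [_ * erlang_int a k v]mulrC.
rewrite -fu; apply: (ger0_is_derive_le (ltW uv)) => // x /andP[ux xv].
have x0 := lt_trans u0 ux.
have h2 : 0 < (k.+1)%:R :> R by rewrite ltr0n.
rewrite erlangS [leRHS](_ : _ = erlang a k x / k.+1%:R *
   (x * erlang_int a k u - k.+1%:R * erlang_int a k.+1 u)); last first.
  by field; rewrite nat1r gt_eqF.
apply: mulr_ge0; first by rewrite divr_ge0 ?ler0n// erlang_ge0// ltW.
rewrite subr_ge0 (le_trans (erlang_int_le_erlang_int k a0 (ltW u0)))//.
by rewrite ler_wpM2r ?erlang_int_ge0 ?(ltW u0)// ltW.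
Qed.

Lemma is_derive_erlang_logarithmic a m u : is_derive u 1 (erlang a m)
  (if u == 0 then (m == 1)%:R - a * (m == 0)%:R else (m%:R / u - a) * erlang a m u).
Proof.
apply: (is_derive_eq (is_derive_erlang a m u)).
have [->|u0] := eqVneq u 0.
  by rewrite erlang_at0; case: m => [|m]; rewrite ?erlang_at0// eqSS.
case: m => [|m]; first by rewrite mul0r !sub0r mulNr.
rewrite erlangS; have h2 : (m.+1)%:R != 0 :> R by rewrite pnatr_eq0.
by field; rewrite nat1r h2.
Qed.

(** Divided by [u] and by the primitive, this says that the logarithmic derivative [m / u - a] of
    the density is below that of its primitive. The difference of the two sides vanishes at 0 and
    has derivative [erlang a m + a erlang_int a m]. *)
Lemma erlang_hazard_bound a m u : 0 < a -> 0 < u ->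
  m%:R * erlang_int a m u < u * erlang a m u + a * u * erlang_int a m u.
Proof.
move=> a0 u0; have aN := lt0r_neq0 a0; rewrite -subr_gt0.
pose g (x : R) := x * erlang a m x + a * (x * erlang_int a m x) - m%:R * erlang_int a m x.
have dg (x : R) : is_derive x 1 g (erlang a m x + a * erlang_int a m x).
  apply: (is_derive_eq (is_derive_fB (is_derive_fD
    (is_derive_fM (is_derive_fid x) (is_derive_erlang a m x))
    (is_derive_fZ a (is_derive_fM (is_derive_fid x) (is_derive_erlang_int m x aN))))
    (is_derive_fZ _ (is_derive_erlang_int m x aN)))).
  case: m {g} => [|m]; first by ring.
  rewrite !erlangS; have h2 : (m.+1)%:R != 0 :> R by rewrite pnatr_eq0.
  by field; rewrite nat1r.
rewrite [ltRHS](_ : _ = g u); last by rewrite /g mulrA.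
have <- : g 0 = 0 by rewrite /g !erlang_int_at0 !mulr0 !mul0r !addr0 subrr.
apply: (gtr0_is_derive_lt u0) => // x /andP[x0 _].
by rewrite addr_gt0 ?erlang_gt0// mulr_gt0// erlang_int_gt0.
Qed.

(** The quotient [p_k / c_m] is [(p_k / p_m) (p_m / c_m)]: the first factor is a multiple of
    [u^(k - m)], nonincreasing for [k <= m], and the second decreases strictly by
    [erlang_hazard_bound]. *)
Lemma erlang_ratio a k m u v : 0 < a -> (k <= m)%N -> 0 < u -> u < v ->
  erlang a k v * erlang_int a m u < erlang a k u * erlang_int a m v.
Proof.
move=> a0 km u0 uv; have aN := lt0r_neq0 a0; have v0 := lt_trans u0 uv.
have h1 : erlang a k v * erlang a m u <= erlang a k u * erlang a m v.
  apply: (@ratio_chain (fun k => erlang a k u) (fun k => erlang a k v)) => // i;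
    try exact: erlang_gt0.
  rewrite !erlangS -subr_ge0.
  rewrite [leRHS](_ : _ = i.+1%:R^-1 * (v - u) * (erlang a i u * erlang a i v)); last by ring.
  have vu : 0 <= v - u by rewrite subr_ge0 ltW.
  apply: mulr_ge0; first by apply: mulr_ge0 => //; rewrite invr_ge0 ler0n.
  by apply: mulr_ge0; apply: erlang_ge0; exact: ltW.
have h2 : erlang a m v * erlang_int a m u < erlang a m u * erlang_int a m v.
  pose f (x : R) := erlang a m u * erlang_int a m x - erlang_int a m u * erlang a m x.
  have fu : f u = 0 by rewrite /f mulrC subrr.
  rewrite -subr_gt0 [ltRHS](_ : _ = f v); last by rewrite /f [erlang_int a m u * _]mulrC.
  pose f' (x : R) := erlang a m u * erlang a m x -
    erlang_int a m u * (if x == 0 then (m == 1)%:R - a * (m == 0)%:R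
      else (m%:R / x - a) * erlang a m x).
  have df (x : R) : is_derive x 1 f (f' x).
    exact: (is_derive_fB (is_derive_fZ _ (is_derive_erlang_int m x aN))
      (is_derive_fZ _ (is_derive_erlang_logarithmic a m x))).
  rewrite -fu; apply: (gtr0_is_derive_lt uv (fun x _ => df x)); rewrite /f'.
  move=> x /andP[ux _]; have x0 := lt_trans u0 ux.
  rewrite gt_eqF// [ltRHS](_ : _ = erlang a m x / x * (x * erlang a m u +
    a * x * erlang_int a m u - m%:R * erlang_int a m u)); last by field; rewrite gt_eqF.
  apply: mulr_gt0; first by rewrite divr_gt0// erlang_gt0.
  rewrite subr_gt0.
  rewrite (lt_le_trans (erlang_hazard_bound m a0 u0))// lerD//.
    by rewrite ler_wpM2r ?erlang_ge0 ?(ltW u0)// ltW.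
  by rewrite ler_wpM2r ?erlang_int_ge0 ?(ltW u0)// ler_wpM2l ?(ltW a0)// ltW.
have pm := erlang_gt0 a m u0; have pk := erlang_gt0 a k u0.
have cu := erlang_int_gt0 m aN u0.
rewrite -(ltr_pM2r pm).
have h3 := ler_wpM2r (ltW cu) h1.
have : erlang a k u * (erlang a m v * erlang_int a m u) <
       erlang a k u * (erlang a m u * erlang_int a m v) by rewrite ltr_pM2l.
lra.
Qed.
End ErlangRatios.

(** * The equation at frequency zero *)

Section VarianceParts.
Context {R : realType}.
Implicit Types (a t u v : R) (k l m : nat) (f : R -> R).
Notation mu := (@lebesgue_measure R).

(** For [u < 0] the interval is empty and [F u = 0], so [F] is a primitive composed with [max 0 u]:
    continuous on the line, with its derivative claimed on the open half-line. *)
Lemma parameterized_Rintegral f : continuous f ->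
  let F u := \int[mu]_(s in `[0, u]) f s in
  continuous F /\ forall u, 0 < u -> is_derive u 1 F (f u).
Proof.
move=> cf F; have [G dG] := primitive_exists cf.
have FE u : F u = G (Num.max 0 u) - G 0.
  have [u0|u0] := leP 0 u.
    by apply: Rintegral_FTC => // x /andP[x0 _]; apply: dG; lra.
  by rewrite /F set_itv_ge ?Rintegral_set0 ?subrr// -leNgt bnd_simp.
split=> [u|u u0].
  rewrite (_ : F = fun u => G (Num.max 0 u) - G 0); last exact/funext.
  apply: cvgB; last exact: cvg_cst.
  apply: (@continuous_comp _ _ _ (fun x : R => Num.max 0 x) G).
    by apply: continuous_max; [exact: cst_continuous|move=> ?; exact: cvg_id].
  apply: (is_derive_continuous (f := f)); apply: dG.
  by rewrite (lt_le_trans _ (_ : 0 <= _))// ?le_max ?lexx// ltrN10.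
have dG' : is_derive u 1 (fun x => G x - G 0) (f u).
  have u1 : -1 < u by lra.
  by apply: (is_derive_eq (is_derive_fB (dG u u1) (is_derive_fcst _ _))); rewrite subr0.
apply: near_eq_is_derive dG'.
near=> x; rewrite FE (max_idPr _)// ltW//.
by near: x; exact: lt_nbhsr.
Unshelve. all: by end_near. Qed.

Lemma continuous_fsqr f : continuous f -> continuous (fun s => f s ^+ 2).
Proof. by move=> cf s; apply: (@cvgM _ _ _ _ f f); exact: cf. Qed.

(* The integral of [erlang a (m - k) s * erlang a (m - l) s] over the half-line. *)
Definition ou_gram a m k l : R :=
  'C((m - k) + (m - l), m - k)%:R / (2 * a) ^+ ((m - k) + (m - l)).+1.

Definition ou_initial_part a m t : R :=
  \sum_(k < m.+1) \sum_(l < m.+1) ou_gram a m k l * (erlang_int a k t * erlang_int a l t).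

Definition ou_noise_part a m t : R :=
  \int[mu]_(s in `[0, t]) (erlang_int a m s) ^+ 2.

Lemma ou_gram_gt0 a m k l : 0 < a -> 0 < ou_gram a m k l.
Proof.
move=> a0; rewrite /ou_gram divr_gt0 ?exprn_gt0 ?mulr_gt0// ltr0n bin_gt0.
by rewrite leq_addr.
Qed.

Lemma erlang_scale a k t : 0 < a -> erlang a k t = a ^- k * erlang 1 k (a * t).
Proof.
move=> a0; rewrite /erlang mulN1r exprMn mulNr.
by field; rewrite expf_neq0 ?gt_eqF// pnatr_eq0 -lt0n fact_gt0.
Qed.

Lemma erlang_int_scale a k t : 0 < a ->
  erlang_int a k t = a ^- k.+1 * erlang_int 1 k (a * t).
Proof.
move=> a0; elim: k => [|k ih] /=.
  by rewrite (erlang_scale _ _ a0); field; rewrite gt_eqF.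
have -> : a ^- k.+2 = a ^- k.+1 / a by rewrite exprSr invfM.
by rewrite ih (erlang_scale _ _ a0) divr1 mulrAC mulrBr.
Qed.

(** In each summand [ou_gram] has degree [-(2m - k - l + 1)] in [a] and the primitives have degrees
    [-(k + 1)] and [-(l + 1)], in total [-(2m + 3)]. The noise part has the same degree, so a single
    parameter [b] describes the rescaled problem. *)
Lemma ou_initial_part_scale a m t : 0 < a ->
  ou_initial_part a m t = a ^- (2 * m + 3) * ou_initial_part 1 m (a * t).
Proof.
move=> a0; rewrite /ou_initial_part mulr_sumr; apply: eq_bigr => k _.
rewrite mulr_sumr; apply: eq_bigr => l _.
rewrite !(erlang_int_scale _ _ a0) /ou_gram mulr1 exprMn.
have e : a ^+ (2 * m + 3) = a ^+ (m - k + (m - l)).+1 * (a ^+ k.+1 * a ^+ l.+1).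
  rewrite -!exprD; congr (_ ^+ _); have := ltn_ord k; have := ltn_ord l.
  lia.
rewrite e !invfM. ring.
Qed.

Lemma ou_noise_part_scale a m t : 0 < a -> 0 <= t ->
  ou_noise_part a m t = a ^- (2 * m + 3) * ou_noise_part 1 m (a * t).
Proof.
move=> a0 t0; have cf b : b != 0 -> continuous (fun s => (erlang_int b m s : R) ^+ 2).
  by move=> bN; exact/continuous_fsqr/continuous_erlang_int.
have [G dG] := primitive_exists (cf 1 (oner_neq0 _)).
have at0 : 0 <= a * t by rewrite mulr_ge0// ltW.
have dG0 (x : R) : 0 <= x <= a * t -> is_derive x 1 G (erlang_int 1 m x ^+ 2).
  by move=> /andP[x0 _]; apply: dG; lra.
rewrite /ou_noise_part (Rintegral_FTC at0 (cf 1 (oner_neq0 _)) dG0).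
have dH (x : R) : 0 <= x <= t -> is_derive x 1 (fun s => a ^- (2 * m + 3) * G (a * s))
    (erlang_int a m x ^+ 2).
  move=> /andP[x0 _]; have ax : -1 < a * x by rewrite (lt_le_trans (ltrN10 _))// mulr_ge0// ltW.
  apply: (is_derive_eq (is_derive_fZ _ (is_derive_fcomp (is_derive_fZ a (is_derive_fid x)) (dG _ ax)))).
  have e : a ^+ (2 * m + 3) = a * (a ^+ m.+1) ^+ 2.
    by rewrite -exprM -exprS; congr (_ ^+ _); lia.
  rewrite (erlang_int_scale _ _ a0) e exprMn; field.
  by rewrite expf_neq0 ?gt_eqF.
by rewrite (Rintegral_FTC t0 (cf a (lt0r_neq0 a0)) dH) mulr0 mulrBr.
Qed.

End VarianceParts.

(** * The renewal equation for the variance of the integrated process *)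

Section OURenewal.
Context {R : realType}.
Variable m : nat.
Implicit Types u v : R.
Notation mu := (@lebesgue_measure R).

Lemma continuous_fsum (I : Type) (r : seq I) (f : I -> R -> R) :
  (forall i, continuous (f i)) -> continuous (fun u => \sum_(i <- r) f i u).
Proof.
move=> cf; elim: r => [|i r ih].
  by under eq_fun do rewrite big_nil; exact: cst_continuous.
under eq_fun do rewrite big_cons.
by move=> u; apply: cvgD; [exact: cf|exact: ih].
Qed.

Let c := @erlang_int R 1.
Let p := @erlang R 1.
Let g (k l : nat) : R := ou_gram 1 m k l.
Let q u := c m u ^+ 2.
Let F := @ou_noise_part R 1 m.
Let D := @ou_initial_part R 1 m.
Let dD u := \sum_(k < m.+1) \sum_(l < m.+1) g k l * (p k u * c l u + c k u * p l u).

Let oneN : 1 != 0 :> R. Proof. exact: oner_neq0. Qed.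

Let cc k : continuous (c k). Proof. exact: continuous_erlang_int. Qed.

Let cp k : continuous (p k). Proof. exact: continuous_erlang. Qed.

Let c0 k u : 0 <= u -> 0 <= c k u. Proof. exact: erlang_int_ge0. Qed.

Let c_gt0 k u : 0 < u -> 0 < c k u. Proof. exact: erlang_int_gt0. Qed.

Let c_homo k u v : 0 <= u -> u <= v -> c k u <= c k v.
Proof.
move=> u0; rewrite le_eqVlt => /orP[/eqP -> //|uv].
by apply/ltW/erlang_int_ltr.
Qed.

Let p0 k u : 0 <= u -> 0 <= p k u. Proof. exact: erlang_ge0. Qed.

Let g_gt0 k l : 0 < g k l. Proof. exact: ou_gram_gt0. Qed.

Let c_le1 k u : 0 <= u -> c k u <= 1.
Proof. by move=> u0; rewrite (le_trans (erlang_int_le k ltr01 u0))// expr1n invr1. Qed.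

Let cq : continuous q. Proof. exact: continuous_fsqr. Qed.

Let q_ge0 u : 0 <= u -> 0 <= q u. Proof. by move=> _; exact: sqr_ge0. Qed.

Let q_gt0 u : 0 < u -> 0 < q u. Proof. by move=> u0; rewrite exprn_gt0// c_gt0. Qed.

Let q0 : q 0 = 0. Proof. by rewrite /q /c erlang_int_at0 expr0n. Qed.

Let cF : continuous F. Proof. by have [] := parameterized_Rintegral cq. Qed.

Let dF u : 0 < u -> is_derive u 1 F (q u).
Proof. by have [_] := parameterized_Rintegral cq; exact. Qed.

Let F0 : F 0 = 0. Proof. by rewrite /F /ou_noise_part set_itv1 Rintegral_set1. Qed.

(** Beyond 1 the derivative [q] is at least [q 1 > 0], so [F] grows at least linearly. *)
Let Fy : F u @[u --> +oo] --> +oo.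
Proof.
have q1 := q_gt0 ltr01.
have F_ge u : 1 <= u -> q 1 * (u - 1) <= F u.
  move=> u1; pose G u := F u - q 1 * u.
  have dG (x : R) : 1 <= x <= u -> is_derive x 1 G (q x - q 1).
    move=> /andP[x1 _]; have x0 : 0 < x by rewrite (lt_le_trans ltr01).
    apply: (is_derive_eq (is_derive_fB (dF x0) (is_derive_fZ (q 1) (is_derive_fid x)))).
    by rewrite mulr1.
  have : G 1 <= G u.
    apply: (ger0_is_derive_le u1 dG) => x /andP[x1 _].
    by rewrite subr_ge0 lerXn2r ?nnegrE ?c0 ?c_homo ?ler01// ltW// (lt_trans ltr01).
  have F1 : 0 <= F 1 by apply: Rintegral_ge0 => x _; exact: sqr_ge0.
  rewrite /G; lra.
apply/cvgryPge => A; near=> u.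
have u1 : 1 <= u by near: u; apply: nbhs_pinfty_ge; rewrite num_real.
have uA : A / q 1 + 1 <= u by near: u; apply: nbhs_pinfty_ge; rewrite num_real.
by apply: (le_trans _ (F_ge u u1)); rewrite -ler_pdivrMl// mulrC; lra.
Unshelve. all: by end_near. Qed.

Let dDP u : is_derive u 1 D (dD u).
Proof.
apply: is_derive_fsum => k; apply: is_derive_fsum => l; apply: is_derive_fZ.
exact: is_derive_fM (is_derive_erlang_int k u oneN) (is_derive_erlang_int l u oneN).
Qed.

Let cD : continuous D.
Proof. by move=> u; exact: (is_derive_continuous (f := dD)). Qed.

Let cdD : continuous dD.
Proof.
apply: continuous_fsum => k; apply: continuous_fsum => l u.
apply: cvgM; first exact: cvg_cst.
by apply: cvgD; apply: cvgM; do ?[exact: cc|exact: cp].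
Qed.

Let D0 : D 0 = 0.
Proof.
rewrite /D /ou_initial_part big1// => k _; rewrite big1// => l _.
by rewrite erlang_int_at0 mul0r mulr0.
Qed.

Let D_homo u v : 0 <= u -> u <= v -> D u <= D v.
Proof.
move=> u0 uv; apply: ler_sum => k _; apply: ler_sum => l _.
rewrite ler_wpM2l ?(ltW (g_gt0 k l))//; apply: ler_pM; do ?exact: c0; exact: c_homo.
Qed.

Let Dm := \sum_(k < m.+1) \sum_(l < m.+1) g k l.

Let D_le u : 0 <= u -> D u <= Dm.
Proof.
move=> u0; apply: ler_sum => k _; apply: ler_sum => l _.
rewrite ler_piMr ?(ltW (g_gt0 k l))// -[leRHS]mulr1.
by apply: ler_pM; do ?exact: c0; exact: c_le1.
Qed.

(** Keep the summand [k = l = m] of a sum of nonnegative terms. *)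
Let q_le_D u : 0 <= u -> g m m * q u <= D u.
Proof.
move=> u0; rewrite /D /ou_initial_part.
have gc k l : 0 <= ou_gram 1 m k l * (erlang_int 1 k u * erlang_int 1 l u).
  by rewrite mulr_ge0 ?(ltW (g_gt0 k l))// mulr_ge0// c0.
rewrite (bigD1 ord_max)//= (bigD1 ord_max)//= -addrA lerDl addr_ge0// sumr_ge0// => k _.
by rewrite sumr_ge0.
Qed.

Let D_gt0 u : 0 < u -> 0 < D u.
Proof. by move=> u0; rewrite (lt_le_trans _ (q_le_D (ltW u0)))// mulr_gt0// q_gt0. Qed.

Let dM u := q u + dD u.

Let cdM : continuous dM. Proof. by move=> u; apply: cvgD; [exact: cq|exact: cdD]. Qed.

Let dMP u : 0 < u -> is_derive u 1 (F \+ D) (dM u).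
Proof. by move=> u0; exact: is_derive_fD (dF u0) (dDP u). Qed.

Let q_le_dM u : 0 <= u -> q u <= dM u.
Proof.
move=> u0; rewrite lerDl sumr_ge0// => k _; rewrite sumr_ge0// => l _.
by rewrite mulr_ge0 ?(ltW (g_gt0 k l))// addr_ge0// mulr_ge0// ?p0 ?c0.
Qed.

Let dM_gt0 u : 0 < u -> 0 < dM u.
Proof. by move=> u0; rewrite (lt_le_trans (q_gt0 u0))// q_le_dM// ltW. Qed.

Let ratio u v : 0 < u -> u < v -> q u * dM v < q v * dM u.
Proof.
move=> u0 uv; have v0 := lt_trans u0 uv.
rewrite /dM !mulrDr [q v * q u]mulrC ltrD2l /dD !mulr_sumr.
(* The terms [q u * q v] have cancelled and the rest is a sum over [k], [l]. Each product [p_k c_l],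
   divided by [q = c_m^2], is [(p_k / c_m) (c_l / c_m)]: strictly decreasing times nonincreasing. *)
have pc k l : (k <= m)%N -> (l <= m)%N ->
    q u * (p k v * c l v) < q v * (p k u * c l u).
  move=> km lm.
  rewrite (_ : q u * _ = (p k v * c m u) * (c l v * c m u)); last by rewrite /q; ring.
  rewrite (_ : q v * _ = (p k u * c m v) * (c l u * c m v)); last by rewrite /q; ring.
  apply: (@lt_le_trans _ _ ((p k u * c m v) * (c l v * c m u))).
    by rewrite ltr_pM2r ?mulr_gt0 ?c_gt0//; exact: erlang_ratio.
  rewrite ler_pM2l; last by rewrite mulr_gt0 ?c_gt0// erlang_gt0.
  exact: erlang_int_ratio.
have pc2 (k l : 'I_m.+1) : q u * (g k l * (p k v * c l v + c k v * p l v)) <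
    q v * (g k l * (p k u * c l u + c k u * p l u)).
  have kl : (k <= m)%N /\ (l <= m)%N by split; rewrite -ltnS; exact: ltn_ord.
  rewrite mulrCA [ltRHS]mulrCA ltr_pM2l// !mulrDr.
  have h1 := pc k l kl.1 kl.2; have h2 := pc l k kl.2 kl.1.
  by rewrite [c k v * _]mulrC [c k u * _]mulrC ltrD.
have ne : has xpredT (index_enum 'I_m.+1) by apply/hasP; exists ord0 => //; rewrite mem_index_enum.
apply: ltr_sum => // k _; rewrite !mulr_sumr; apply: ltr_sum => // l _; exact: pc2.
Qed.

Definition ou_unit_variance u := F u + D u.

Definition ou_response b := \int[mu]_(u in `[0, +oo[)
  (b * c m u ^+ 2 * expR (- b * ou_unit_variance u)).

Lemma ou_response_solution kappa : 1 < kappa ->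
  exists2 b, 0 < b & kappa * ou_response b = 1.
Proof.
exact: (renewal_solution cq q_ge0 cF dF F0 Fy cD D0 D_gt0 D_homo D_le (g_gt0 m m)
  q_le_D cdM dMP q_le_dM).
Qed.

Lemma ou_response_lt b1 b2 : 0 < b1 -> b1 < b2 -> ou_response b2 < ou_response b1.
Proof.
exact: (renewal_lt cq q_ge0 q0 cF F0 Fy cD D0 D_gt0 cdM dMP q_le_dM dM_gt0 ratio).
Qed.

Lemma ou_unit_variance_facts : [/\ continuous ou_unit_variance,
  forall u, 0 <= u -> 0 <= ou_unit_variance u &
  forall b, 0 < b -> mu.-integrable `[0, +oo[
    (EFin \o (fun u => b * c m u ^+ 2 * expR (- b * ou_unit_variance u)))].
Proof.
have D_ge0 u : 0 <= u -> 0 <= D u.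
  by rewrite le_eqVlt => /orP[/eqP<-|/D_gt0/ltW//]; rewrite D0.
have F_ge0 u : 0 <= F u by apply: Rintegral_ge0 => x _; exact: sqr_ge0.
have cM : continuous ou_unit_variance by move=> u; apply: cvgD; [exact: cF|exact: cD].
have M0 : ou_unit_variance 0 = 0 by rewrite /ou_unit_variance F0 D0 addr0.
have My : ou_unit_variance u @[u --> +oo] --> +oo.
  by apply: ger_cvgy Fy; near=> u; rewrite lerDl D_ge0.
split => //.
- by move=> u u0; rewrite addr_ge0// D_ge0.
- by move=> b b0; exact: (integrable_renewal cq q_ge0 cM cdM dMP M0 q_le_dM My b0).
Unshelve. all: by end_near. Qed.

End OURenewal.

(** * Rescaling of time *)

Section Scaling.
Context {R : realType}.
Notation mu := (@lebesgue_measure R).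

Lemma integral_scale (a : R) (G : R -> R) : 0 < a -> continuous G ->
  (forall u, 0 <= u -> 0 <= G u) ->
  (\int[mu]_(u in `[0%R, +oo[) (G u)%:E =
   \int[mu]_(t in `[0%R, +oo[) (a * G (a * t))%:E)%E.
Proof.
move=> a0 cG G0; pose F (t : R) := a * t.
have dF (t : R) : is_derive t 1 F a.
  by apply: (is_derive_eq (is_derive_fZ a (is_derive_fid t))); rewrite mulr1.
have dFE : F^`()%classic = fun=> a.
  by apply/funext => t; rewrite derive1E; have [_ ->] := dF t.
have F0 : F 0 = 0 by rewrite /F mulr0.
transitivity (\int[mu]_(u in `[F 0%R, +oo[) (G u)%:E)%E; first by rewrite F0.
rewrite (@increasing_ge0_integration_by_substitutiony _ F G 0).
- by apply: eq_integral => t _ /=; rewrite dFE /= mulrC.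
- by move=> x y _ _ xy; rewrite /F ltr_pM2l.
- by rewrite dFE => x _; exact: cst_continuous.
- by rewrite dFE; exact: is_cvg_cst.
- by rewrite dFE; exact: is_cvg_cst.
- split; first by move=> x _; have [] := dF x.
  by apply: cvg_at_right_filter; exact: (is_derive_continuous (f := fun=> a)).
- by apply: gt0_cvgMry => //; exact: cvg_id.
- exact: continuous_subspaceT.
- by move=> x; rewrite F0 in_itv/= andbT => x0; rewrite G0// ltW.
Qed.

Definition ou_scaled_variance (a : R) m t := ou_noise_part a m t + ou_initial_part a m t.

(** Under [u = a t], the Jacobian [a], the factor [a ^- (2 * m + 3)] of the new parameter and the
    square of the factor [a ^+ m.+1] from [erlang_int] have total degree 0. *)
Lemma ou_response_scale (a gam : R) m : 0 < a -> 0 < gam ->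
  let f t := erlang_int a m t ^+ 2 * expR (- gam * ou_scaled_variance a m t) in
  [/\ continuous f, mu.-integrable `[0, +oo[ (EFin \o f) &
   gam * \int[mu]_(t in `[0, +oo[) f t = ou_response m (gam * a ^- (2 * m + 3))].
Proof.
move=> a0 gam0 f; set b := gam * a ^- _.
have b0 : 0 < b by rewrite mulr_gt0// invr_gt0 exprn_gt0.
have [cM M0 iM] := @ou_unit_variance_facts R m.
pose G u := b * erlang_int 1 m u ^+ 2 * expR (- b * ou_unit_variance m u).
have cG : continuous G.
  move=> u; apply: cvgM.
    by apply: cvgM; [exact: cvg_cst|apply: continuous_fsqr; exact/continuous_erlang_int/oner_neq0].
  apply: (@continuous_comp _ _ _ (fun u => - b * ou_unit_variance m u) expR).
    by apply: cvgM; [exact: cvg_cst|exact: cM].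
  exact: continuous_expR.
have G0 u : 0 <= u -> 0 <= G u.
  by move=> u0; rewrite /G mulr_ge0 ?expR_ge0// mulr_ge0 ?sqr_ge0// ltW.
have fE t : 0 <= t -> a * G (a * t) = gam * f t.
  move=> t0; have at0 : 0 <= a * t by rewrite mulr_ge0// ltW.
  rewrite /f /G /ou_scaled_variance (ou_initial_part_scale _ _ a0) (ou_noise_part_scale _ a0 t0).
  rewrite (erlang_int_scale _ _ a0) /ou_unit_variance.
  rewrite (_ : - gam * _ = - b * (ou_noise_part 1 m (a * t) + ou_initial_part 1 m (a * t)));
    last by rewrite /b; ring.
  have e : a ^+ (2 * m + 3) = a * (a ^+ m.+1) ^+ 2.
    by rewrite -exprM -exprS; congr (_ ^+ _); lia.
  by rewrite /b e; field; rewrite expf_neq0 ?gt_eqF.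
have aN := lt0r_neq0 a0.
have cc : continuous (fun t => erlang_int a m t ^+ 2).
  exact/continuous_fsqr/continuous_erlang_int.
have cf : continuous f.
  move=> t; apply: cvgM; first exact: cc.
  apply: (@continuous_comp _ _ _ (fun t => - gam * ou_scaled_variance a m t) expR).
    apply: cvgM; first exact: cvg_cst.
    apply: cvgD; first by have [+ _] := parameterized_Rintegral cc; exact.
    apply: continuous_fsum => k; apply: continuous_fsum => l x.
    apply: cvgM; first exact: cvg_cst.
    by apply: cvgM; exact: continuous_erlang_int.
  exact: continuous_expR.
have If : (\int[mu]_(t in `[0%R, +oo[) (gam * f t)%:E = (ou_response m b)%:E)%E.
  transitivity (\int[mu]_(t in `[0%R, +oo[) (a * G (a * t))%:E)%E.
    by apply: eq_integral => t; rewrite inE/= in_itv/= andbT => t0; rewrite fE.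
  rewrite -integral_scale// /ou_response /Rintegral fineK//.
  exact: integrable_fin_num (iM _ b0).
have f0 t : 0 <= f t by rewrite mulr_ge0 ?sqr_ge0 ?expR_ge0.
have igf : mu.-integrable `[0, +oo[ (EFin \o (fun t => gam * f t)).
  apply: ge0_integrable_of_Rintegrable If => //.
    by apply: continuous_measurable => t; apply: cvgM; [exact: cvg_cst|exact: cf].
  by move=> t _; rewrite mulr_ge0// ltW.
have intf : mu.-integrable `[0, +oo[ (EFin \o f).
  have -> : EFin \o f = (fun t => (gam^-1)%:E * (EFin \o (fun t => (gam * f t)%R)) t)%E.
    by apply/funext => t /=; rewrite -EFinM mulKf// gt_eqF.
  exact: integrableZl igf.
split => //.
by rewrite -RintegralZl// /Rintegral If.
Qed.

End Scaling.

(** * Roots of the dispersion relation *)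

Section Dispersion.
Context {R : realType}.
Notation mu := (@lebesgue_measure R).
Implicit Types (a t x y : R) (m : nat).
Local Open Scope complex_scope.

Lemma memory_coefE a m t : a != 0 -> 0 <= t -> memory_coef m.+1 a t = erlang_int a m t.
Proof.
move=> a0 t0; have fN : m`!%:R != 0 :> R by rewrite pnatr_eq0 -lt0n fact_gt0.
rewrite /memory_coef -(Rintegral_erlang m a0 t0) -RintegralZl//.
  by apply: eq_Rintegral => s _; rewrite /erlang/= mulrC.
apply: continuous_integrable => s; apply: cvgM; last exact: exprn_continuous.
apply: (@continuous_comp _ _ _ (fun s => - a * s) expR); last exact: continuous_expR.
by apply: cvgM; [exact: cvg_cst|exact: cvg_id].
Qed.

Lemma memory_integralE m (q2 a : R) (V f : R -> R) (x y : R) :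
  (forall t, 0 <= t -> memory_coef m a t ^+ 2 * expR (- (q2 / 2) * V t) = f t) ->
  memory_integral m q2 a V (x +i* y) =
    (\int[mu]_(t in `[0, +oo[) (expR (- (x * t)) * cos (- (y * t)) * f t))
    +i* (\int[mu]_(t in `[0, +oo[) (expR (- (x * t)) * sin (- (y * t)) * f t)).
Proof.
move=> fE; rewrite /memory_integral /Cintegral; congr (_ +i* _);
  apply: eq_Rintegral => t; rewrite inE/= in_itv/= andbT => t0;
  rewrite (fE t t0) !mulr0 !mulNr ?subr0 ?addr0 ?oppr0 ?add0r ?subr0 ?addr0//.
Qed.

(* The Laplace transform of a bounded integrable function is continuous on the
   half-line; [`|x|] extends it past the end point. *)
Lemma laplace_root (f : R -> R) (c M : R) : continuous f -> (forall t, 0 <= t -> 0 <= f t <= M) ->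
  mu.-integrable `[0, +oo[ (EFin \o f) -> 0 < c ->
  1 < c * (\int[mu]_(t in `[0, +oo[) f t) ->
  exists2 x, 0 < x & c * (\int[mu]_(t in `[0, +oo[) (expR (- (x * t)) * f t)) = 1.
Proof.
move=> cf fM intf c0 c1.
pose e x t := expR (- (`|x| * t)) * f t.
have ce x : continuous (e x).
  move=> t; apply: cvgM; last exact: cf.
  apply: (@continuous_comp _ _ _ (fun t => - (`|x| * t)) expR); last exact: continuous_expR.
  by apply: (@cvgN _ R^o); apply: cvgM; [exact: cvg_cst|exact: cvg_id].
have e_ge0 x t : 0 <= t -> 0 <= e x t.
  by move=> t0; rewrite mulr_ge0 ?expR_ge0//; case/andP : (fM t t0).
have e_le x t : 0 <= t -> `|e x t| <= f t.
  move=> t0; rewrite ger0_norm ?e_ge0// ler_piMl//; first by case/andP : (fM t t0).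
  by rewrite -[leRHS]expR0 ler_expR oppr_le0 mulr_ge0.
have ie x : mu.-integrable `[0, +oo[ (EFin \o e x).
  apply: le_integrable_real intf => //; first exact: continuous_measurable.
  by move=> t /=; rewrite in_itv/= andbT; exact: e_le.
pose L x := c * \int[mu]_(t in `[0, +oo[) e x t.
have M0 : 0 <= M by case/andP : (fM 0 (lexx 0)); exact: le_trans.
(* [f <= M] gives [L X <= c M / X], below 1 for this [X]; [M + 1] keeps [X] positive. *)
pose X := 2 * c * (M + 1).
have X0 : 0 < X by rewrite !mulr_gt0//; lra.
have LX : L X <= 1.
  have ie0 : mu.-integrable `[0, +oo[ (EFin \o erlang X 0).
    apply: ge0_integrable_of_Rintegrable (integral_erlangy 0 X0) => //.
      by apply: continuous_measurable; exact: continuous_erlang.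
    by move=> t /=; rewrite in_itv/= andbT; exact: erlang_ge0.
  have ier : mu.-integrable `[0, +oo[ (EFin \o (fun t => M * erlang X 0 t)).
    by apply: (integrableZl _ M ie0).
  apply: (@le_trans _ _ (c * \int[mu]_(t in `[0, +oo[) (M * erlang X 0 t))).
    rewrite ler_wpM2l ?(ltW c0)//; apply: le_Rintegral => // t /=.
    rewrite in_itv/= andbT => t0; rewrite /e erlang0 gtr0_norm// mulNr mulrC.
    by rewrite ler_wpM2r ?expR_ge0//; case/andP : (fM t t0).
  rewrite RintegralZl// Rintegral_erlangy// expr1 mulrA ler_pdivrMr// mul1r /X.
  have cM : 0 <= c * M by rewrite mulr_ge0// ltW.
  by rewrite (_ : 2 * c * (M + 1) = 2 * (c * M) + 2 * c); [lra|ring].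
have L0 : 1 < L 0.
  rewrite /L (_ : \int[mu]_(t in _) _ = \int[mu]_(t in `[0, +oo[) f t)//.
  by apply: eq_Rintegral => t _; rewrite /e normr0 mul0r oppr0 expR0 mul1r.
have cL : {within `[0, X], continuous L}.
  have ca : {in `](-1), X + 1[%classic, continuous (fun x => \int[mu]_(t in `[0, +oo[) e x t)}.
    apply: (@continuity_under_integral R _ _ mu e _ _ (-1) (X + 1) _ _ f).
    - exact: measurable_itv.
    - by move=> x _; exact: ie.
    - apply: aeW => t _ x _; rewrite /e; apply: cvgM; last exact: cvg_cst.
      apply: (@continuous_comp _ _ _ (fun x => - (`|x| * t)) expR); last exact: continuous_expR.
      by apply: (@cvgN _ R^o); apply: cvgM; [exact: norm_continuous|exact: cvg_cst].
    - exact: intf.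
    - by move=> x _; apply: aeW => t /=; rewrite in_itv/= andbT; exact: e_le.
  apply: continuous_in_subspaceT => x; rewrite inE/= in_itv/= => /andP[x0 xX].
  apply: cvgM; first exact: cvg_cst.
  apply: ca; rewrite inE/= in_itv/=; apply/andP; split; lra.
have [|x + Lx] := @IVT _ L 0 X 1 (ltW X0) cL.
  by rewrite ge_min le_max LX (ltW L0) orbT.
rewrite in_itv/= le_eqVlt => /andP[/orP[/eqP x0|x0] _].
  by move: L0; rewrite x0 Lx ltxx.
exists x => //; rewrite -Lx /L; congr (_ * _); apply: eq_Rintegral => t _.
by rewrite /e gtr0_norm.
Qed.


End Dispersion.

Section DispersionRoots.
Context {R : realType}.
Notation mu := (@lebesgue_measure R).
Implicit Types (a t x y : R) (m : nat).
Local Open Scope complex_scope.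

Lemma ou_scaled_variance_ge0 a m t : 0 < a -> 0 <= t -> 0 <= ou_scaled_variance a m t.
Proof.
move=> a0 t0; apply: addr_ge0; first by apply: Rintegral_ge0 => s _; exact: sqr_ge0.
apply: sumr_ge0 => k _; apply: sumr_ge0 => l _.
by rewrite mulr_ge0 ?(ltW (ou_gram_gt0 _ _ _ a0))// mulr_ge0// erlang_int_ge0// gt_eqF.
Qed.

Lemma dispersion_rootE m (rho0 g0 g1 w q2 a : R) (V f : R -> R) (x y : R) :
  (forall t, 0 <= t -> memory_coef m a t ^+ 2 * expR (- (q2 / 2) * V t) = f t) ->
  dispersion_root m rho0 g0 g1 w%:C q2 a V (x +i* y) <->
  [/\ - (q2 * g0 ^+ 2 / 2) * a ^- (2 * m) < x,
    - (rho0 * g0 * g1 * w * q2) *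
      \int[mu]_(t in `[0, +oo[) (expR (- (x * t)) * cos (- (y * t)) * f t) = 1 &
    - (rho0 * g0 * g1 * w * q2) *
      \int[mu]_(t in `[0, +oo[) (expR (- (x * t)) * sin (- (y * t)) * f t) = 0].
Proof.
move=> fE; rewrite /dispersion_root (memory_integralE _ _ fE).
rewrite -!(rmorphN, rmorphM)/=.
rewrite (_ : - (rho0 * g0 * g1) * w * q2 = - (rho0 * g0 * g1 * w * q2)); last by ring.
set c := - (rho0 * _ * _ * _ * _).
set A := \int[mu]_(t in _) _; set A' := \int[mu]_(t in _) _.
split=> [[lt /eqP]|[lt e1 e2]].
  by rewrite eq_complex/= !mul0r !subr0 !addr0 => /andP[/eqP e1 /eqP e2]; split.
by split => //; apply/eqP; rewrite eq_complex/= !mul0r !subr0 !addr0 e1 e2 !eqxx.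
Qed.

(** At [lambda = 0] the left-hand side is [c * I a = kappa * ou_response m (h a)]. Both [h] and
    [ou_response] decrease strictly, so it increases strictly with [a]; each comparison with the
    critical value rests on this. *)
Lemma dispersion_dichotomy m (rho0 g0 g1 w q2 : R) (V : R -> R -> R) :
  0 < q2 -> 0 < g0 -> q2 / 2 * g0 ^+ 2 < - (rho0 * g0 * g1 * w * q2) ->
  (forall a t, 0 < a -> 0 <= t -> V a t = g0 ^+ 2 * ou_scaled_variance a m t) ->
  let root a := dispersion_root m.+1 rho0 g0 g1 w%:C q2 a (V a) in
  exists abar : R,
    [/\ 0 < abar /\ root abar 0,
        forall a : R, 0 < a -> root a 0 -> a = abar,
        forall a : R, 0 < a -> a < abar ->
          forall lambda : R[i], root a lambda -> complex.Re lambda < 0 &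
        forall a : R, abar < a ->
          exists lambda : R[i], root a lambda /\ 0 < complex.Re lambda].
Proof.
move=> q2_gt0 g0_gt0 hc VE root.
set c := - _ in hc; set gam := q2 / 2 * g0 ^+ 2 in hc.
have gam0 : 0 < gam by rewrite mulr_gt0 ?divr_gt0 ?exprn_gt0.
have c0 := lt_trans gam0 hc.
pose f a t : R := erlang_int a m t ^+ 2 * expR (- gam * ou_scaled_variance a m t).
have fE a t : 0 < a -> 0 <= t ->
    memory_coef m.+1 a t ^+ 2 * expR (- (q2 / 2) * V a t) = f a t.
  move=> a0 t0; rewrite (memory_coefE _ (lt0r_neq0 a0) t0) (VE a t a0 t0) /f /gam.
  by congr (_ * expR _); ring.
pose kappa := c / gam.
have kappa1 : 1 < kappa by rewrite ltr_pdivlMr// mul1r.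
have [b b0 bE] := ou_response_solution m kappa1.
pose N := (2 * m + 3)%N.
pose h a := gam * a ^- N.
pose I a := \int[mu]_(t in `[0, +oo[) f a t.
have cI a : 0 < a -> c * I a = kappa * ou_response m (h a).
  move=> a0; have [_ _ <-] := ou_response_scale m a0 gam0.
  by rewrite /kappa -mulrA mulKf// gt_eqF.
have h_gt0 a : 0 < a -> 0 < h a by move=> a0; rewrite mulr_gt0// invr_gt0 exprn_gt0.
have h_lt a a' : 0 < a -> a < a' -> h a' < h a.
  move=> a0 aa'; rewrite ltr_pM2l// ltf_pV2 ?posrE ?exprn_gt0// ?(lt_trans a0)//.
  by rewrite ltr_pXn2r ?nnegrE ?(ltW a0) ?(ltW (lt_trans a0 aa'))// /N addn3.
have kappa0 : 0 < kappa by rewrite (lt_trans ltr01).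
have cI_lt a a' : 0 < a -> a < a' -> c * I a < c * I a'.
  move=> a0 aa'; have a'0 := lt_trans a0 aa'.
  by rewrite !cI// ltr_pM2l// ou_response_lt ?h_gt0// h_lt.
(* The solution of [gam * a ^- N = b]. *)
pose abar := (gam / b) `^ (N%:R^-1).
have gb : 0 < gam / b by rewrite divr_gt0.
have abar0 : 0 < abar by rewrite powR_gt0.
have NN : N%:R != 0 :> R by rewrite pnatr_eq0 /N addn3.
have hbar : h abar = b.
  rewrite /h /abar -powR_mulrn ?powR_ge0// -powRrM mulVf// powRr1 ?(ltW gb)//.
  by field; rewrite !gt_eqF.
have cIbar : c * I abar = 1 by rewrite cI// hbar.
have bound a x : 0 < a -> 0 <= x -> - (q2 * g0 ^+ 2 / 2) * a ^- (2 * m.+1) < x.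
  move=> a0; apply: lt_le_trans.
  by rewrite mulNr oppr_lt0 mulr_gt0 ?invr_gt0 ?exprn_gt0// divr_gt0// mulr_gt0// exprn_gt0.
have int_f a : 0 < a -> [/\ continuous (f a), (forall t, 0 <= f a t) &
    mu.-integrable `[0, +oo[ (EFin \o f a)].
  move=> a0; have [cf intf _] := ou_response_scale m a0 gam0.
  by split => // t; rewrite mulr_ge0 ?sqr_ge0 ?expR_ge0.
have rootE a x y (a0 : 0 < a) :=
  dispersion_rootE rho0 g0 g1 w x y (fun t => fE a t a0).
have rootr a x : 0 < a -> 0 <= x ->
    c * (\int[mu]_(t in `[0, +oo[) (expR (- (x * t)) * f a t)) = 1 -> root a x%:C.
  move=> a0 x0 e; apply/(rootE _ _ _ a0); split; first exact: bound.
    rewrite -/c -[RHS]e; congr (_ * _); apply: eq_Rintegral => t _.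
    by rewrite mul0r oppr0 cos0 mulr1.
  rewrite (_ : \int[mu]_(t in _) _ = 0) ?mulr0// -[RHS](mul0r (fine (mu `[0, +oo[))).
  rewrite -Rintegral_cst//.
  by apply: eq_Rintegral => t _; rewrite mul0r oppr0 sin0 mulr0 mul0r.
have root0 a : 0 < a -> root a 0 <-> c * I a = 1.
  move=> a0; have e0 : \int[mu]_(t in `[0, +oo[) (expR (- (0 * t)) * f a t) = I a.
    by apply: eq_Rintegral => t _; rewrite mul0r oppr0 expR0 mul1r.
  split; last by move=> e; apply: rootr => //; rewrite e0.
  move=> /(rootE _ _ _ a0)[_ + _]; rewrite -/c => <-; congr (_ * _).
  by apply: eq_Rintegral => t _; rewrite !mul0r oppr0 expR0 cos0 !mul1r.
exists abar; split.
- by split => //; apply/root0.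
- move=> a a0 /(root0 _ a0) cIa.
  have [aab|aab|//] := ltgtP a abar.
    by have := cI_lt _ _ a0 aab; rewrite cIa cIbar ltxx.
  by have := cI_lt _ _ abar0 aab; rewrite cIa cIbar ltxx.
(* If [x >= 0], the real part of the relation gives [1 <= c * I a], because
   [exp(-x t) cos(-y t) <= 1]; but [a < abar] gives [c * I a < 1]. *)
- move=> a a0 aab [x y] /(rootE _ _ _ a0)[_ e1 _] /=; rewrite ltNge; apply/negP => x0.
  have [cf f0 intf] := int_f a a0.
  have : c * I a < 1 by rewrite -cIbar cI_lt.
  rewrite ltNge -e1 -/c => /negP; apply; rewrite ler_wpM2l ?(ltW c0)//.
  have fl t : 0 <= t -> `|expR (- (x * t)) * cos (- (y * t)) * f a t| <= f a t.
    move=> t0; rewrite normrM (ger0_norm (f0 t)) ler_piMl//.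
    rewrite normrM ger0_norm ?expR_ge0// -[leRHS]mulr1; apply: ler_pM => //.
      by rewrite -[leRHS]expR0 ler_expR oppr_le0 mulr_ge0.
    by rewrite ler_norml cos_geN1 cos_le1.
  apply: le_Rintegral => //.
  + apply: le_integrable_real intf => //.
      apply: continuous_measurable => t; apply: cvgM; last exact: cf.
      apply: cvgM.
        apply: (@continuous_comp _ _ _ (fun t => - (x * t)) expR); last exact: continuous_expR.
        by apply: (@cvgN _ R^o); apply: cvgM; [exact: cvg_cst|exact: cvg_id].
      apply: (@continuous_comp _ _ _ (fun t => - (y * t)) cos); last exact: continuous_cos.
      by apply: (@cvgN _ R^o); apply: cvgM; [exact: cvg_cst|exact: cvg_id].
    by move=> t /=; rewrite in_itv/= andbT; exact: fl.
  + move=> t /=; rewrite in_itv/= andbT => t0.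
    exact: le_trans (ler_norm _) (fl t t0).
- move=> a aab; have a0 := lt_trans abar0 aab; have [cf f0 intf] := int_f a a0.
  (* The bound on [f a] is the square of [a ^- m.+1], the limit of [erlang_int a m] at infinity. *)
  have [] := @laplace_root _ (f a) c ((a ^- m.+1) ^+ 2) cf _ intf c0.
  + move=> t t0; rewrite f0 /f -[leRHS]mulr1; apply: ler_pM; rewrite ?sqr_ge0 ?expR_ge0//.
      by rewrite lerXn2r ?nnegrE ?erlang_int_ge0 ?gt_eqF// ?invr_ge0 ?exprn_ge0 ?(ltW a0)// erlang_int_le.
    rewrite -[leRHS]expR0 ler_expR mulNr oppr_le0 mulr_ge0 ?(ltW gam0)//.
    exact: ou_scaled_variance_ge0.
  + by rewrite -cIbar; exact: cI_lt.
  move=> x x0 e1; exists x%:C; split => //=.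
  exact: rootr _ _ a0 (ltW x0) e1.
Qed.

End DispersionRoots.

(** * Gaussian moments and limits in L2 *)

Section Density.
Import HBNNSimple.
Context {R : realType} d (T : measurableType d).
Variables (mu nu : {measure set T -> \bar R}) (p : T -> R).
Hypothesis mp : measurable_fun setT p.
Hypothesis p_ge0 : forall x, 0 <= p x.
Hypothesis nuE : forall A, measurable A -> nu A = (\int[mu]_(x in A) (p x)%:E)%E.
Local Open Scope ereal_scope.

(** Turns integrals against a normal law into Lebesgue integrals. For simple functions it follows
    from [nuE], and both sides are monotone limits of their values on simple functions. *)
Lemma ge0_integral_density (f : T -> \bar R) : measurable_fun setT f ->
  (forall x, 0 <= f x) -> \int[nu]_x f x = \int[mu]_x (f x * (p x)%:E).
Proof.
move=> mf f0; pose f_ := nnsfun_approx measurableT mf.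
have mpE : measurable_fun setT (EFin \o p) by exact/measurable_EFinP.
have simple (h : {nnsfun T >-> R}) :
    \int[nu]_x (h x)%:E = \int[mu]_x ((h x)%:E * (p x)%:E).
  rewrite integralT_nnsfun sintegralE.
  transitivity (\int[mu]_x
      (\sum_(r \in range h) ((r%:E * (\1_(h @^-1` [set r]) x)%:E) * (p x)%:E))).
    rewrite ge0_integral_fsum//.
    - apply: eq_fsbigr => r /[!inE] -[t _ <-].
      rewrite nuE//.
      under [RHS]eq_integral do rewrite -muleA.
      rewrite ge0_integralZl_EFin//.
      + congr (_ * _); rewrite integral_mkcond; apply: eq_integral => x _.
        by rewrite patchE indicE; case: ifPn => _; rewrite ?mul1e ?mul0e.
      + by move=> x _; rewrite mule_ge0 ?lee_fin.
      + by apply: emeasurable_funM => //; exact/measurable_EFinP.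
    - move=> r; apply: emeasurable_funM => //; apply: measurable_funeM.
      exact/measurable_EFinP.
    - by move=> r x _; rewrite mule_ge0 ?lee_fin//; exact: nnfun_muleindic_ge0.
  apply: eq_integral => x _; rewrite (fimfunE h x) -fsumEFin//.
  rewrite !fsbig_finite//= ge0_sume_distrl//.
  by move=> r _; exact: nnfun_muleindic_ge0.
have nd (x : T) : nondecreasing_seq (fun n => f_ n x).
  by move=> m n mn; exact/lefP/nd_nnsfun_approx.
transitivity (limn (fun n => \int[nu]_x (f_ n x)%:E)).
  rewrite -monotone_convergence//=.
  - by apply: eq_integral => x _; apply/esym/cvg_lim => //; exact: cvg_nnsfun_approx.
  - by move=> n; exact/measurable_EFinP.
  - by move=> n x _; rewrite lee_fin.
  - by move=> x _ m n mn; rewrite lee_fin; exact: nd.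
under eq_fun do rewrite simple.
rewrite -monotone_convergence//=.
- apply: eq_integral => x _; apply/cvg_lim => //.
  apply: cvgeMr => //; exact: cvg_nnsfun_approx.
- by move=> n; apply: emeasurable_funM => //; exact/measurable_EFinP.
- by move=> n x _; rewrite mule_ge0 ?lee_fin.
- by move=> x _ m n mn; rewrite lee_wpmul2r ?lee_fin// nd.
Qed.

End Density.

Section GaussMoments.
Context {R : realType}.
Notation mu := (@lebesgue_measure R).
Import gauss_integral_proof.

Lemma cvg_integral0_gauss : @integral0_gauss R x @[x --> +oo] --> Num.sqrt pi / 2.
Proof.
have : Num.sqrt (@integral0_gauss R x ^+ 2) @[x --> +oo] --> Num.sqrt (pi / 4).
  apply: continuous_cvg => //; [exact: sqrt_continuous|exact: cvg_integral0_gauss_sqr].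
rewrite sqrtrM ?pi_ge0// sqrtrV// (_ : 4 = 2 ^+ 2); last by rewrite expr2 -natrM.
rewrite sqrtr_sqr ger0_norm//.
rewrite (_ : (fun _ => Num.sqrt _) = integral0_gauss)//.
by apply/funext => r; rewrite sqrtr_sqr// ger0_norm// integral0_gauss_ge0.
Qed.

Lemma integral0y_sqr_gauss :
  (\int[mu]_(x in `[0%R, +oo[) (x ^+ 2 * gauss_fun x)%:E = (Num.sqrt pi / 4)%:E)%E.
Proof.
have [cI dI] := parameterized_Rintegral (@continuous_gauss_fun R).
(* Integration by parts: with [g = gauss_fun] and [g' = -2 x g], this [F] has derivative [x^2 g]. *)
pose F (x : R) := integral0_gauss x / 2 - x * gauss_fun x / 2.
have dg (x : R) : is_derive x 1 gauss_fun (- (2 * x) * gauss_fun x).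
  apply: (is_derive_eq (is_derive_fcomp (is_derive_fN
    (is_derive_fM (is_derive_fid x) (is_derive_fid x))) (is_derive_expR _))).
  rewrite /gauss_fun -expr2. ring.
have F0 : F 0 = 0.
  by rewrite /F mul0r mul0r subr0 /integral0_gauss set_itv1 Rintegral_set1 mul0r.
rewrite (@ge0_continuous_FTC2y _ _ F 0 (Num.sqrt pi / 4)).
- by rewrite F0 sube0.
- by move=> x _; rewrite mulr_ge0 ?sqr_ge0 ?gauss_fun_ge0.
- apply: continuous_subspaceT => x; apply: cvgM; last exact: continuous_gauss_fun.
  exact: exprn_continuous.
- have -> : Num.sqrt pi / 4 = Num.sqrt pi / 2 / 2 - 0 :> R by field.
  apply: cvgB; first by apply: cvgM; [exact: cvg_integral0_gauss|exact: cvg_cst].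
  rewrite [X in _ --> X](_ : _ = 0 / 2); last by rewrite mul0r.
  apply: cvgM; last exact: cvg_cst.
  have Vx : x^-1 @[x --> +oo] --> (0 : R).
    apply/(@gtr0_cvgV0 _ _ _ _ id); last exact: cvg_id.
    by near=> x.
  (* [x exp(-x^2) <= 1 / x], from [exp(x^2) >= 1 + x^2]. *)
  apply: squeeze_cvgr (cvg_cst 0) Vx; near=> x.
  have x0 : 0 < x by [].
  rewrite mulr_ge0 ?gauss_fun_ge0 ?(ltW x0)//= /gauss_fun expRN ler_pdivrMr ?expR_gt0//.
  rewrite -ler_pdivrMl ?invr_gt0// invrK -expr2 (le_trans _ (expR_ge1Dx _))//.
  by rewrite lerDr.
- move=> x x0.
  have dF := is_derive_fB (is_derive_fM (dI x x0) (is_derive_fcst 2^-1 x))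
    (is_derive_fM (is_derive_fM (is_derive_fid x) (dg x)) (is_derive_fcst 2^-1 x)).
  by have [] := dF.
- apply: cvg_at_right_filter.
  have cg := @continuous_gauss_fun R.
  apply: cvgB; (apply: cvgM; last exact: cvg_cst); first exact: cI.
  by apply: cvgM; [exact: cvg_id|exact: cg].
- move=> x; rewrite in_itv/= andbT => x0.
  have dF := is_derive_fB (is_derive_fM (dI x x0) (is_derive_fcst 2^-1 x))
    (is_derive_fM (is_derive_fM (is_derive_fid x) (dg x)) (is_derive_fcst 2^-1 x)).
  rewrite derive1E; have [_ ->] := dF; field.
Unshelve. all: by end_near. Qed.

Variable s : R.
Hypothesis s0 : 0 < s.
Let p := normal_pdf 0 s.

Let cp : continuous p. Proof. by apply: continuous_normal_pdf; rewrite gt_eqF. Qed.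

Let pN x : p (- x) = p x.
Proof. by rewrite /p !normal_pdfE ?gt_eqF// /normal_fun !subr0 sqrrN. Qed.

Let p0 x : 0 <= p x. Proof. exact: normal_pdf_ge0. Qed.

Lemma integral_sqr_normal_pdf : (\int[mu]_x ((x ^+ 2)%:E * (p x)%:E) = (s ^+ 2)%:E)%E.
Proof.
transitivity (\int[mu]_x (x ^+ 2 * p x)%:E)%E; first by apply: eq_integral => x _; rewrite EFinM.
have cf : continuous (fun x : R => x ^+ 2 * p x).
  by move=> x; apply: cvgM; [exact: exprn_continuous|exact: cp].
rewrite ge0_symfun_integralT//=; last 2 first.
- by move=> x; rewrite mulr_ge0 ?sqr_ge0.
- by move=> x /=; rewrite pN sqrrN.
rewrite (_ : [set x | _] = `[0, +oo[%classic); last first.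
  by apply/seteqP; split => x/=; rewrite in_itv/= andbT.
pose a := (Num.sqrt 2 * s)^-1.
have r2 : 0 < Num.sqrt 2 :> R by rewrite sqrtr_gt0.
have a0 : 0 < a by rewrite invr_gt0 mulr_gt0.
have pi0 : 0 < Num.sqrt pi :> R by rewrite sqrtr_gt0 pi_gt0.
have sq2 : Num.sqrt 2 ^+ 2 = 2 :> R by rewrite sqr_sqrtr.
(* Chosen to absorb the normalisation of the density; then [2 k sqrt(pi) / 4 = s^2]. *)
pose k : R := 2 * s ^+ 2 / Num.sqrt pi.
have e (x : R) : x ^+ 2 * p x = k * (a * ((a * x) ^+ 2 * gauss_fun (a * x))).
  rewrite /p normal_pdfE ?gt_eqF// /normal_fun /normal_peak /gauss_fun subr0.
  have -> : (s ^+ 2 * pi *+ 2) = 2 * pi * s ^+ 2 by rewrite -mulr_natl; ring.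
  rewrite sqrtrM ?mulr_ge0 ?pi_ge0// sqrtr_sqr gtr0_norm// sqrtrM//.
  have -> : - x ^+ 2 / (s ^+ 2 *+ 2) = - (a * x) ^+ 2.
    rewrite /a exprMn exprVn exprMn sq2 -mulr_natl; field. by rewrite gt_eqF.
  have -> : a * ((a * x) ^+ 2 * expR (- (a * x) ^+ 2)) =
      x ^+ 2 * expR (- (a * x) ^+ 2) * (a * a ^+ 2) by ring.
  have a2 : a ^+ 2 = (2 * s ^+ 2)^-1 by rewrite /a exprVn exprMn sq2.
  set E := expR _; rewrite a2 /a /k; field.
  by rewrite !gt_eqF.
transitivity (2%:E * (k%:E * \int[mu]_(x in `[0%R, +oo[) (a * ((a * x) ^+ 2 * gauss_fun (a * x)))%:E))%E.
  congr (_ * _)%E; rewrite -ge0_integralZl_EFin//.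
  - by apply: eq_integral => x _; rewrite e EFinM.
  - by move=> x /= _; rewrite lee_fin mulr_ge0 ?(ltW a0)// mulr_ge0 ?sqr_ge0// gauss_fun_ge0.
  - apply/measurable_EFinP; apply: continuous_measurable => x.
    apply: cvgM; first exact: cvg_cst.
    apply: (@continuous_comp _ _ _ (fun x : R => a * x) (fun y => y ^+ 2 * gauss_fun y)).
      by apply: cvgM; [exact: cvg_cst|exact: cvg_id].
    by apply: cvgM; [exact: exprn_continuous|exact: continuous_gauss_fun].
  - by rewrite /k divr_ge0 ?(ltW pi0)// mulr_ge0// sqr_ge0.
rewrite -(@integral_scale _ a (fun x => x ^+ 2 * gauss_fun x))//.
- rewrite integral0y_sqr_gauss -!EFinM /k; congr EFin; field; by rewrite gt_eqF.
- by move=> x; apply: cvgM; [exact: exprn_continuous|exact: continuous_gauss_fun].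
- by move=> x _; rewrite mulr_ge0 ?sqr_ge0 ?gauss_fun_ge0.
Qed.

(** Reflection [x -> -x] exchanges the positive and negative parts; stated with nonnegative
    integrands, this yields the zero mean of a normal variable. *)
Lemma integral_maxr_normal_pdf :
  (\int[mu]_x ((Num.max x 0)%:E * (p x)%:E) = \int[mu]_x ((Num.max (- x) 0)%:E * (p x)%:E))%E.
Proof.
have cG : continuous (fun x : R => - x * p x).
  by move=> x; apply: cvgM; [apply: (@cvgN _ R^o); exact: cvg_id|exact: cp].
transitivity (\int[mu]_(x in `[0%R, +oo[) (x * p x)%:E)%E.
  rewrite [RHS]integral_mkcond; apply: eq_integral => x _; rewrite patchE.
  case: ifPn; rewrite ?(inE, notin_setE)/= in_itv/= andbT => x0.
    by rewrite (max_idPl _)// EFinM.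
  by rewrite (max_idPr _) ?mul0e// ltW// ltNge; apply/negP.
transitivity (\int[mu]_(x in `]-oo, (- 0)%R]) (- x * p x)%:E)%E.
  rewrite ge0_integration_by_substitutionNy.
  - by apply: eq_integral => x _ /=; rewrite opprK pN.
  - exact: continuous_subspaceT.
  - move=> x; rewrite in_itv/= oppr0 => x0.
    by rewrite mulr_ge0// oppr_ge0 ltW.
rewrite oppr0 [LHS]integral_mkcond; apply: eq_integral => x _; rewrite patchE.
case: ifPn; rewrite ?(inE, notin_setE)/= in_itv/= => x0.
  by rewrite (max_idPl _) ?oppr_ge0// EFinM.
by rewrite (max_idPr _) ?mul0e// oppr_le0 ltW// ltNge; apply/negP.
Qed.

End GaussMoments.

(** * Square-integrable random variables *)

Section SquareIntegrable.
Context {R : realType} d (T : measurableType d) (P : probability T R).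
Implicit Types (X Y Z : T -> R) (c : R).

Definition square_integrable X :=
  measurable_fun setT X /\ P.-integrable setT (EFin \o (fun w => X w ^+ 2)).

Definition inner X Y : R := \int[P]_w (X w * Y w).

Definition mean X : R := \int[P]_w X w.

Lemma le_integrable_prob X Y : measurable_fun setT X -> (forall w, `|X w| <= Y w) ->
  P.-integrable setT (EFin \o Y) -> P.-integrable setT (EFin \o X).
Proof.
move=> mX XY; apply: le_integrable => //; first exact/measurable_EFinP.
by move=> x _ /=; rewrite lee_fin (le_trans (XY x))// ler_norm.
Qed.

Lemma square_integrable_inner X Y : square_integrable X -> square_integrable Y ->
  P.-integrable setT (EFin \o (fun w => X w * Y w)).
Proof.
move=> [mX iX] [mY iY].
have iXY : P.-integrable setT (EFin \o (fun w => X w ^+ 2 + Y w ^+ 2)).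
  exact: integrableD iX iY.
apply: le_integrable_prob iXY; first exact: measurable_funM.
move=> w; have h1 := sqr_ge0 (X w - Y w); have h2 := sqr_ge0 (X w + Y w).
rewrite ler_norml; apply/andP; split; nra.
Qed.

Lemma square_integrable_mean X : square_integrable X -> P.-integrable setT (EFin \o X).
Proof.
move=> [mX iX].
have i1 : P.-integrable setT (EFin \o (fun w => 1 + X w ^+ 2)).
  exact: (integrableD _ (finite_measure_integrable_cst P 1 measurableT) iX).
apply: le_integrable_prob i1 => // w.
have h1 := sqr_ge0 (X w - 1); have h2 := sqr_ge0 (X w + 1).
by rewrite ler_norml; apply/andP; split; nra.
Qed.

Lemma square_integrableD X Y : square_integrable X -> square_integrable Y ->
  square_integrable (fun w => X w + Y w).
Proof.
move=> [mX iX] [mY iY]; split; first exact: measurable_funD.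
have i : P.-integrable setT (EFin \o (fun w => 2 * (X w ^+ 2 + Y w ^+ 2))).
  by apply: (integrableZl _ 2 (integrableD _ iX iY)).
apply: le_integrable_prob i; first by apply: measurable_funX; exact: measurable_funD.
by move=> w; rewrite ger0_norm ?sqr_ge0//; have := sqr_ge0 (X w - Y w); nra.
Qed.

Lemma square_integrableZ c X : square_integrable X ->
  square_integrable (fun w => c * X w).
Proof.
move=> [mX iX]; split; first exact: measurable_funM.
have i : P.-integrable setT (EFin \o (fun w => c ^+ 2 * X w ^+ 2)).
  by apply: (integrableZl _ (c ^+ 2) iX).
apply: le_integrable_prob i; first by apply: measurable_funX; exact: measurable_funM.
by move=> w; rewrite exprMn ger0_norm// mulr_ge0 ?sqr_ge0.
Qed.

Lemma square_integrable0 : square_integrable (fun=> 0).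
Proof.
split; first exact: measurable_cst.
by rewrite expr0n; exact: finite_measure_integrable_cst.
Qed.

Lemma square_integrable_sum (I : Type) (r : seq I) (c : I -> R) (X : I -> T -> R) :
  (forall i, square_integrable (X i)) ->
  square_integrable (fun w => \sum_(i <- r) c i * X i w).
Proof.
move=> sX; elim: r => [|i r ih].
  by under eq_fun do rewrite big_nil; exact: square_integrable0.
under eq_fun do rewrite big_cons.
by apply: square_integrableD => //; exact: square_integrableZ.
Qed.

Lemma innerC X Y : inner X Y = inner Y X.
Proof. by apply: eq_Rintegral => w _; rewrite mulrC. Qed.

Lemma innerD X Y Z : square_integrable X -> square_integrable Y -> square_integrable Z ->
  inner (fun w => X w + Y w) Z = inner X Z + inner Y Z.
Proof.
move=> sX sY sZ; rewrite /inner -RintegralD//; last 2 first.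
- exact: square_integrable_inner.
- exact: square_integrable_inner.
by apply: eq_Rintegral => w _; rewrite mulrDl.
Qed.

Lemma innerZ c X Z : square_integrable X -> square_integrable Z ->
  inner (fun w => c * X w) Z = c * inner X Z.
Proof.
move=> sX sZ; rewrite /inner -RintegralZl//; last exact: square_integrable_inner.
by apply: eq_Rintegral => w _; rewrite mulrA.
Qed.

Lemma inner_suml (I : Type) (r : seq I) (c : I -> R) (X : I -> T -> R) Z :
  (forall i, square_integrable (X i)) -> square_integrable Z ->
  inner (fun w => \sum_(i <- r) c i * X i w) Z = \sum_(i <- r) c i * inner (X i) Z.
Proof.
move=> sX sZ; elim: r => [|i r ih].
  rewrite big_nil /inner; under eq_Rintegral do rewrite big_nil mul0r.
  by rewrite Rintegral_cst// mul0r.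
rewrite big_cons -ih -innerZ// -innerD//.
- by apply: eq_Rintegral => w _; rewrite big_cons.
- exact: square_integrableZ.
- exact: square_integrable_sum.
Qed.

Lemma mean_sum (I : Type) (r : seq I) (c : I -> R) (X : I -> T -> R) :
  (forall i, square_integrable (X i)) ->
  mean (fun w => \sum_(i <- r) c i * X i w) = \sum_(i <- r) c i * mean (X i).
Proof.
move=> sX; elim: r => [|i r ih].
  rewrite big_nil /mean; under eq_Rintegral do rewrite big_nil.
  by rewrite Rintegral_cst// mul0r.
rewrite big_cons -ih /mean; under eq_Rintegral do rewrite big_cons.
rewrite RintegralD//; last 2 first.
- exact/square_integrable_mean/square_integrableZ.
- exact/square_integrable_mean/square_integrable_sum.
by rewrite RintegralZl//; exact: square_integrable_mean.
Qed.

Lemma variance_centered X : square_integrable X -> mean X = 0 ->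
  fine ('V_P[X])%E = inner X X.
Proof.
move=> sX mX0; have iX := square_integrable_mean sX.
rewrite /variance covariance.unlock.
have -> : ('E_P[X] = 0)%E.
  rewrite expectation.unlock -(fineK (integrable_fin_num measurableT iX)).
  by congr EFin; exact: mX0.
rewrite /= (_ : X \- cst 0 = X); last by apply/funext => w /=; rewrite subr0.
by rewrite expectation.unlock.
Qed.

End SquareIntegrable.

Section Independence.
Context {R : realType} d (T : measurableType d) (P : probability T R).
Local Open Scope ereal_scope.

(* Fubini for the joint law, which is the product of the laws. *)
Lemma inner_independent (X Y : {RV P >-> R}) :
  (forall E F : set R, measurable E -> measurable F ->
    P (X @^-1` E `&` Y @^-1` F) = P (X @^-1` E) * P (Y @^-1` F)) ->
  square_integrable P X -> square_integrable P Y -> mean P Y = 0%R ->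
  inner P X Y = 0%R.
Proof.
move=> XY sX sY mY0.
have mZ : measurable_fun setT (fun w => (X w, Y w)) by exact: measurable_fun_pair.
pose Z := mfun_Sub (mem_set mZ).
pose f (z : R * R) := (z.1 * z.2)%:E.
have mf : measurable_fun setT f.
  by apply/measurable_EFinP; exact: measurable_funM.
have prodE A : measurable A -> (distribution P X \x distribution P Y) A = distribution P Z A.
  by move=> mA; apply: product_measure_unique.
have iXY := square_integrable_inner sX sY.
have iZ : (distribution P Z).-integrable setT f.
  by apply: integrable_pushforward.
have iprod : (distribution P X \x distribution P Y).-integrable setT f.
  apply/integrableP; split => //; case/integrableP : iZ => _; apply: le_lt_trans.
  rewrite le_eqVlt; apply/orP; left; apply/eqP.
  by apply: eq_measure_integral => A mA _; exact: prodE.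
have iY := square_integrable_mean sY.
rewrite /inner /Rintegral (_ : \int[P]_w _ = 0)//.
transitivity (\int[distribution P Z]_z f z); first by rewrite integral_distribution.
rewrite -(@eq_measure_integral _ _ _ _ _ (distribution P X \x distribution P Y)); last first.
  by move=> A mA _; exact: prodE.
rewrite -integral12_prod_meas1//.
rewrite -[RHS](integral0 (distribution P X) setT).
have mY : \int[distribution P Y]_y y%:E = 0.
  rewrite integral_distribution//.
  by rewrite -(fineK (integrable_fin_num measurableT iY)); congr EFin; exact: mY0.
have iYd : (distribution P Y).-integrable setT (@EFin R).
  by apply: integrable_pushforward.
apply: eq_integral => x _; rewrite /fubini_F /f /=.
under eq_integral do rewrite EFinM.
by rewrite integralZl// mY mule0.
Qed.

End Independence.

Section NormalMoments.
Context {R : realType} d (T : measurableType d) (P : probability T R).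
Local Open Scope ereal_scope.

Lemma integral_normal_law (X : {RV P >-> R}) (v : R) (g : R -> \bar R) :
  (0 <= v)%R -> has_normal_law P 0 v X ->
  measurable_fun setT g -> (forall x, 0 <= g x) ->
  \int[P]_w g (X w) = if v == 0%R then g 0%R
    else \int[lebesgue_measure]_x (g x * (normal_pdf 0 (Num.sqrt v) x)%:E).
Proof.
move=> v0 hX mg g0; case: eqVneq => [vE|vN].
  rewrite -[LHS](ge0_integral_distribution X mg g0).
  rewrite (@eq_measure_integral _ _ _ _ (dirac (0%R : R))).
    by rewrite integral_dirac// diracT mul1e.
  by move=> A mA _; have := hX A mA; rewrite vE eqxx.
have mX : measurable_fun setT (X : T -> measurableTypeR R) := measurable_funP X.
pose X' : {mfun T >-> measurableTypeR R} :=
  @mfun_Sub _ _ T (measurableTypeR R) (X : T -> measurableTypeR R) (mem_set mX).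
have mg' : measurable_fun [set: measurableTypeR R] g := mg.
transitivity (\int[normal_prob 0 (Num.sqrt v)]_x g x).
  rewrite -[LHS](ge0_integral_distribution X' mg' g0).
  by apply: eq_measure_integral => A mA _; have := hX A mA; rewrite (negbTE vN).
apply: ge0_integral_density => //.
- exact: measurable_normal_pdf.
- by move=> x; exact: normal_pdf_ge0.
Qed.

Lemma normal_law_moments (X : {RV P >-> R}) (v : R) : (0 <= v)%R ->
  has_normal_law P 0 v X ->
  [/\ square_integrable P X, mean P X = 0%R & inner P X X = v].
Proof.
move=> v0 hX; pose s := Num.sqrt v.
have I2 : \int[P]_w (X w ^+ 2)%:E = v%:E.
  rewrite (integral_normal_law v0 hX (g := fun x => (x ^+ 2)%:E)); last 2 first.
  - by apply/measurable_EFinP; exact: exprn_measurable.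
  - by move=> x; rewrite lee_fin sqr_ge0.
  case: eqVneq => [->|vN]; first by rewrite expr0n.
  have s0 : (0 < s)%R by rewrite sqrtr_gt0 lt_neqAle eq_sym vN.
  by rewrite (integral_sqr_normal_pdf s0) sqr_sqrtr.
have sX : square_integrable P X.
  split => //; apply/integrableP; split.
    by apply/measurable_EFinP; exact: measurable_funX.
  under eq_integral => w _ do rewrite /= ger0_norm ?sqr_ge0//.
  by rewrite I2 ltry.
have IB : \int[P]_w (Num.max (X w) 0)%:E = \int[P]_w (Num.max (- X w) 0)%:E.
  rewrite (integral_normal_law v0 hX (g := fun x => (Num.max x 0)%:E)); last 2 first.
  - by apply/measurable_EFinP; exact: measurable_maxr.
  - by move=> x; rewrite lee_fin le_max lexx orbT.
  rewrite (integral_normal_law v0 hX (g := fun x => (Num.max (- x) 0)%:E)); last 2 first.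
  - by apply/measurable_EFinP; exact: measurable_maxr.
  - by move=> x; rewrite lee_fin le_max lexx orbT.
  case: eqVneq => [_|vN]; first by rewrite oppr0.
  have s0 : (0 < s)%R by rewrite sqrtr_gt0 lt_neqAle eq_sym vN.
  exact: integral_maxr_normal_pdf.
split => //; last by rewrite /inner /Rintegral; under eq_integral do rewrite -expr2; rewrite I2.
have iX := square_integrable_mean sX.
have fin := integrable_neg_fin_num measurableT iX.
rewrite /mean /Rintegral integralE.
have e1 : \int[P]_x ((EFin \o X)^\+) x = \int[P]_w (Num.max (X w) 0)%:E.
  by apply: eq_integral => w _; rewrite funeposE /= EFin_max.
have e2 : \int[P]_x ((EFin \o X)^\-) x = \int[P]_w (Num.max (- X w) 0)%:E.
  by apply: eq_integral => w _; rewrite funenegE /= EFin_max.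
by rewrite e1 e2 IB subee// -e2.
Qed.
End NormalMoments.

Section L2Limit.
Context {R : realType} d (T : measurableType d) (P : probability T R).
Implicit Types (X Y : T -> R).

Lemma ae_eq0_moments X : measurable_fun setT X -> {ae P, forall w, X w = 0} ->
  [/\ square_integrable P X, mean P X = 0 & forall Z, measurable_fun setT Z -> inner P X Z = 0].
Proof.
move=> mX X0.
have ae0 (f : T -> R) : measurable_fun setT f -> {ae P, forall w, f w = 0} ->
    (\int[P]_w (f w)%:E = 0)%E.
  move=> mf f0; rewrite -[RHS](integral0 P setT); apply: ae_eq_integral => //.
    exact/measurable_EFinP.
  by apply: filterS f0 => w fw _; rewrite fw.
split.
- split => //; apply/integrableP; split.
    by apply/measurable_EFinP; exact: measurable_funX.
  under eq_integral => w _ do rewrite /= ger0_norm ?sqr_ge0//.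
  rewrite ae0 ?ltry//; first exact: measurable_funX.
  by apply: filterS X0 => w ->; rewrite expr0n.
- by rewrite /mean /Rintegral ae0.
- move=> Z mZ; rewrite /inner /Rintegral ae0//; first exact: measurable_funM.
  by apply: filterS X0 => w ->; rewrite mul0r.
Qed.

Lemma ae_eq_moments X Y : measurable_fun setT X -> measurable_fun setT Y ->
  {ae P, forall w, X w = Y w} -> square_integrable P X ->
  [/\ square_integrable P Y, mean P Y = mean P X & inner P Y Y = inner P X X].
Proof.
move=> mX mY XY [_ iX].
have XY2 : {ae P, forall w, X w ^+ 2 = Y w ^+ 2} by apply: filterS XY => w ->.
have e (f g : T -> R) : measurable_fun setT f -> measurable_fun setT g ->
    {ae P, forall w, f w = g w} -> (\int[P]_w (f w)%:E = \int[P]_w (g w)%:E)%E.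
  move=> mf mg fg; apply: ae_eq_integral => //; do ?exact/measurable_EFinP.
  by apply: filterS fg => w fw _; rewrite fw.
split.
- split => //; apply/integrableP; split.
    by apply/measurable_EFinP; exact: measurable_funX.
  case/integrableP : iX => _; apply: le_lt_trans.
  rewrite le_eqVlt; apply/orP; left; apply/eqP => /=; apply/esym.
  rewrite (e (fun w => `|X w ^+ 2|) (fun w => `|Y w ^+ 2|))//.
  + by apply: measurableT_comp => //; exact: measurable_funX.
  + by apply: measurableT_comp => //; exact: measurable_funX.
  + by apply: filterS XY2 => w ->.
- by rewrite /mean /Rintegral (e X Y).
- rewrite /inner /Rintegral (e (fun w => X w * X w) (fun w => Y w * Y w))//.
  + exact: measurable_funM.
  + exact: measurable_funM.
Qed.

Lemma inner_ge0 X : 0 <= inner P X X.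
Proof. by apply: Rintegral_ge0 => w _; rewrite -expr2 sqr_ge0. Qed.

Lemma inner_sqrDZ X Y (c : R) : square_integrable P X -> square_integrable P Y ->
  inner P (fun w => X w + c * Y w) (fun w => X w + c * Y w) =
    inner P X X + 2 * c * inner P X Y + c ^+ 2 * inner P Y Y.
Proof.
move=> sX sY; have sZ := square_integrableZ c sY; have sXZ := square_integrableD sX sZ.
rewrite innerD// innerZ// (innerC _ X) (innerC _ Y) !innerD// !innerZ//.
by rewrite (innerC _ Y X); ring.
Qed.

(** Expand [e] times the squared norm of [X + c Y] at [c = 1 / e] and at [c = -1 / e]. *)
Lemma inner_young X Y (e : R) : 0 < e -> square_integrable P X -> square_integrable P Y ->
  `|2 * inner P X Y| <= e * inner P X X + e^-1 * inner P Y Y.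
Proof.
move=> e0 sX sY; have eN := lt0r_neq0 e0.
have h c : 0 <= e * (inner P X X + 2 * c * inner P X Y + c ^+ 2 * inner P Y Y).
  by rewrite -inner_sqrDZ// mulr_ge0 ?(ltW e0)// inner_ge0.
have h1 := h e^-1; have h2 := h (- e^-1).
have e1 : e * (inner P X X + 2 * e^-1 * inner P X Y + e^-1 ^+ 2 * inner P Y Y) =
  e * inner P X X + 2 * inner P X Y + e^-1 * inner P Y Y by field.
have e2 : e * (inner P X X + 2 * - e^-1 * inner P X Y + (- e^-1) ^+ 2 * inner P Y Y) =
  e * inner P X X - 2 * inner P X Y + e^-1 * inner P Y Y by field.
by rewrite e1 in h1; rewrite e2 in h2; rewrite ler_norml; apply/andP; split; lra.
Qed.

(** If the inner products tend to [L] as both indices grow, squared distances tend to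
    [L - 2 L + L = 0], so the sequence is Cauchy in L2; Fatou's lemma identifies its limit with the
    pointwise limit [S]. *)
Lemma L2_limit (S_ : nat -> T -> R) (S : T -> R) (L : R) :
  (forall n, square_integrable P (S_ n)) -> measurable_fun setT S ->
  (forall w, S_ n w @[n --> \oo] --> S w) ->
  (forall e : R, 0 < e -> exists N, forall n m, (N <= n)%N -> (N <= m)%N ->
     `|inner P (S_ n) (S_ m) - L| <= e) ->
  (forall n, mean P (S_ n) = 0) ->
  [/\ square_integrable P S, mean P S = 0 & inner P S S = L].
Proof.
move=> sS mS cS hL mean0.
have sB n m : square_integrable P (fun w => S_ n w + (-1) * S_ m w).
  by apply: square_integrableD => //; exact: square_integrableZ.
have dist n m : inner P (fun w => S_ n w + (-1) * S_ m w) (fun w => S_ n w + (-1) * S_ m w) =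
    inner P (S_ n) (S_ n) - 2 * inner P (S_ n) (S_ m) + inner P (S_ m) (S_ m).
  by rewrite inner_sqrDZ//; ring.
(* By Fatou, the limit is at distance at most [4 e] from the tail of the sequence. *)
have key e : 0 < e -> exists n, [/\ `|inner P (S_ n) (S_ n) - L| <= e,
    square_integrable P (fun w => S w + (-1) * S_ n w) &
    inner P (fun w => S w + (-1) * S_ n w) (fun w => S w + (-1) * S_ n w) <= 4 * e].
  move=> e0; have [N hN] := hL e e0; exists N.
  have mD : measurable_fun setT (fun w => S w + (-1) * S_ N w).
    by apply: measurable_funD => //; apply: measurable_funM => //; have [] := sS N.
  pose f m w := ((S_ (m + N)%N w + (-1) * S_ N w) ^+ 2)%:E.
  have mf m : measurable_fun setT (f m).
    by apply/measurable_EFinP; apply: measurable_funX; have [] := sB (m + N)%N N.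
  have fat := @fatou _ _ _ P setT measurableT f mf _.
  have If m : (\int[P]_w f m w <= (4 * e)%:E)%E.
    have [_ iB] := sB (m + N)%N N.
    rewrite -(fineK (integrable_fin_num measurableT iB)) lee_fin.
    have : inner P (fun w => S_ (m + N)%N w + (-1) * S_ N w)
        (fun w => S_ (m + N)%N w + (-1) * S_ N w) <= 4 * e.
      rewrite dist.
      have := hN _ _ (leqnn N) (leqnn N); have := hN _ _ (leq_addl m N) (leqnn N).
      have := hN _ _ (leq_addl m N) (leq_addl m N).
      by rewrite !ler_norml => /andP[? ?] /andP[? ?] /andP[? ?]; lra.
    apply: le_trans; rewrite le_eqVlt; apply/orP; left; apply/eqP.
    by rewrite /inner /Rintegral; congr fine; apply: eq_integral => w _; rewrite /= expr2.
  have limf w : limn_einf (fun m => f m w) = ((S w + (-1) * S_ N w) ^+ 2)%:E.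
    have cf : f m w @[m --> \oo] --> ((S w + (-1) * S_ N w) ^+ 2)%:E.
      apply: cvg_EFin; first exact: nearW.
      have c1 : S_ (m + N)%N w + (-1) * S_ N w @[m --> \oo] --> S w + (-1) * S_ N w.
        apply: cvgD; last exact: cvg_cst.
        by rewrite (cvg_shiftn N (fun m => S_ m w)); exact: cS.
      exact: (cvgM c1 c1).
    by rewrite is_cvg_limn_einfE ?(cvg_lim _ cf)//; apply/cvg_ex; exists (((S w + (-1) * S_ N w) ^+ 2)%:E).
  have I4 : (\int[P]_w ((S w + (-1) * S_ N w) ^+ 2)%:E <= (4 * e)%:E)%E.
    under eq_integral => w _ do rewrite -limf.
    apply: (le_trans (fat _)); first by move=> m w _; rewrite lee_fin sqr_ge0.
    rewrite limn_einf_lim; apply: lime_le; first exact: is_cvg_einfs.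
    near=> m; apply: le_trans (If m); apply: ereal_inf_lbound.
    by exists m => //=.
  have sD : square_integrable P (fun w => S w + (-1) * S_ N w).
    split => //; apply/integrableP; split.
      by apply/measurable_EFinP; exact: measurable_funX.
    under eq_integral => w _ do rewrite /= ger0_norm ?sqr_ge0//.
    by rewrite (le_lt_trans I4) ?ltry.
  split => //; first exact: hN.
  rewrite -lee_fin; apply: le_trans I4; rewrite le_eqVlt; apply/orP; left; apply/eqP.
  rewrite /inner /Rintegral fineK; last first.
    exact/integrable_fin_num/square_integrable_inner.
  by apply: eq_integral => w _; rewrite -expr2.
(* [key] is applied with [e = eta ^+ 2]. Young's inequality with parameter [eta] bounds [2 |mean S|]
   by [eta + 4 eta]; in the second estimate [|L| + 10] collects 1 from [S_ n], [|L| + 1 + 4] from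
   the cross term and 4 from [D]. *)
have bound (eta : R) : 0 < eta -> eta <= 1 -> square_integrable P S /\
    (`|mean P S| <= 5 / 2 * eta /\ `|inner P S S - L| <= (`|L| + 10) * eta).
  move=> eta0 eta1; have e0 : 0 < eta ^+ 2 by rewrite exprn_gt0.
  have [n [hn sD D4]] := key _ e0.
  set D := (fun w => S w + (-1) * S_ n w) in sD D4.
  have SE : S = (fun w => S_ n w + 1 * D w) by apply/funext => w; rewrite /D; ring.
  have sD1 := square_integrableZ 1 sD.
  have sS1 : square_integrable P S by rewrite SE; exact: square_integrableD.
  have etaN := lt0r_neq0 eta0.
  have D4' : eta^-1 * inner P D D <= 4 * eta.
    by rewrite mulrC ler_pdivrMr// -mulrA -expr2.
  have eta2 : eta ^+ 2 <= eta by rewrite expr2 ler_piMl// ltW.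
  split => //; split.
    have -> : mean P S = inner P (fun=> 1) D.
      have iD := square_integrable_mean sD.
      have := mean0 n; rewrite SE /mean /inner RintegralD//; last 2 first.
      - exact: square_integrable_mean.
      - exact: square_integrable_mean.
      by move=> ->; rewrite add0r.
    have s1 : square_integrable P (fun=> 1).
      by split; [exact: measurable_cst|exact: finite_measure_integrable_cst].
    have in1 : inner P (fun=> 1) (fun=> 1) = 1.
      by rewrite /inner Rintegral_cst//= probability_setT mulr1 mul1r.
    have := inner_young eta0 s1 sD; rewrite in1 mulr1 normrM ger0_norm// => h.
    lra.
  have -> : inner P S S = inner P (S_ n) (S_ n) + 2 * inner P (S_ n) D + inner P D D.
    by rewrite SE inner_sqrDZ//; ring.
  have Y := inner_young eta0 (sS n) sD.
  have nn : inner P (S_ n) (S_ n) <= `|L| + 1.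
    move: hn; rewrite ler_norml => /andP[_ h]; have := ler_norm L; lra.
  have nn2 := ler_wpM2l (ltW eta0) nn.
  have D0 := inner_ge0 D.
  move: hn Y; rewrite !ler_norml => /andP[h1 h2] /andP[h3 h4].
  by apply/andP; split; lra.
have [sS1 _] := bound 1 ltr01 (lexx _).
have sml (x C : R) : (forall eta, 0 < eta -> eta <= 1 -> `|x| <= C * eta) -> x = 0.
  move=> h; apply/eqP; rewrite -normr_eq0 eq_le normr_ge0 andbT; apply/ler_addgt0Pl => z z0.
  have C0 : 0 <= C by have := h 1 ltr01 (lexx _); rewrite mulr1; exact: le_trans.
  pose eta := Num.min 1 (z / (C + 1)).
  have C1 : 0 < C + 1 by lra.
  have eta0 : 0 < eta by rewrite lt_min ltr01 divr_gt0.
  have etaz : eta * (C + 1) <= z by rewrite -ler_pdivlMr// ge_min lexx orbT.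
  have := h eta eta0; rewrite ge_min lexx => /(_ isT); rewrite addr0; lra.
split => //.
- by apply: (sml _ (5 / 2)) => eta h1 h2; have [_ []] := bound eta h1 h2.
- apply/eqP; rewrite -subr_eq0; apply/eqP.
  by apply: (sml _ (`|L| + 10)) => eta h1 h2; have [_ []] := bound eta h1 h2.
Unshelve. all: by end_near. Qed.

End L2Limit.

(** * Stochastic integrals of deterministic functions *)

Section OUMoments.
Context {R : realType} d (T : measurableType d) (P : probability T R).

Lemma sigma_generated_preimage (I : Type) (J : set I) (X : I -> T -> R) i (E : set R) :
  J i -> measurable E -> sigma_generated J X (X i @^-1` E).
Proof. by move=> Ji mE; apply: sub_sigma_algebra; exists i => //; exists E. Qed.

Section Brownian.
Variable B : R -> {RV P >-> R}.
Hypothesis bm : brownian_motion B.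

Let inc (s t : R) : {RV P >-> R} :=
  mfun_Sub (mem_set (measurable_funB (measurable_funP (B t)) (measurable_funP (B s)))).

Let inc_moments s t : 0 <= s -> s < t ->
  [/\ square_integrable P (inc s t), mean P (inc s t) = 0 & inner P (inc s t) (inc s t) = t - s].
Proof.
move=> s0 st; apply: normal_law_moments; first by rewrite subr_ge0 ltW.
have h := bm_increment bm s0 st; exact: h.
Qed.

Let B0_moments := ae_eq0_moments (measurable_funP (B 0)) (bm_start bm).

(** [B 0] vanishes only almost surely, so it is carried along as a term with zero moments. *)
Let BE (t : R) : (B t : T -> R) = (fun w => inc 0 t w + 1 * B 0 w).
Proof. by apply/funext => w; rewrite mul1r [inc 0 t w]/(B t w - B 0 w) subrK. Qed.

Lemma brownian_moments s : 0 <= s ->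
  [/\ square_integrable P (B s), mean P (B s) = 0 & inner P (B s) (B s) = s].
Proof.
rewrite le_eqVlt => /orP[/eqP <-|s0].
  by have [h1 h2 h3] := B0_moments; split => //; exact: h3.
have [h1 h2 h3] := B0_moments; have [k1 k2 k3] := inc_moments (lexx 0) s0.
rewrite BE; split.
- by apply: square_integrableD => //; exact: square_integrableZ.
- rewrite /mean RintegralD//; last 2 first.
  + exact: square_integrable_mean.
  + exact/square_integrable_mean/square_integrableZ.
  rewrite RintegralZl//; last exact: square_integrable_mean.
  by move: h2 k2; rewrite /mean => -> ->; rewrite mulr0 addr0.
- by rewrite inner_sqrDZ// (innerC _ (inc 0 s)) !h3// k3 !mulr0 !addr0 subr0.
Qed.

Lemma brownian_covariance s t : 0 <= s -> 0 <= t -> inner P (B s) (B t) = Num.min s t.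
Proof.
wlog st : s t / s <= t.
  move=> h s0 t0; have [st|ts] := leP s t; first by rewrite h// min_l.
  by rewrite innerC h// ?(ltW ts)// min_l// ltW.
rewrite min_l// => s0 t0; move: st; rewrite le_eqVlt => /orP[/eqP <-|st].
  by have [] := brownian_moments s0.
have [h1 h2 h3] := brownian_moments s0; have [k1 k2 k3] := inc_moments s0 st.
have -> : (B t : T -> R) = (fun w => B s w + inc s t w).
  by apply/funext => w; rewrite [inc s t w]/(B t w - B s w) addrC subrK.
rewrite innerC innerD// h3 innerC inner_independent ?addr0// => E F mE mF.
apply: (bm_independent bm s0 st).
  by apply: sigma_generated_preimage => //=; rewrite in_itv/= s0 lexx.
exact: (@sigma_generated_preimage unit setT (fun _ => inc s t) tt).
Qed.

Variables (K : nat) (S : 'M[R]_K) (Y0 : 'I_K -> {RV P >-> R}).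
Hypothesis S_ge0 : forall u : 'cV[R]_K, 0 <= (u^T *m S *m u) 0 0.
Hypothesis Y0_law : has_centered_gaussian_law P S Y0.
Hypothesis Y0_indep : independent_systems P
  (sigma_generated [set: 'I_K] Y0) (sigma_generated `[0, +oo[ B).

Let lin (u : 'cV[R]_K) w := \sum_(k < K) u k 0 * Y0 k w.

Let mlin u : measurable_fun setT (lin u).
Proof. by apply: measurable_sum => k; exact: measurable_funM. Qed.

Let lin_moments u :
  [/\ square_integrable P (lin u), mean P (lin u) = 0 & inner P (lin u) (lin u) = (u^T *m S *m u) 0 0].
Proof.
apply: (@normal_law_moments _ _ _ P (mfun_Sub (mem_set (mlin u)))) => //.
Qed.

Let Y0_moments k : square_integrable P (Y0 k) /\ mean P (Y0 k) = 0.
Proof.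
have [h1 h2 _] := lin_moments (delta_mx k 0).
suff e : lin (delta_mx k 0) = Y0 k by move: h1 h2; rewrite e.
apply/funext => w; rewrite /lin (bigD1 k)//= mxE !eqxx mul1r big1 ?addr0// => l lk.
by rewrite mxE (negbTE lk) mul0r.
Qed.

Let Y0_B k s : 0 <= s -> inner P (Y0 k) (B s) = 0.
Proof.
move=> s0; have [h1 h2 h3] := brownian_moments s0; have [k1 k2] := Y0_moments k.
apply: inner_independent => // E F mE mF; apply: Y0_indep.
  exact: sigma_generated_preimage.
by apply: sigma_generated_preimage => //=; rewrite in_itv/= s0.
Qed.

(** The common form of the discretised integrals: a part linear in the initial state plus finitely
    many values of [B]. *)
Definition ou_combination (u : 'cV[R]_K) n (a s : 'I_n -> R) (w : T) : R :=
  \sum_(k < K) u k 0 * Y0 k w + \sum_(i < n) a i * B (s i) w.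

Lemma ou_combination_moments (u : 'cV[R]_K) n (a s : 'I_n -> R) :
  (forall i, 0 <= s i) ->
  square_integrable P (ou_combination u a s) /\ mean P (ou_combination u a s) = 0.
Proof.
move=> s0; have [h1 h2 h3] := lin_moments u.
have sB i : square_integrable P (B (s i)) by have [] := brownian_moments (s0 i).
have sC := square_integrable_sum (index_enum 'I_n) a sB.
split; first exact: square_integrableD.
rewrite /mean RintegralD//; [|exact: square_integrable_mean|exact: square_integrable_mean].
rewrite -/(mean P (lin u)) h2 add0r -/(mean P _) mean_sum// big1// => i _.
by have [_ -> _] := brownian_moments (s0 i); rewrite mulr0.
Qed.

(** The two combinations share [u] but may use different grids, as the Cauchy property in L2
    requires. Cross terms vanish by independence of the initial state and [B]; the rest is Brownian
    covariance. *)
Lemma ou_combination_inner (u : 'cV[R]_K) n (a s : 'I_n -> R) n' (a' s' : 'I_n' -> R) :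
  (forall i, 0 <= s i) -> (forall i, 0 <= s' i) ->
  inner P (ou_combination u a s) (ou_combination u a' s') =
    (u^T *m S *m u) 0 0 + \sum_(i < n) \sum_(j < n') a i * a' j * Num.min (s i) (s' j).
Proof.
move=> s0 s0'; have [h1 h2 h3] := lin_moments u.
have sB i : square_integrable P (B (s i)) by have [] := brownian_moments (s0 i).
have sB' i : square_integrable P (B (s' i)) by have [] := brownian_moments (s0' i).
have sY k : square_integrable P (Y0 k) by have [] := Y0_moments k.
have sC := square_integrable_sum (index_enum 'I_n) a sB.
have sC' := square_integrable_sum (index_enum 'I_n') a' sB'.
have sD := square_integrableD h1 sC'.
have linB n1 (a1 s1 : 'I_n1 -> R) : (forall i, 0 <= s1 i) ->
    inner P (lin u) (fun w => \sum_(i < n1) a1 i * B (s1 i) w) = 0.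
  move=> s01; have sB1 i : square_integrable P (B (s1 i)) by have [] := brownian_moments (s01 i).
  rewrite inner_suml//; last exact: square_integrable_sum.
  rewrite big1// => k _; rewrite innerC inner_suml// big1 ?mulr0// => i _.
  by rewrite innerC Y0_B ?mulr0.
set C := fun w => \sum_(i < n) a i * B (s i) w in sC *.
set C' := fun w => \sum_(i < n') a' i * B (s' i) w in sC' sD *.
have e1 : inner P (lin u) (fun w => lin u w + C' w) = (u^T *m S *m u) 0 0.
  by rewrite innerC innerD// h3 innerC linB ?addr0.
have e2 : inner P C (fun w => lin u w + C' w) = inner P C C'.
  by rewrite innerC innerD// linB// add0r innerC.
rewrite [LHS](innerD h1 sC sD) e1 e2; congr (_ + _).
rewrite inner_suml//; apply: eq_bigr => i _.
rewrite innerC inner_suml// mulr_sumr; apply: eq_bigr => j _.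
by rewrite brownian_covariance// minC mulrA.
Qed.

End Brownian.
End OUMoments.

(** * Riemann-Stieltjes sums and step functions *)

Section RiemannStieltjes.
Context {R : realType}.
Notation mu := (@lebesgue_measure R).

(** Heine's theorem from the near-covering form of compactness: the radius at a point is shared
    between the move to a nearby point and the move from there to [y]. Only [x] is confined to the
    segment. *)
Lemma continuous_unif_segment (b : R -> R) (t e : R) : continuous b -> 0 < e ->
  exists2 r : R, 0 < r & forall x y, 0 <= x <= t -> `|x - y| < r -> `|b x - b y| <= e.
Proof.
move=> cb e0.
have cov := (@compact_near_coveringP _ `[0, t]).1 (@segment_compact R 0 t).
have := cov R (0 : R)^'+ (fun r x => forall y, `|x - y| < r -> `|b x - b y| <= e) _.
case.
- move=> x _.
  have /cvgrPdist_lt/(_ (e / 2) _)[|r /= r0 hr] := cb x; first by rewrite divr_gt0.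
  exists (ball x (r / 2), [set s : R | s < r / 2]) => /=.
    split; first by apply: nbhsx_ballx; rewrite divr_gt0.
    by apply: nbhs_right_lt; rewrite divr_gt0.
  move=> [x' s] /= [xx' sr] y x'y.
  have h1 : `|b x - b x'| < e / 2.
    by apply: hr; rewrite /= (lt_trans xx')// ltr_pdivrMr// ltr_pMr// ltr1n.
  have h2 : `|b x - b y| < e / 2.
    apply: hr => /=; rewrite -(subrKA x') (le_lt_trans (ler_normD _ _))//.
    by rewrite [ltRHS](splitr r) ltrD// (lt_trans x'y).
  rewrite -(subrKA (b x)) (le_trans (ler_normD _ _))// (splitr e) lerD// ?ltW//.
  by rewrite distrC.
- move=> r /= r0 hr; exists (r / 2); first by rewrite divr_gt0.
  move=> x y x0t; apply: (hr (r / 2)) => /=.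
  + by rewrite sub0r normrN gtr0_norm ?divr_gt0// ltr_pdivrMr// ltr_pMr// ltr1n.
  + by rewrite divr_gt0.
  + by rewrite in_itv.
Qed.

Definition grid (t : R) (n : nat) (i : nat) : R := t * i%:R / n.+1%:R.

Lemma grid_bounds t n i : 0 <= t -> (i <= n.+1)%N -> 0 <= grid t n i <= t.
Proof.
move=> t0 ni; rewrite /grid mulr_ge0 ?mulr_ge0 ?invr_ge0//= ler_pdivrMr ?ltr0n//.
by rewrite ler_wpM2l// ler_nat.
Qed.

Lemma gridS t n i : grid t n i.+1 = grid t n i + t / n.+1%:R.
Proof.
by rewrite /grid -natr1; field; rewrite nat1r pnatr_eq0.
Qed.

Lemma grid0 t n : grid t n 0 = 0. Proof. by rewrite /grid mulr0 mul0r. Qed.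

Lemma grid_max t n : grid t n n.+1 = t.
Proof. by rewrite /grid mulfK// pnatr_eq0. Qed.

Lemma mesh_cvg (C : R) : C / n.+1%:R @[n --> \oo] --> 0.
Proof.
rewrite -[X in _ --> X](mulr0 C); apply: cvgM; first exact: cvg_cst.
exact: cvg_harmonic.
Qed.

(** [Phi] stands for the integral of [b] against [dA]. Since [A] is nondecreasing, the errors on the
    cells, bounded by multiples of its increments, add up to a multiple of [A t - A 0]. *)
Lemma riemann_stieltjes (b h A Phi : R -> R) (t : R) : 0 <= t -> continuous b ->
  (forall x : R, 0 <= x <= t -> [/\ 0 <= h x, is_derive x 1 A (h x) &
    is_derive x 1 Phi (h x * b x)]) ->
  \sum_(i < n.+1) (A (grid t n i.+1) - A (grid t n i)) * b (grid t n i) @[n --> \oo]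
    --> Phi t - Phi 0.
Proof.
move=> t0 cb hA; apply/cvgrPdist_le => e e0.
have mono x y : 0 <= x -> x <= y -> y <= t -> A x <= A y.
  move=> x0 xy yt; apply: (@ger0_is_derive_le _ A h) => // z /andP[xz zy].
    by have [] := hA z _ => //; rewrite (le_trans x0 xz) (le_trans zy).
  by have [] := hA z _ => //; rewrite (le_trans x0 (ltW xz)) (le_trans (ltW zy)).
(* The added 1 keeps [C] positive when [A] is constant. *)
pose C := A t - A 0 + 1.
have C0 : 0 < C by rewrite ltr_wpDl// subr_ge0 mono.
have eC : 0 < e / C by rewrite divr_gt0.
have [r r0 hr] := continuous_unif_segment t cb eC.
have : \forall n \near \oo, `|t / n.+1%:R| < r.
  by have /cvgr0Pnorm_lt := mesh_cvg t; exact.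
apply: filterS => n; rewrite ger0_norm; last by rewrite divr_ge0.
move=> tr.
have gs i : (i < n.+1)%N -> [/\ 0 <= grid t n i, grid t n i <= grid t n i.+1 & grid t n i.+1 <= t].
  move=> ni; have /andP[g0 _] := grid_bounds t0 (ltnW ni).
  have /andP[_ g1] := grid_bounds t0 ni; split => //.
  by rewrite gridS lerDl divr_ge0.
(* On each cell, compare [Phi] with the primitive [b (grid t n i) A] of [h b (grid t n i)]. *)
have cell i : (i < n.+1)%N ->
    `|(Phi (grid t n i.+1) - Phi (grid t n i)) -
      (A (grid t n i.+1) - A (grid t n i)) * b (grid t n i)|
    <= (e / C) * (A (grid t n i.+1) - A (grid t n i)).
  move=> /gs[]; set x := grid t n i; set y := grid t n i.+1 => x0 xy yt.
  have zx z : x <= z <= y -> 0 <= z <= t.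
    by move=> /andP[xz zy]; rewrite (le_trans x0 xz) (le_trans zy).
  have bz z : x <= z <= y -> `|b z - b x| <= e / C.
    move=> zxy; apply: hr; first exact: zx.
    move/andP: zxy => [xz zy]; rewrite ger0_norm ?subr_ge0//.
    by rewrite (le_lt_trans _ tr)// lerBlDl -gridS.
  have D k (z : R) : x <= z <= y ->
      is_derive z 1 (fun z => k * A z - (Phi z - b x * A z)) (k * h z - (h z * b z - b x * h z)).
    move=> /zx/hA[_ dA dP].
    exact: is_derive_fB (is_derive_fZ k dA) (is_derive_fB dP (is_derive_fZ (b x) dA)).
  have D' k (z : R) : x <= z <= y ->
      is_derive z 1 (fun z => k * A z + (Phi z - b x * A z)) (k * h z + (h z * b z - b x * h z)).
    move=> /zx/hA[_ dA dP].
    exact: is_derive_fD (is_derive_fZ k dA) (is_derive_fB dP (is_derive_fZ (b x) dA)).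
  have g1 := ger0_is_derive_le xy (D (e / C)); have g2 := ger0_is_derive_le xy (D' (e / C)).
  have hz z : x < z < y -> 0 <= h z /\ `|b z - b x| <= e / C.
    move=> /andP[xz zy]; have zxy : x <= z <= y by rewrite (ltW xz) (ltW zy).
    by split; [have [] := hA z (zx z zxy)|exact: bz].
  have {}g1 : e / C * A x - (Phi x - b x * A x) <= e / C * A y - (Phi y - b x * A y).
    apply: g1 => z /hz[h0 hb].
    rewrite (_ : _ - _ = h z * (e / C - (b z - b x))); last by ring.
    by rewrite mulr_ge0// subr_ge0 (le_trans (ler_norm _)).
  have {}g2 : e / C * A x + (Phi x - b x * A x) <= e / C * A y + (Phi y - b x * A y).
    apply: g2 => z /hz[h0 hb].
    rewrite (_ : _ + _ = h z * (e / C - (b x - b z))); last by ring.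
    by rewrite mulr_ge0// subr_ge0 (le_trans (ler_norm _))// distrC.
  by rewrite ler_norml; apply/andP; split; lra.
have -> : Phi t - Phi 0 = \sum_(i < n.+1) (Phi (grid t n i.+1) - Phi (grid t n i)).
  by rewrite -(big_mkord xpredT (fun i => Phi (grid t n i.+1) - Phi (grid t n i)))
    telescope_sumr// grid_max grid0.
rewrite -sumrB (le_trans (ler_norm_sum _ _ _))//.
apply: (@le_trans _ _ (\sum_(i < n.+1) (e / C) * (A (grid t n i.+1) - A (grid t n i)))).
  by apply: ler_sum => i _; exact: cell.
rewrite -mulr_sumr -(big_mkord xpredT (fun i => A (grid t n i.+1) - A (grid t n i))).
rewrite telescope_sumr// grid_max grid0 -mulrA ler_piMr ?(ltW e0)//.
by rewrite mulrC ler_pdivrMr// mul1r /C lerDl.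
Qed.

Definition lt_indic (s u : R) : R := (u < s)%R%:R.

(** The isometry sending [B s] to the indicator of [[0, s[]: Brownian covariance becomes an inner
    product in [L^2(0, t)]. *)
Lemma indic_lt_integral (t s r : R) : 0 <= s <= t -> 0 <= r <= t ->
  \int[mu]_(u in `[0, t]) (lt_indic s u * lt_indic r u) = Num.min s r.
Proof.
move=> /andP[s0 st] /andP[r0 rt].
have m0 : 0 <= Num.min s r by rewrite le_min s0.
have mt : Num.min s r <= t by rewrite ge_min st.
transitivity (\int[mu]_(u in `[0, t]) (\1_`[0, Num.min s r[ u : R)).
  apply: eq_Rintegral => u; rewrite inE/= in_itv/= => /andP[u0 _].
  rewrite indicE mem_setE in_itv/= u0/= lt_min /lt_indic.
  by case: (u < s); case: (u < r); rewrite /= ?mulr1 ?mulr0.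
rewrite /Rintegral integral_indic//= setIidl; last first.
  move=> u /=; rewrite !in_itv/= => /andP[-> um]; exact: le_trans (ltW um) mt.
rewrite lebesgue_measure_itv/= lte_fin; case: ltP => [_|h]; first by rewrite -EFinD subr0.
by apply/eqP; rewrite eq_le h m0.
Qed.

Lemma measurable_lt (s : R) : measurable_fun setT (lt_indic s).
Proof.
rewrite (_ : lt_indic s = \1_`]-oo, s[); first exact: measurable_indic.
by apply/funext => u; rewrite indicE mem_setE in_itv.
Qed.

Definition step_fun n (a s : 'I_n -> R) (u : R) : R := \sum_(i < n) a i * lt_indic (s i) u.

Lemma measurable_step_fun n (a s : 'I_n -> R) : measurable_fun setT (step_fun a s).
Proof. by apply: measurable_sum => i; apply: measurable_funM => //; exact: measurable_lt. Qed.

Lemma bounded_integrable (f : R -> R) (t C : R) : measurable_fun setT f ->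
  (forall u, 0 <= u <= t -> `|f u| <= C) -> mu.-integrable `[0, t] (EFin \o f).
Proof.
move=> mf fC; apply: (le_integrable_real (g := fun=> C)) => //; first exact: measurable_funTS.
by apply: continuous_integrable; exact: cst_continuous.
Qed.

Lemma Rintegral_sum (I : Type) (r : seq I) (f : I -> R -> R) (D : set (measurableTypeR R)) : measurable D ->
  (forall i, mu.-integrable D (EFin \o f i)) ->
  mu.-integrable D (EFin \o (fun u => \sum_(i <- r) f i u)) /\
  \int[mu]_(u in D) (\sum_(i <- r) f i u) = \sum_(i <- r) \int[mu]_(u in D) f i u.
Proof.
move=> mD fi; elim: r => [|i r [ih1 ih2]].
  split.
    by apply: (eq_integrable _ (cst 0%E)) => //; [move=> u _ /=; rewrite big_nil|exact: integrable0].
  rewrite big_nil; under eq_Rintegral do rewrite big_nil.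
  by rewrite Rintegral_cst// mul0r.
have e : (fun u => \sum_(i <- i :: r) f i u) = (fun u => f i u + \sum_(i <- r) f i u).
  by apply/funext => u; rewrite big_cons.
rewrite e big_cons -ih2 -RintegralD//; split => //.
exact: (integrableD mD (fi i) ih1).
Qed.

Lemma step_fun_inner (t : R) n (a s : 'I_n -> R) n' (a' s' : 'I_n' -> R) :
  (forall i, 0 <= s i <= t) -> (forall i, 0 <= s' i <= t) ->
  \sum_(i < n) \sum_(j < n') a i * a' j * Num.min (s i) (s' j) =
  \int[mu]_(u in `[0, t]) (step_fun a s u * step_fun a' s' u).
Proof.
move=> s0 s0'.
have m1 i j : mu.-integrable `[0, t] (EFin \o (fun u => lt_indic (s i) u * lt_indic (s' j) u)).
  apply: (bounded_integrable (C := 1)).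
    by apply: measurable_funM; exact: measurable_lt.
  by move=> u _; rewrite /lt_indic; case: (u < s i); case: (u < s' j); rewrite /= ?mulr1 ?mulr0 ?normr1 ?normr0.
have m2 i j : mu.-integrable `[0, t]
    (EFin \o (fun u => a i * a' j * (lt_indic (s i) u * lt_indic (s' j) u))).
  by apply: (integrableZl _ (a i * a' j) (m1 i j)).
have m3 i := Rintegral_sum (index_enum 'I_n') (measurable_itv `[0, t]) (m2 i).
have [_ m4] := Rintegral_sum (index_enum 'I_n) (measurable_itv `[0, t]) (fun i => (m3 i).1).
transitivity (\int[mu]_(u in `[0, t]) \sum_(i < n) \sum_(j < n')
    a i * a' j * (lt_indic (s i) u * lt_indic (s' j) u)).
  rewrite m4; apply: eq_bigr => i _; rewrite (m3 i).2; apply: eq_bigr => j _.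
  by rewrite RintegralZl// indic_lt_integral.
apply: eq_Rintegral => u _; rewrite /step_fun mulr_suml; apply: eq_bigr => i _.
by rewrite mulr_sumr; apply: eq_bigr => j _; ring.
Qed.

End RiemannStieltjes.

(** * Step approximation of the noise kernel *)

Section StepConvergence.
Context {R : realType}.
Notation mu := (@lebesgue_measure R).
Variables (c : R -> R) (t L : R).
Hypothesis t0 : 0 <= t.
Hypothesis cc : continuous c.
Hypothesis c0 : c 0 = 0.
Hypothesis L0 : 0 <= L.
Hypothesis c_lip : forall x y, 0 <= x <= t -> 0 <= y <= t -> `|c x - c y| <= L * `|x - y|.

Definition grid_weight n (i : nat) : R := c (t - grid t n i) - c (t - grid t n i.+1).

(** For [0 <= u < t] the sum telescopes: as [c 0 = 0], the value at [u] is [c (t - g)], where [g] is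
    the first grid point beyond [u]. *)
Definition grid_step n : R -> R :=
  @step_fun R n.+1 (fun i => grid_weight n i) (fun i => grid t n i).

Let flip x : 0 <= x <= t -> 0 <= t - x <= t.
Proof. by move=> /andP[x0 xt]; apply/andP; split; lra. Qed.

Lemma grid_step_approx n u : 0 <= u <= t ->
  `|grid_step n u - c (t - u)| <= L * (t / n.+1%:R).
Proof.
move=> /andP[u0 ut]; set dl := t / n.+1%:R.
have dl0 : 0 <= dl by rewrite divr_ge0.
have g i : (i <= n.+1)%N -> 0 <= grid t n i <= t by exact: grid_bounds.
(* The partial sum is completed by its missing tail [c (t - grid t n k)]. As long as
   [grid t n k <= u] all indicators vanish and the Lipschitz bound on one cell suffices; afterwards
   each step leaves the expression unchanged. *)
have H k : (k <= n.+1)%N ->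
    `|\sum_(0 <= i < k) grid_weight n i * lt_indic (grid t n i) u + c (t - grid t n k)
      - c (t - Num.min u (grid t n k))| <= L * dl.
  elim: k => [_|k ih kn].
    by rewrite big_geq// grid0 add0r min_r// subrr normr0 mulr_ge0.
  have /andP[gk0 gkt] := g _ kn; have /andP[g0 gt] := g _ (ltnW kn).
  have [uk|ku] := ltP u (grid t n k).
    have e : lt_indic (grid t n k) u = 1 by rewrite /lt_indic uk.
    rewrite big_nat_recr//= e mulr1; set S := \sum_(0 <= i < k) _.
    rewrite /grid_weight -(addrA S) subrK.
    have uk1 : u <= grid t n k.+1 by rewrite (le_trans (ltW uk))// gridS lerDl.
    by move: (ih (ltnW kn)); rewrite !min_l// ltW.
  rewrite big_nat big1 ?add0r; last first.
    move=> i /andP[_ ik]; rewrite /lt_indic ltNge (le_trans _ ku) ?mulr0//.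
    by rewrite /grid ler_wpM2r ?invr_ge0// ler_wpM2l// ler_nat -ltnS.
  have mb : grid t n k <= Num.min u (grid t n k.+1) <= grid t n k.+1.
    by rewrite ge_min lexx orbT le_min ku/= andbT gridS lerDl.
  move/andP: mb => [mb1 mb2].
  rewrite (le_trans (c_lip (flip _) (flip _)))//; do ?[by apply/andP; split; lra].
  rewrite ler_wpM2l// ler_norml.
  by move: mb1 mb2; rewrite gridS -/dl => ? ?; apply/andP; split; lra.
have := H n.+1 (leqnn _).
by rewrite grid_max subrr c0 addr0 min_l// /grid_step /step_fun big_mkord.
Qed.

Let C := L * t.

Let c_bound u : 0 <= u <= t -> `|c (t - u)| <= C.
Proof.
move=> ut; have := c_lip (flip ut) (_ : 0 <= 0 <= t); rewrite c0 !subr0 lexx => /(_ t0) h.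
rewrite (le_trans h)// ler_wpM2l// ger0_norm; last by case/andP : (flip ut).
by case/andP : (flip ut).
Qed.

Let C0 : 0 <= C. Proof. by rewrite mulr_ge0. Qed.

Lemma grid_covariance_cvg (e : R) : 0 < e -> exists N, forall n m, (N <= n)%N -> (N <= m)%N ->
  `|\sum_(i < n.+1) \sum_(j < m.+1)
      grid_weight n i * grid_weight m j * Num.min (grid t n i) (grid t m j)
    - \int[mu]_(u in `[0, t]) (c (t - u) ^+ 2)| <= e.
Proof.
(* The integrands differ by at most [eta (C + 1) + C eta], the integrals by at most
   [eta (2 C + 1) t]. Here [eta <= 1] gives the bound [C + 1] on the step functions, and the last 1
   keeps the denominator positive. *)
move=> e0; pose eta := Num.min 1 (e / ((2 * C + 1) * t + 1)).
have D0 : 0 < (2 * C + 1) * t + 1.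
  have : 0 <= (2 * C + 1) * t by rewrite mulr_ge0// addr_ge0// mulr_ge0.
  lra.
have eta0 : 0 < eta by rewrite lt_min ltr01 divr_gt0.
have eta1 : eta <= 1 by rewrite ge_min lexx.
have etae : eta * ((2 * C + 1) * t + 1) <= e by rewrite -ler_pdivlMr// ge_min lexx orbT.
have [N _ hN] : \forall n \near \oo, `|C / n.+1%:R| < eta.
  by have /cvgr0Pnorm_lt := mesh_cvg C; exact.
exists N => n m Nn Nm.
have G k : (N <= k)%N -> forall u, 0 <= u <= t -> `|grid_step k u - c (t - u)| <= eta.
  move=> Nk u ut; rewrite (le_trans (grid_step_approx k ut))// mulrA.
  by rewrite (le_trans (ler_norm _))// ltW//; exact: hN.
have gb k (i : 'I_k.+1) : 0 <= grid t k i <= t by apply: grid_bounds => //; exact: ltnW.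
rewrite (step_fun_inner _ _ (gb n) (gb m)) -/(grid_step n) -/(grid_step m).
have mG k : measurable_fun setT (grid_step k) by exact: measurable_step_fun.
have mc : measurable_fun setT (fun u : R => c (t - u)).
  apply: continuous_measurable_fun => u.
  apply: (@continuous_comp _ _ _ (fun u => t - u) c); last exact: cc.
  by apply: cvgB; [exact: cvg_cst|exact: cvg_id].
have bG k u : (N <= k)%N -> 0 <= u <= t -> `|grid_step k u| <= C + 1.
  move=> Nk ut; rewrite -(subrK (c (t - u)) (grid_step k u)) (le_trans (ler_normD _ _))//.
  have := G k Nk u ut; have := c_bound ut; lra.
have iG : mu.-integrable `[0, t] (EFin \o (fun u : R => grid_step n u * grid_step m u)).
  apply: (bounded_integrable (C := (C + 1) * (C + 1))); first exact: measurable_funM.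
  by move=> u ut; rewrite normrM ler_pM// bG.
have ic : mu.-integrable `[0, t] (EFin \o (fun u : R => c (t - u) ^+ 2)).
  apply: (bounded_integrable (C := C * C)); first exact: measurable_funX.
  by move=> u ut; rewrite expr2 normrM ler_pM// c_bound.
rewrite -RintegralB//.
have iB : mu.-integrable `[0, t]
    (EFin \o (fun u : R => grid_step n u * grid_step m u - c (t - u) ^+ 2)).
  by apply: (integrableB _ iG ic).
rewrite (le_trans (le_normr_Rintegral _ iB))//.
have icst : mu.-integrable `[0, t] (EFin \o (fun _ : R => eta * (2 * C + 1))).
  by apply: continuous_integrable; exact: cst_continuous.
apply: (@le_trans _ _ (\int[mu]_(u in `[0, t]) (eta * (2 * C + 1)))).
  apply: le_Rintegral => //.
    by apply: (integrable_norm iB).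
  move=> u /=; rewrite in_itv/= => ut.
  have h1 := G n Nn u ut; have h2 := G m Nm u ut; have h3 := c_bound ut.
  have h4 := bG m u Nm ut.
  set x := grid_step n u in h1 *; set y := grid_step m u in h2 h4 *; set z := c (t - u) in h1 h2 h3 *.
  rewrite (_ : x * y - z ^+ 2 = (x - z) * y + z * (y - z)); last by ring.
  rewrite (le_trans (ler_normD _ _))// !normrM.
  rewrite (_ : eta * (2 * C + 1) = eta * (C + 1) + C * eta); last by ring.
  by apply: lerD; apply: ler_pM.
have fm : fine (mu `[0, t]) = t.
  rewrite lebesgue_measure_itv/= lte_fin; case: ltP => [_|h].
    by rewrite -EFinD/= subr0.
  by apply/eqP; rewrite eq_le h t0.
rewrite Rintegral_cst//.
by rewrite fm -mulrA (le_trans _ etae)// ler_wpM2l ?(ltW eta0)// lerDl.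
Qed.

End StepConvergence.

Lemma noise_part_reflect {R : realType} (a t : R) (m : nat) : a != 0 -> 0 <= t ->
  \int[lebesgue_measure]_(u in `[0, t]) (erlang_int a m (t - u) ^+ 2) = ou_noise_part a m t.
Proof.
move=> a0 t0; have cf : continuous (fun s : R => erlang_int a m s ^+ 2).
  exact/continuous_fsqr/continuous_erlang_int.
have cg : continuous (fun u : R => erlang_int a m (t - u) ^+ 2).
  move=> u; apply: (@continuous_comp _ _ _ (fun u => t - u) (fun s : R => erlang_int a m s ^+ 2)).
    by apply: cvgB; [exact: cvg_cst|exact: cvg_id].
  exact: cf.
have [G dG] := primitive_exists cf.
have dF (x : R) : 0 <= x <= t -> is_derive x 1 G (erlang_int a m x ^+ 2).
  by move=> /andP[x0 _]; apply: dG; lra.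
have dH (x : R) : 0 <= x <= t -> is_derive x 1 (fun u => - G (t - u)) (erlang_int a m (t - x) ^+ 2).
  move=> /andP[x0 xt]; have tx : -1 < t - x by lra.
  apply: (is_derive_eq (is_derive_fN (is_derive_fcomp
    (is_derive_fB (is_derive_fcst t x) (is_derive_fid x)) (dG _ tx)))).
  by rewrite sub0r mulrN1 opprK.
rewrite /ou_noise_part (Rintegral_FTC t0 cf dF) (Rintegral_FTC t0 cg dH).
by rewrite subrr subr0; ring.
Qed.

(** * The integrated Ornstein-Uhlenbeck process *)

Section OUPath.
Context {R : realType}.
Notation mu := (@lebesgue_measure R).

(** The recursion of [erlang_int] read as the adjoint equation: the row vector [c] of the primitives
    satisfies [c' = c A + e_1^T]. *)
Lemma erlang_int_drift m (a x : R) (l : 'I_m.+1) : a != 0 ->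
  \sum_(k < m.+1) erlang_int a k x * ou_drift m.+1 a k l = erlang a l x - (l == 0 :> nat)%:R.
Proof.
move=> a0.
have e (k : 'I_m.+1) : ou_drift m.+1 a k l = - a * (k == l)%:R + (l == k.+1 :> nat)%:R.
  rewrite mxE eq_sym; have [->|kl] := eqVneq k l.
    by rewrite ltn_eqF// mulr1 addr0.
  by rewrite mulr0 add0r; case: ifP.
under eq_bigr do rewrite e mulrDr.
rewrite big_split/= (bigD1 l)//= eqxx mulr1 [X in _ + X + _]big1 ?addr0; last first.
  by move=> k /negbTE ->; rewrite !mulr0.
case: l {e} => [[|l] lm] /=.
  rewrite big1 ?addr0; last by move=> k _; rewrite mulr0.
  by rewrite /=; field.
have lm' : (l < m.+1)%N by exact: ltnW.
rewrite (bigD1 (Ordinal lm'))//= eqxx mulr1 big1 ?addr0; last first.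
  move=> k; rewrite -val_eqE/= => kl; rewrite eqSS eq_sym (negbTE kl).
  by rewrite mulr0.
by rewrite subr0; field.
Qed.

(* The derivative of [Phi] is the integrand of the Wiener integral after integration
   by parts, so no stochastic integral is needed. *)
Lemma ou_path_integral m (a g0 t : R) (y : R -> 'I_m.+1 -> R) (b Phi : R -> R) :
  a != 0 -> 0 <= t -> (forall k, continuous (y^~ k)) ->
  (forall x : R, 0 <= x <= t -> is_derive x 1 Phi (erlang a m (t - x) * b x)) ->
  (forall s k, 0 <= s -> y s k = y 0 k
     + \int[mu]_(r in `[0, s]) (ou_drift m.+1 a *m \col_(l < m.+1) y r l) k 0
     + g0 * ou_noise R m.+1 k 0 * b s) ->
  \int[mu]_(s in `[0, t]) y s ord0 =
    \sum_(k < m.+1) erlang_int a k t * y 0 k + g0 * (Phi t - Phi 0).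
Proof.
move=> a0 t0 cy dPhi eqy.
pose Ay k r := \sum_(l < m.+1) ou_drift m.+1 a k l * y r l.
have cAy k : continuous (Ay k).
  by apply: continuous_fsum => l u; apply: cvgM; [exact: cvg_cst|exact: cy].
have [Z dZ] := choice (fun k => primitive_exists (cAy k)).
have [Psi dPsi] := primitive_exists (cy ord0).
have dZ0 k s (x : R) : 0 <= x <= s -> is_derive x 1 (Z k) (Ay k x).
  by move=> /andP[x0 _]; apply: dZ; lra.
have yE s k : 0 <= s -> y s k = y 0 k + (Z k s - Z k 0) + g0 * (k == m :> nat)%:R * b s.
  move=> s0; rewrite (eqy s k s0); congr (_ + _ + _ * _ * _).
    rewrite -(Rintegral_FTC s0 (cAy k) (dZ0 k s)); apply: eq_Rintegral => r _.
    transitivity (\sum_l ou_drift m.+1 a k l * (\col_(l < m.+1) y r l) l 0); first exact: mxE.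
    by rewrite /Ay; apply: eq_bigr => l _; congr (_ * _); exact: mxE.
  by rewrite mxE eqSS.
have dPsi0 (x : R) : 0 <= x <= t -> is_derive x 1 Psi (y x ord0).
  by move=> /andP[x0 _]; apply: dPsi; lra.
rewrite (Rintegral_FTC t0 (cy ord0) dPsi0).
pose z k s := y 0 k + (Z k s - Z k 0).
(* [z] is the differentiable part of [y], without the noise. In the derivative of [chi] the adjoint
   equation cancels the drift against [Psi], and [Phi] cancels the noise that [z] leaves out. *)
pose chi s := \sum_(k < m.+1) erlang_int a k (t - s) * z k s - g0 * Phi s + Psi s.
have dz k s (x : R) : 0 <= x <= s -> is_derive x 1 (z k) (Ay k x).
  move=> xs; apply: (is_derive_eq (is_derive_fD (is_derive_fcst (y 0 k) x)
    (is_derive_fB (dZ0 k s x xs) (is_derive_fcst (Z k 0) x)))).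
  by rewrite add0r subr0.
have dchi (x : R) : 0 <= x <= t -> is_derive x 1 chi 0.
  move=> xt; have dc k : is_derive x 1 (fun s => erlang_int a k (t - s)) (- erlang a k (t - x)).
    apply: (is_derive_eq (is_derive_fcomp (is_derive_fB (is_derive_fcst t x) (is_derive_fid x))
      (is_derive_erlang_int k (t - x) a0))).
    by rewrite sub0r mulrN1.
  apply: (is_derive_eq (is_derive_fD (is_derive_fB
    (is_derive_fsum (index_enum 'I_m.+1) (fun k => is_derive_fM (dc k) (dz k t x xt)))
    (is_derive_fZ g0 (dPhi x xt))) (dPsi0 x xt))).
  have x0 : 0 <= x by case/andP : xt.
  rewrite big_split/=.
  have -> : \sum_(k < m.+1) erlang_int a k (t - x) * Ay k x =
      \sum_(l < m.+1) (erlang a l (t - x) - (l == 0 :> nat)%:R) * y x l.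
    under eq_bigr do rewrite mulr_sumr; rewrite exchange_big/=; apply: eq_bigr => l _.
    rewrite -(erlang_int_drift _ _ a0) mulr_suml; apply: eq_bigr => k _.
    by rewrite mulrA.
  rewrite -big_split/=.
  have -> : \sum_(k < m.+1) (- erlang a k (t - x) * z k x
      + (erlang a k (t - x) - (k == 0 :> nat)%:R) * y x k) =
      g0 * erlang a m (t - x) * b x - y x ord0.
    rewrite (eq_bigr (fun k : 'I_m.+1 => g0 * erlang a k (t - x) * b x * (k == m :> nat)%:R
        - (k == ord0)%:R * y x k)); last first.
      move=> k _; have := yE x k x0; rewrite -/(z k x) => ->.
      have -> : (k == 0 :> nat) = (k == ord0) by [].
      by ring.
    rewrite sumrB (bigD1 ord_max)//= eqxx mulr1 big1 ?addr0; last first.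
      by move=> k; rewrite -val_eqE/= => /negbTE ->; rewrite mulr0.
    rewrite (bigD1 ord0)//= mul1r big1 ?addr0//.
    by move=> k /negbTE ->; rewrite mul0r.
  by ring.
have cc : chi t = chi 0.
  apply/eqP; rewrite eq_le; apply/andP; split.
    rewrite -lerN2; apply: (ger0_is_derive_le (F := fun s => - chi s) (f := fun=> 0)) => //.
    by move=> x xt; apply: (is_derive_eq (is_derive_fN (dchi x xt))); rewrite oppr0.
  exact: (ger0_is_derive_le (F := chi) (f := fun=> 0)).
move: cc; rewrite /chi subrr subr0 big1; last by move=> k _; rewrite erlang_int_at0 mul0r.
under eq_bigr do rewrite /z subrr addr0.
by move=> cc; lra.
Qed.
End OUPath.

(** * The stationary covariance *)

Section OUCovariance.
Context {R : realType}.
Notation mu := (@lebesgue_measure R).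
Variable m : nat.

(** The drift is [N - a] with [N] the nilpotent shift, so the entry is the coefficient of
    [N^(l - k)] in the binomial expansion; the induction step is Pascal's rule. *)
Lemma ou_drift_expE (a : R) j (k l : 'I_m.+1) :
  (ou_drift m.+1 a ^+ j) k l =
    if (k <= l)%N then 'C(j, l - k)%:R * (- a) ^+ (j - (l - k)) else 0.
Proof.
elim: j k l => [|j ih] k l.
  rewrite expr0 mxE; case: leqP => kl.
    rewrite bin0n subn_eq0 sub0n expr0 mulr1; congr (_%:R); congr nat_of_bool.
    by rewrite -val_eqE/= eqn_leq kl.
  by rewrite -val_eqE/= gtn_eqF.
rewrite exprSr mxE.
have e (i : 'I_m.+1) : ou_drift m.+1 a i l = - a * (i == l)%:R + (l == i.+1 :> nat)%:R.
  rewrite mxE eq_sym; have [->|kl] := eqVneq i l.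
    by rewrite ltn_eqF// mulr1 addr0.
  by rewrite mulr0 add0r; case: ifP.
under eq_bigr do rewrite e mulrDr.
rewrite big_split/= (bigD1 l)//= eqxx mulr1 [X in _ + X + _]big1 ?addr0; last first.
  by move=> i /negbTE ->; rewrite !mulr0.
rewrite ih; case: l {e} => [[|l] lm] /=.
  rewrite big1 ?addr0; last by move=> i _; rewrite mulr0.
  by case: leqP => kl; rewrite ?mul0r// sub0n !subn0 !bin0 !mul1r exprSr.
have lm' : (l < m.+1)%N by exact: ltnW.
rewrite (bigD1 (Ordinal lm'))//= eqxx mulr1 big1 ?addr0; last first.
  move=> i; rewrite -val_eqE/= => il; rewrite eqSS eq_sym (negbTE il).
  by rewrite mulr0.
rewrite ih/=; have [kl|lk] := leqP k l.
  rewrite (leqW kl) subSn// binS subSS natrD mulrDl; congr (_ + _).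
  (* For [j <= l - k] the truncated exponents do not match, but the binomial coefficient is 0. *)
  have [jp|pj] := leqP (l - k).+1 j.
    by rewrite -mulrA -exprSr subnSK.
  by rewrite bin_small// !mul0r.
rewrite addr0; case: leqP => kl; last by rewrite mul0r.
have -> : (l.+1 - k = 0)%N by lia.
by rewrite !subn0 !bin0 !mul1r exprSr.
Qed.

(** Terms of index below [p = l - k] vanish; in the others [C(j + p, p) / (j + p)! = 1 / (p! j!)]
    splits off [s^p / p!] and leaves the exponential series. *)
Lemma expmx_ou_drift (a s : R) (k l : 'I_m.+1) : (k <= l)%N ->
  expmx (s *: ou_drift m.+1 a) k l = erlang a (l - k) s.
Proof.
move=> kl; rewrite mxE; apply/cvg_lim => //; set p := (l - k)%N.
have -> : erlang a p s = s ^+ p / p`!%:R * expR (- a * s) by rewrite /erlang [RHS]mulrAC [_ * expR _]mulrC.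
rewrite -(cvg_shiftn p).
suff -> : (fun N => (\sum_(j < N + p) j`!%:R^-1 *: (s *: ou_drift m.+1 a) ^+ j) k l) =
    (fun N => s ^+ p / p`!%:R * series (exp_coeff (- a * s)) N).
  by apply: cvgM; [exact: cvg_cst|exact: is_cvg_series_exp_coeff].
apply/funext => N; rewrite summxE.
have fN i : i`!%:R != 0 :> R by rewrite pnatr_eq0 -lt0n fact_gt0.
rewrite -(big_mkord xpredT (fun j => ((j`!%:R)^-1 *: (s *: ou_drift m.+1 a) ^+ j) k l)).
rewrite /series/= mulr_sumr addnC (big_cat_nat (n := p))//=; last exact: leq_addr.
rewrite big_nat big1 ?add0r; last first.
  move=> j /andP[_ jp]; rewrite exprZn !mxE ou_drift_expE kl -/p bin_small//.
  by rewrite mul0r !mulr0.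
rewrite -{1}[p]add0n big_addn addKn; apply: eq_bigr => j _.
rewrite exprZn !mxE ou_drift_expE kl -/p addnK /exp_coeff/= exprMn.
have := bin_fact (leq_addl j p); rewrite addnK => /(congr1 (fun i : nat => i%:R : R)).
rewrite !natrM => h.
have -> : 'C(j + p, p)%:R = (j + p)`!%:R / (p`!%:R * j`!%:R) :> R.
  by rewrite -h mulfK// mulf_neq0.
rewrite exprD; field; rewrite !fN.
by [].
Qed.

Lemma expmx_trmx n (M : 'M[R]_n) : expmx M^T = (expmx M)^T.
Proof.
apply/matrixP => k l; rewrite !mxE; congr (limn _); apply/funext => N.
rewrite !summxE; apply: eq_bigr => j _; rewrite [LHS]mxE [RHS]mxE; congr (_ * _).
have -> : M^T ^+ j = (M ^+ j)^T; last by rewrite mxE.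
by elim: (nat_of_ord j) => [|i ih]; rewrite ?expr0 ?trmx1// exprSr exprS ih trmx_mul.
Qed.

Lemma ou_covarianceE (a g0 : R) (k l : 'I_m.+1) : 0 < a ->
  ou_covariance m.+1 a g0 k l = g0 ^+ 2 *
    \int[mu]_(s in `[0, +oo[) (erlang a (m - k) s * erlang a (m - l) s).
Proof.
move=> a0; rewrite mxE; congr (_ * _); apply: eq_Rintegral => s _.
have e (M : 'M[R]_m.+1) i : (M *m ou_noise R m.+1) i 0 = M i ord_max.
  rewrite mxE (bigD1 ord_max)//= big1 ?addr0 ?mxE ?eqxx ?mulr1// => j jm.
  by rewrite mxE eqSS -[m]/(val (@ord_max m)) val_eqE (negbTE jm) mulr0.
have -> : s *: (ou_drift m.+1 a)^T = (s *: ou_drift m.+1 a)^T by rewrite linearZ.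
rewrite expmx_trmx -mulmxA -trmx_mul mxE big_ord1 [X in _ * X]mxE !e.
by rewrite !expmx_ou_drift// -ltnS ltn_ord.
Qed.

Lemma integrable_erlang (a : R) k : 0 < a ->
  mu.-integrable `[0%R, +oo[ (EFin \o erlang a k).
Proof.
move=> a0; apply: (ge0_integrable_of_Rintegrable (l := a ^- k.+1)) => //.
- by apply: continuous_measurable; exact: continuous_erlang.
- by move=> x; rewrite set_itvE/=; exact: erlang_ge0.
- exact: integral_erlangy.
Qed.

Lemma integrable_erlangM (a : R) i j (c : R) : 0 < a ->
  mu.-integrable `[0%R, +oo[ (EFin \o (fun s => c * (erlang a i s * erlang a j s))).
Proof.
move=> a0; have a20 : 0 < 2 * a by rewrite mulr_gt0.
have -> : (fun s => c * (erlang a i s * erlang a j s)) =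
    (fun s => c * 'C(i + j, i)%:R * erlang (2 * a) (i + j) s).
  by apply/funext => s; rewrite erlangM mulrA.
by apply: (integrableZl _ (c * 'C(i + j, i)%:R) (integrable_erlang (i + j) a20)).
Qed.

Lemma ou_covariance_gram (a g0 : R) (k l : 'I_m.+1) : 0 < a ->
  ou_covariance m.+1 a g0 k l = g0 ^+ 2 * ou_gram a m k l.
Proof.
move=> a0; rewrite ou_covarianceE//; congr (_ * _).
have a20 : 0 < 2 * a by rewrite mulr_gt0.
under eq_Rintegral do rewrite erlangM.
rewrite RintegralZl ?Rintegral_erlangy//.
exact: integrable_erlang.
Qed.

Lemma quadratic_formE n (S : 'M[R]_n) (u : 'cV[R]_n) :
  (u^T *m S *m u) 0 0 = \sum_(k < n) \sum_(l < n) u k 0 * u l 0 * S k l.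
Proof.
rewrite mxE exchange_big/=; apply: eq_bigr => l _; rewrite mxE mulr_suml.
by apply: eq_bigr => k _; rewrite mxE mulrAC.
Qed.

(** The form is [g0 ^+ 2] times the integral of the square of [sum_k u_k erlang a (m - k)]. *)
Lemma ou_covariance_psd (a g0 : R) (u : 'cV[R]_m.+1) : 0 < a ->
  0 <= (u^T *m ou_covariance m.+1 a g0 *m u) 0 0.
Proof.
move=> a0; rewrite quadratic_formE.
have h (kl : 'I_m.+1 * 'I_m.+1) : mu.-integrable `[0%R, +oo[
    (EFin \o (fun s => (u kl.1 0 * u kl.2 0) * (erlang a (m - kl.1) s * erlang a (m - kl.2) s))).
  exact: integrable_erlangM.
have [_ e] := Rintegral_sum (index_enum _) (measurable_itv _) h.
rewrite pair_big/= (eq_bigr (fun kl => g0 ^+ 2 *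
    \int[mu]_(s in `[0, +oo[) (u kl.1 0 * u kl.2 0 * (erlang a (m - kl.1) s * erlang a (m - kl.2) s)))).
  rewrite -mulr_sumr -e mulr_ge0 ?sqr_ge0// Rintegral_ge0// => s _.
  rewrite -(pair_big xpredT xpredT (fun k l => u k 0 * u l 0 *
    (erlang a (m - k) s * erlang a (m - l) s)))/=.
  rewrite (_ : \sum_i _ = (\sum_k u k 0 * erlang a (m - k) s) ^+ 2) ?sqr_ge0//.
  rewrite expr2 big_distrlr/=; apply: eq_bigr => k _; apply: eq_bigr => l _.
  by rewrite mulrACA.
move=> [k l] _ /=; rewrite ou_covarianceE// RintegralZl//; first by rewrite mulrCA.
rewrite (_ : (fun x => _) = (fun x => 1 * (erlang a (m - k) x * erlang a (m - l) x))).
  exact: integrable_erlangM.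
by apply/funext => x; rewrite mul1r.
Qed.

Lemma ou_initial_variance (a g0 t : R) : 0 < a ->
  let u := \col_(k < m.+1) erlang_int a k t in
  (u^T *m ou_covariance m.+1 a g0 *m u) 0 0 = g0 ^+ 2 * ou_initial_part a m t.
Proof.
move=> a0 u; rewrite quadratic_formE mulr_sumr; apply: eq_bigr => k _.
rewrite mulr_sumr; apply: eq_bigr => l _.
by rewrite ou_covariance_gram// !mxE mulrCA [_ * (erlang_int _ _ _ * _)]mulrC.
Qed.

End OUCovariance.

(** * The variance of the integrated process *)

Section IntegralVariance.
Context {R : realType}.
Notation mu := (@lebesgue_measure R).

(** Paths are controlled only on [[0, +oo[]; freezing them at their initial value for negative times
    makes them continuous on the line, as the calculus lemmas require. *)
Lemma continuous_max0_extension (f : R -> R) : {within `[0, +oo[, continuous f} ->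
  continuous (fun s : R => f (Num.max s 0)).
Proof.
move=> cf s; apply: (@cvg_comp _ _ _ (fun s : R => Num.max s 0) f _ (within `[0, +oo[ (nbhs (Num.max s 0))) _).
  have cm : (fun x : R => Num.max x 0) @ s --> Num.max s 0.
    by apply: continuous_max; [exact: cvg_id|exact: cvg_cst].
  move=> U /cm; rewrite /= => hU; near=> x.
  suff : `[0, +oo[%classic (Num.max x 0) by near: x.
  by rewrite set_itvE/= le_max lexx orbT.
have s0 : `[0, +oo[%classic (Num.max s 0) by rewrite set_itvE/= le_max lexx orbT.
by rewrite (nbhs_subspace_in s0); exact: cf.
Unshelve. all: by end_near. Qed.

Lemma erlang_int_lipschitz (a t : R) m : 0 < a -> forall x y : R, 0 <= x <= t -> 0 <= y <= t ->
  `|erlang_int a m x - erlang_int a m y| <= a ^- m * `|x - y|.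
Proof.
move=> a0; have aN := lt0r_neq0 a0.
have main x y : 0 <= x -> x <= y -> `|erlang_int a m x - erlang_int a m y| <= a ^- m * `|x - y|.
  move=> x0 xy; have cxy : erlang_int a m x <= erlang_int a m y.
    apply: (ger0_is_derive_le (f := erlang a m) xy) => z xz; first exact: is_derive_erlang_int.
    by apply: erlang_ge0; move/andP : xz => [/ltW xz _]; exact: le_trans xz.
  rewrite distrC (distrC x) !ger0_norm ?subr_ge0//.
  suff : a ^- m * x - erlang_int a m x <= a ^- m * y - erlang_int a m y by lra.
  apply: (ger0_is_derive_le (F := fun z => a ^- m * z - erlang_int a m z)
    (f := fun z => a ^- m * 1 - erlang a m z) xy) => z xz.
    exact: (is_derive_fB (is_derive_fZ _ (is_derive_fid z)) (is_derive_erlang_int m z aN)).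
  rewrite mulr1 subr_ge0 erlang_le//.
  by move/andP : xz => [/ltW xz _]; exact: le_trans xz.
move=> x y /andP[x0 _] /andP[y0 _]; have [xy|/ltW yx] := leP x y; first exact: main.
by rewrite distrC (distrC x) main.
Qed.

Context (d : measure_display) (T : measurableType d) (P : probability T R).
Variables (m : nat) (a g0 t : R) (B : R -> {RV P >-> R}) (Y : R -> 'I_m.+1 -> {RV P >-> R}).
Hypotheses (a0 : 0 < a) (t0 : 0 <= t) (hY : stationary_ou a g0 B Y).

Let aN : a != 0. Proof. exact: lt0r_neq0. Qed.

Let y w (s : R) k : R := Y (Num.max s 0) k w.
Let b w (s : R) : R := B (Num.max s 0) w.

Let cy w k : continuous (fun s => y w s k).
Proof.
have [_ _ _ hc _] := hY.
have h0 : {within `[0, +oo[, continuous (fun s => Y s k w)} by exact: hc.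
by have h := @continuous_max0_extension (fun s => Y s k w) h0; move=> s; exact: (h s).
Qed.

Let cb w : continuous (b w).
Proof.
have [_ hc _ _] := ou_brownian hY.
have h0 : {within `[0, +oo[, continuous (fun s => B s w)} by exact: hc.
by have h := @continuous_max0_extension (fun s => B s w) h0; move=> s; exact: (h s).
Qed.

Let grid_max0 n i : (i <= n.+1)%N -> Num.max (grid t n i) 0 = grid t n i.
Proof. by move=> ni; apply/max_idPl; have /andP[] := grid_bounds t0 ni. Qed.

Let X w := \int[mu]_(s in `[0, t]) Y s ord0 w.

Let XE w : X w = \int[mu]_(s in `[0, t]) y w s ord0.
Proof.
apply: eq_Rintegral => s; rewrite inE set_itvE/= => /andP[s0 _].
by rewrite /y (max_idPl s0).
Qed.

(** The pathwise integral is a limit of Riemann sums, the case [A = id], [h = 1] of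
    [riemann_stieltjes], and each sum is a finite combination of random variables. *)
Let mX : measurable_fun setT X.
Proof.
apply: (measurable_fun_cvg (h := fun n w => \sum_(i < n.+1) (grid t n i.+1 - grid t n i) * Y (grid t n i) ord0 w)).
  by move=> n; apply: measurable_sum => i; apply: measurable_funM.
move=> w _; rewrite XE.
have [Psi dPsi] := primitive_exists (@cy w ord0).
have dPsi0 (x : R) : 0 <= x <= t -> is_derive x 1 Psi (y w x ord0).
  by move=> /andP[x0 _]; apply: dPsi; lra.
rewrite (Rintegral_FTC t0 (@cy w ord0) dPsi0).
have := @riemann_stieltjes R (fun s => y w s ord0) (fun=> 1) id Psi t t0 (@cy w ord0).
rewrite (_ : (fun n => \sum_(i < n.+1) _ * y w _ _) =
  (fun n => \sum_(i < n.+1) (grid t n i.+1 - grid t n i) * Y (grid t n i) ord0 w)); last first.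
  by apply/funext => n; apply: eq_bigr => i _; rewrite /y (grid_max0 (ltnW (ltn_ord i))).
apply=> x xt; split => //; first exact: is_derive_fid.
by rewrite mul1r; exact: dPsi0.
Qed.

Let Phi_exists w : exists Phi : R -> R, forall x : R, 0 <= x <= t ->
  is_derive x 1 Phi (erlang a m (t - x) * b w x).
Proof.
have ch : continuous (fun x => erlang a m (t - x) * b w x).
  move=> x; apply: cvgM; last exact: cb.
  apply: (@cvg_comp _ _ _ (fun x : R => t - x) (erlang a m) _ (nbhs (t - x)) _); last exact: continuous_erlang.
  by apply: cvgB; [exact: cvg_cst|exact: cvg_id].
have [Phi dPhi] := primitive_exists ch.
by exists Phi => x /andP[x0 _]; apply: dPhi; lra.
Qed.

(** Chosen separately for each path, so it carries no measurability in [w]; that of [S] comes from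
    [S_cvg]. *)
Let Phi w : R -> R := sval (cid (Phi_exists w)).

Let dPhi w (x : R) : 0 <= x <= t -> is_derive x 1 (Phi w) (erlang a m (t - x) * b w x).
Proof. exact: (svalP (cid (Phi_exists w))). Qed.

Let u : 'cV[R]_m.+1 := \col_k erlang_int a k t.
Let c := erlang_int a m.

Let S_ n : T -> R := ou_combination B (Y 0) u
  (fun i : 'I_n.+1 => g0 * grid_weight c t n i) (fun i => grid t n i).

Let S w := \sum_(k < m.+1) erlang_int a k t * Y 0 k w + g0 * (Phi w t - Phi w 0).

Let S_cvg w : S_ n w @[n --> \oo] --> S w.
Proof.
apply: cvgD.
  rewrite (_ : (fun _ => _) = cst (\sum_(k < m.+1) erlang_int a k t * Y 0 k w)); first exact: cvg_cst.
  by apply/funext => n; apply: eq_bigr => k _; rewrite mxE.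
(* The integrator [- c (t - x)] is nondecreasing, and its increments are the grid weights. *)
have := @riemann_stieltjes R (b w) (fun x => erlang a m (t - x)) (fun x => - c (t - x)) (Phi w) t t0 (@cb w).
move=> /(_ _)/(cvgM (cvg_cst g0)) h.
apply: cvg_trans; last apply: h.
  apply: near_eq_cvg; near=> n; rewrite /= mulr_sumr; apply: eq_bigr => i _.
  rewrite /b grid_max0 ?(ltnW (ltn_ord i))// /grid_weight mulrA; congr (_ * _ * _).
  by rewrite opprK addrC.
move=> x xt; split; last exact: dPhi.
  by apply: erlang_ge0; rewrite subr_ge0; case/andP : xt.
apply: (is_derive_eq (is_derive_fN (is_derive_fcomp (is_derive_fB (is_derive_fcst t x)
  (is_derive_fid x)) (is_derive_erlang_int m (t - x) aN)))).
by rewrite sub0r mulrN1 opprK.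
Unshelve. all: by end_near. Qed.

Let grid_ge0 n (i : 'I_n.+1) : 0 <= grid t n i.
Proof. by have /andP[] := grid_bounds t0 (ltnW (ltn_ord i)). Qed.

Let psd v := @ou_covariance_psd R m a g0 v a0.

Let S_moments n : square_integrable P (S_ n) /\ mean P (S_ n) = 0.
Proof.
exact: (ou_combination_moments (ou_brownian hY) psd (ou_initial_law hY)).
Qed.

Let L := g0 ^+ 2 * ou_scaled_variance a m t.

Let S_inner (e : R) : 0 < e -> exists N, forall n n', (N <= n)%N -> (N <= n')%N ->
  `|inner P (S_ n) (S_ n') - L| <= e.
Proof.
(* [g0 ^+ 2 + 1] absorbs the factor [g0 ^+ 2] and is positive for every [g0]. *)
move=> e0; have g1 : 0 < g0 ^+ 2 + 1 by rewrite ltr_wpDl ?sqr_ge0.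
have c0 : c 0 = 0 by exact: erlang_int_at0.
have am : 0 <= a ^- m by rewrite invr_ge0 exprn_ge0// ltW.
have e1 : 0 < e / (g0 ^+ 2 + 1) by rewrite divr_gt0.
have [N hN] := grid_covariance_cvg t0 (@continuous_erlang_int R a m aN) c0 am
  (@erlang_int_lipschitz a t m a0) e1.
exists N => n n' Nn Nn'.
rewrite (ou_combination_inner (ou_brownian hY) psd (ou_initial_law hY)
  (ou_initial_independent hY) _ _ _ (@grid_ge0 n) (@grid_ge0 n')).
rewrite ou_initial_variance//.
have LB (w : R) : g0 ^+ 2 * ou_initial_part a m t + w - L = w - g0 ^+ 2 * ou_noise_part a m t.
  by rewrite /L /ou_scaled_variance; ring.
rewrite LB.
rewrite -(noise_part_reflect m aN t0).
rewrite (_ : \sum_i _ = g0 ^+ 2 * \sum_(i < n.+1) \sum_(j < n'.+1)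
   grid_weight c t n i * grid_weight c t n' j * Num.min (grid t n i) (grid t n' j)); last first.
  rewrite mulr_sumr; apply: eq_bigr => i _; rewrite mulr_sumr; apply: eq_bigr => j _.
  by ring.
rewrite -mulrBr normrM ger0_norm ?sqr_ge0//.
apply: le_trans (ler_wpM2l (sqr_ge0 _) (hN n n' Nn Nn')) _.
rewrite mulrCA -[leRHS]mulr1 ler_wpM2l ?(ltW e0)//.
by rewrite ler_pdivrMr// mul1r lerDl.
Qed.

Let XS : {ae P, forall w, S w = X w}.
Proof.
apply: filterS (ou_equation hY) => w hw; rewrite XE /S.
have m0 : Num.max 0 0 = 0 :> R by apply/max_idPl.
rewrite (@ou_path_integral R m a g0 t (y w) (b w) (Phi w) aN t0 (@cy w) (@dPhi w)) /y ?m0//.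
move=> s k s0; rewrite /b (max_idPl s0) (hw s k s0); congr (_ + _ + _).
apply: eq_Rintegral => r; rewrite inE set_itvE/= => /andP[r0 _].
by rewrite (max_idPl r0).
Qed.

Lemma integral_varianceE : integral_variance (fun s => Y s ord0) t =
  g0 ^+ 2 * ou_scaled_variance a m t.
Proof.
have mS : measurable_fun setT S.
  apply: (measurable_fun_cvg (h := S_)) => [n|w _]; last exact: S_cvg.
  by have [[]] := S_moments n.
have [sS mS0 SS] := L2_limit (fun n => (S_moments n).1) mS S_cvg S_inner
  (fun n => (S_moments n).2).
have [sX mX0 XX] := ae_eq_moments mS mX XS sS.
by rewrite /integral_variance (variance_centered sX) ?XX ?SS// mX0.
Qed.

End IntegralVariance.

(** * Real parameters from the hypotheses of the theorem *)

Lemma sqnorm2_wavevector_gt0 (R : realType) (d : nat) (n : 'rV[int]_d) : n != 0 ->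
  0 < sqnorm2 (wavevector R n).
Proof.
move=> n0; rewrite lt_neqAle sumr_ge0 ?andbT; last by move=> i _; exact: sqr_ge0.
apply: contra n0; rewrite eq_sym psumr_eq0; last by move=> i _; exact: sqr_ge0.
move=> /allP h; apply/eqP/rowP => i; have := h i (mem_index_enum i).
rewrite /= sqrf_eq0 !mxE mulf_eq0 gt_eqF ?mulr_gt0 ?pi_gt0//= intr_eq0.
by move/eqP.
Qed.

(** The strict order of [R[i]] includes equality of imaginary parts, so the inequality itself yields
    that [z] is real. *)
Lemma real_of_gt1 (R : realType) (r : R) (z : R[i]) : 0 < r -> (1 < r%:C%C * z)%R ->
  z = ((complex.Re z)%:C)%C /\ 1 < r * complex.Re z.
Proof.
move=> r0; case: z => x y; rewrite ltcE/= !mul0r subr0 addr0.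
by rewrite mulf_eq0 gt_eqF//= => /andP[/eqP -> ->].
Qed.

Local Open Scope complex_scope.
Theorem mainTheorem8 (R : realType) (d : nat) (hd : (0 < d)%N)
  (rho0 : R) (hrho0 : 0 < rho0)
  (G : R -> R)
  (hG_bounded : exists M : R, forall x : R, 0 <= x -> G x <= M)
  (hG_positive : forall x : R, 0 <= x -> 0 < G x)
  (hG_decreasing : forall x y : R, 0 <= x -> x < y -> G y < G x)
  (hG_derivable : derivable G rho0 1)
  (g0 : R) (hg0 : g0 = G rho0)
  (g1 : R) (hg1 : g1 = derive1 G rho0) (hg1_neg : g1 < 0)
  (W : 'rV[R]_d -> R) (hW : interaction_kernel W)
  (n : 'rV[int]_d) (hn : n != 0)
  (hunstable : 1 < (- 2 * rho0 * (g1 / g0))%:C * fourier_coef W n)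
  (K : nat) (hK : (0 < K)%N)
  (disp : R -> measure_display)
  (T : forall alpha : R, measurableType (disp alpha))
  (P : forall alpha : R, probability (T alpha) R)
  (B : forall alpha : R, R -> {RV (P alpha) >-> R})
  (Y : forall alpha : R, R -> 'I_K -> {RV (P alpha) >-> R})
  (hY : forall alpha : R, 0 < alpha -> stationary_ou alpha g0 (B alpha) (Y alpha)) :
  let q2 := sqnorm2 (wavevector R n) in
  let V (alpha : R) := integral_variance (fun s => Y alpha s (Ordinal hK)) in
  let root (alpha : R) (lambda : R[i]) :=
    dispersion_root K rho0 g0 g1 (fourier_coef W n) q2 alpha (V alpha) lambda in
  exists alphabar : R,
    [/\ 0 < alphabar /\ root alphabar 0,
        forall alpha : R, 0 < alpha -> root alpha 0 -> alpha = alphabar,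
        forall alpha : R, 0 < alpha -> alpha < alphabar ->
          forall lambda : R[i], root alpha lambda -> complex.Re lambda < 0 &
        forall alpha : R, alphabar < alpha ->
          exists lambda : R[i], root alpha lambda /\ 0 < complex.Re lambda].
Proof.
case: K hK Y hY => [//|m] hm Y hY q2 V root.
have g0_gt0 : 0 < g0 by rewrite hg0 hG_positive// ltW.
have r0 : 0 < - 2 * rho0 * (g1 / g0).
  by rewrite -mulrA mulNr oppr_gt0 pmulr_rlt0// pmulr_rlt0// pmulr_llt0 ?invr_gt0.
have [whatE unstable] := real_of_gt1 r0 hunstable.
have q2_gt0 : 0 < q2 by exact: sqnorm2_wavevector_gt0.
rewrite /root whatE; apply: dispersion_dichotomy => //.
  (* Multiplied by [q2 / 2 * g0 ^+ 2], the instability hypothesis becomes the inequality required by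
     [dispersion_dichotomy]. *)
  have := unstable; rewrite -(ltr_pM2l (_ : 0 < q2 / 2 * g0 ^+ 2)) ?mulr1; last first.
    by rewrite mulr_gt0 ?exprn_gt0 ?divr_gt0.
  set w := complex.Re _.
  rewrite (_ : _ * (_ * w) = - (rho0 * g0 * g1 * w * q2))//.
  by field; rewrite gt_eqF.
move=> a t a0 t0; rewrite /V.
have -> : Ordinal hm = ord0 by apply: val_inj.
exact: (integral_varianceE a0 t0 (hY a a0)).
Qed.
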